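(* Let $E$ be a finite set, $X=(X_t)_{t\in\mathbb{Z}}$ an $\mathbb{R}^d$-valued process of the form $X_t=g(S_t)$, and $V_t=(Y_t,X_t)$, where $q$, $\mathcal{D}$, $(S_t)$, $g$, $(Y_t)$, $\gamma$, $\widetilde{P}$, $(a_t)$, $(b_m)$, $(b_m^* )$, $(e_m)$, $\beta_V$ and $\tau_V$ are as described in the context. Assume that the following hold: (S1) $X$ is stationary and ergodic; (S1') there is a coupling kernel $\widetilde{P}$ for which $\lim_{t\to\infty}a_t=0$; (S2) $b_0<1$ and $\sum_{m\ge0}b_m<\infty$; (S3) there is a sequence $(e_m)_{m\in\mathbb{N}}$ of nonnegative real numbers with $\sum_{m\ge1}e_m<\infty$ such that for all $y\in E^{\mathbb{N}}$ and all covariate histories $z,z'$ (elements of $\{x_t^-:x\in\mathcal{D},t\in\mathbb{Z}\}$), $$d_{TV}\left(q(\cdot\vert y,z),q(\cdot\vert y,z')\right)\le\sum_{i\ge0}e_i|z_i-z_i'|.$$ 1. Assume that $\gamma$ is the discrete metric and $X_0\in\mathbb{L}^p$ for some $p\in[1,\infty]$. Set $q_*=\frac{p}{p-1}$ (so $1/q_*=1-1/p$) and $c_t=\max(1,2\|X_0\|_p)\,a_t^{1/q_*}$. Then for $n\in\mathbb{N}^*$, $$\beta_V(n)\le\sum_{j\ge n}g_j,$$ with $$g_j=b_{j-1}^*+c_j+\kappa_j+\sum_{i=0}^{j-2}b_i^*\kappa_{j-i-1},\qquad \kappa_j=\sum_{s=0}^{j-1}e_sc_{j-s}+2\sum_{s\ge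 j}e_s\,\mathbb{E}[|X_0|].$$ 2. Assume that $\gamma$ is the metric induced by the $\ell_1$-norm and $\mathbb{E}|X_0|<\infty$. Then for $n\in\mathbb{N}^*$, $$\tau_V(n)\le\sup_{j\ge n}h_j,$$ with $$h_j=b_{j-1}^*+a_j+\kappa_j+\sum_{i=0}^{j-2}b_i^*\kappa_{j-i-1},\qquad \kappa_j=\sum_{s=0}^{j-1}e_sa_{j-s}+2\sum_{s\ge j}e_s\,\mathbb{E}[|X_0|].$$
   Context: General notation. $\mathbb{N}=\{0,1,\ldots\}$, $\mathbb{N}^*=\mathbb{N}\setminus\{0\}$; $x_t^-=(x_t,x_{t-1},\ldots)$; $|\cdot|$ is the $\ell_1$-norm on $\mathbb{R}^d$; $\|X_0\|_p$ is the $\mathbb{L}^p$ norm of $|X_0|$. $d_{TV}(\nu_1,\nu_2)=\frac12\sum_{e\in E}|\nu_1(e)-\nu_2(e)|$. For $y,y'\in E^{\mathbb{N}}$, $y\stackrel{m}{=}y'$ means $y_i=y_i'$ for $0\le i\le m-1$. Empty sums are $0$. Model. $\mathcal{D}\in\mathcal{B}(\mathbb{R}^d)^{\otimes\mathbb{Z}}$ satisfies $\mathbb{P}(X\in\mathcal{D})=1$; for each $t$ the map $(w,y,x)\mapsto q(w\vert y,x_t^-)$ is measurable from $E\times E^{\mathbb{N}}\times\mathcal{D}$ to $(0,1)$, with $\sum_{w\in E}q(w\vert y,x_t^-)=1$. Set $$b_m=\sup\{d_{TV}(q(\cdot\vert y,x_t^-),q(\cdot\vert y',x_t^-)):y,y'\in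 E^{\mathbb{N}},x\in\mathcal{D},t\in\mathbb{Z},y\stackrel{m}{=}y'\}.$$ Define $b_0^*=b_0$ and, for $n\ge1$, $b_n^*=\mathbb{P}(S_n^{(b)}=0)$, where $(S^{(b)}_n)_{n\ge0}$ is the Markov chain on $\mathbb{N}$ started at $0$ with transitions $i\to i+1$ with probability $1-b_i$ and $i\to0$ with probability $b_i$. Covariates. $(S_t)_{t\in\mathbb{Z}}$ is a stationary Markov chain with values in a Polish space $\mathcal{S}$, with invariant probability $\pi$ (the law of $S_0$), $g:\mathcal{S}\to\mathbb{R}^d$ is measurable and $X_t=g(S_t)$. The process $(Y_t)_{t\in\mathbb{Z}}$ takes values in $E$ and satisfies $\mathbb{P}(Y_t=w\vert Y_{t-1}^-,S)=q(w\vert Y_{t-1}^-,X_t^-)$ for all $t\in\mathbb{Z}$, $w\in E$, where $S=(S_t)_{t\in\mathbb{Z}}$ (hence also $\mathbb{P}(Y_t=w\vert Y_{t-1}^-,X)=q(w\vert Y_{t-1}^-,X_t^-)$); under (S1)-(S2) such a process exists and is unique in law, and $(V_t)$ is stationary. Coupling. $P(s_0,\cdot)$ is the distribution on $\mathcal{S}^{\mathbb{N}^*}$ of $(S_t)_{t\ge1}$ conditional on $S_0=s_0$. $\widetilde{P}$ is a probability kernel from $\mathcal{S}^2$ to $\mathcal{S}^{\mathbb{N}^*}\times\mathcal{S}^{\mathbb{N}^*}$ (with Borel $\sigma$-fields) such that $\widetilde{P}((s_0,\overline{s}_0),\cdot)$ is a coupling of $P(s_0,\cdot)$ and $P(\overline{s}_0,\cdot)$;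 $\widetilde{E}_{s_0,\overline{s}_0}$ is expectation under it, and $S_{1,t},S_{2,t}$ are the coordinates $S_{1,t}(s,\overline{s})=s_t$, $S_{2,t}(s,\overline{s})=\overline{s}_t$. $\gamma$ is a metric on $\mathbb{R}^d$, either the discrete metric $\gamma(x_1,x_2)=\mathbf{1}_{x_1\ne x_2}$ or $\gamma(x_1,x_2)=|x_1-x_2|$. Set $$a_t=\int d\pi(s_0)\,d\pi(\overline{s}_0)\,\widetilde{E}_{s_0,\overline{s}_0}\left[\gamma(g(S_{1,t}),g(S_{2,t}))\right].$$ Dependence coefficients. $\beta_V(n)=\mathbb{E}\left[\sup_A\left|\mathbb{P}((V_n,V_{n+1},\ldots)\in A\vert\sigma(V_i:i\le0))-\mathbb{P}((V_n,V_{n+1},\ldots)\in A)\right|\right]$, the supremum being over measurable sets $A$. On $\overline{E}=E\times\mathbb{R}^d$ put $\overline{\gamma}(v,v')=\mathbf{1}_{v_1\ne v_1'}+|v_2-v_2'|$. For $\ell\ge1$ and probability measures $\mu,\nu$ on $\overline{E}^\ell$ with finite first moment (for $\sum_{j=1}^\ell\overline{\gamma}(v_j,v_0)$, $v_0\in\overline{E}$ fixed), $\mathcal{W}_{1,\ell}(\mu,\nu)=\sup\{\int f\,d\mu-\int f\,d\nu\}$ over functions $f:\overline{E}^\ell\to\mathbb{R}$ that are 1-Lipschitz for the metric $\sum_{i=1}^\ell\overline{\gamma}(w_i,w_i')$. With $\mathcal{F}_0=\sigma((Y_j,S_j):j\le0)$ and $U_J=(V_{j_1},\ldots,V_{j_\ell})$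 for $J=\{j_1<\cdots<j_\ell\}$, set $\tau(\mathcal{F}_0,U_J)=\mathbb{E}\,\mathcal{W}_{1,\ell}(\mathbb{P}_{U_J\vert\mathcal{F}_0},\mathbb{P}_{U_J})$, where $\mathbb{P}_{U_J\vert\mathcal{F}_0}$ is the conditional distribution of $U_J$ given $\mathcal{F}_0$, $$\tau^{(k)}(n)=\max_{1\le\ell\le k}\frac1\ell\sup\{\tau(\mathcal{F}_0,U_{\{j_1,\ldots,j_\ell\}}):n\le j_1<\cdots<j_\ell\},$$ and $\tau_V(n)=\sup_{k\ge1}\tau^{(k)}(n)$. *)

(* Defs.v *)
From HB Require Import structures.
From mathcomp Require Import all_boot all_order all_algebra.
From mathcomp Require Import all_classical all_reals all_analysis.

Set Implicit Arguments.
Unset Strict Implicit.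
Unset Printing Implicit Defensive.

Import Order.TTheory GRing.Theory Num.Theory.
Import numFieldNormedType.Exports.

Local Open Scope classical_set_scope.
Local Open Scope ring_scope.

Notation borelType T := (g_sigma_algebraType (@open T)).

Notation rvec R d := (borelType 'rV[R]_d).

(* Product sigma-algebra on T^I, generated by the coordinate maps. *)
Definition cylinders (I : Type) d (T : measurableType d) : set (set (I -> T)) :=
  \bigcup_(i in [set: I])
    preimage_set_system setT (fun x : I -> T => x i) measurable.

Notation pathType I T := (g_sigma_algebraType (@cylinders I _ T)).

Definition polish (R : realType) (T : topologicalType) : Prop :=
  @second_countable T /\
  exists dist : T -> T -> R,
    [/\ forall x y, (dist x y == 0) = (x == y),
        forall x y, dist x y = dist y x,
        forall x y z, dist x z <= dist x y + dist y z,
        forall (x : T) (A : set T), nbhs x A <->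
          exists2 r : R, 0 < r & [set y | dist x y < r] `<=` A &
        forall u : nat -> T,
          (forall r : R, 0 < r -> exists N : nat, forall m n : nat,
             (N <= m)%N -> (N <= n)%N -> dist (u m) (u n) < r) ->
          exists l : T, u @ \oo --> l].

(* past x t is x_t^- = (x_t, x_{t-1}, ...). *)
Definition past (T : Type) (x : int -> T) (t : int) : nat -> T :=
  fun i => x (t - i%:Z).

Definition l1norm (R : realType) d (x : 'rV[R]_d) : R := \sum_(i < d) `|x 0 i|.

Definition l1_metric (R : realType) d (x y : 'rV[R]_d) : R := l1norm (x - y).

Definition discrete_metric (R : realType) d (x y : 'rV[R]_d) : R :=
  (x != y)%:R.

Definition dTV (R : realType) (E : choiceType) (nu1 nu2 : E -> R) : R :=
  2^-1 * \sum_(w \in [set: E]) `|nu1 w - nu2 w|.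

Definition histories (T : Type) (D : set (int -> T)) : set (nat -> T) :=
  [set z | exists2 x, D x & exists t, z = past x t].

Definition coef_b (R : realType) (E : choiceType) (T : Type)
    (q : E -> (nat -> E) -> (nat -> T) -> R) (D : set (int -> T)) (m : nat) : R :=
  sup [set r | exists y y' z,
    [/\ histories D z, forall i, (i < m)%N -> y i = y' i &
        r = dTV (fun w => q w y z) (fun w => q w y' z)]].

Definition renewal_transition (R : realType) (b : nat -> R) (i j : nat) : R :=
  (if j == i.+1 then 1 - b i else 0) + (if j == 0%N then b i else 0).

(* Law of the chain started at 0; its support at time n is within {0, ..., n},
   so the sum over the previous state is finite. *)
Fixpoint renewal_law (R : realType) (b : nat -> R) (n : nat) : nat -> R :=
  if n is n'.+1 then
    fun j => \sum_(i < n'.+1) renewal_law b n' i * renewal_transition b i j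
  else fun j => (j == 0%N)%:R.

(* The value at n = 0 is b_0 by convention, not P(S_0 = 0) = 1. *)
Definition bstar (R : realType) (b : nat -> R) (n : nat) : R :=
  if n is 0%N then b 0%N else renewal_law b n 0%N.

Definition process_gen (I : Type) (O : Type) d (T : measurableType d)
    (J : set I) (Z : I -> O -> T) : set (set O) :=
  \bigcup_(i in J) preimage_set_system setT (Z i) measurable.

(* h is a version of P(B | F), for a sub-sigma-algebra F. Integrability of h
   is implied: the sets {h >= 0} and {h <= 0} belong to F. *)
Definition cond_prob_version (R : realType) d (O : measurableType d)
    (P : probability O R) (F : set (set O)) (B : set O) (h : O -> R) : Prop :=
  (forall A : set R, measurable A -> F (h @^-1` A)) /\
  (forall A : set O, F A -> (\int[P]_(o in A) (h o)%:E = P (A `&` B))%E).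

(* P(B | F) = phi almost surely. *)
Definition cond_prob_is (R : realType) d (O : measurableType d)
    (P : probability O R) (F : set (set O)) (B : set O) (phi : O -> R) : Prop :=
  exists2 h, cond_prob_version P F B h & {ae P, forall o, h o = phi o}.

(* k is a regular version of the conditional distribution of Z given F. *)
Definition cond_dist (R : realType) d d' (O : measurableType d)
    (T : measurableType d') (P : probability O R) (F : set (set O))
    (Z : O -> T) (k : O -> set T -> \bar R) : Prop :=
  forall A, measurable A ->
    cond_prob_version P F (Z @^-1` A) (fun o => fine (k o A)).

Definition stationary (R : realType) d d' (O : measurableType d)
    (T : measurableType d') (P : probability O R) (Z : int -> O -> T) : Prop :=
  forall (h : int) (A : set (pathType int T)), measurable A ->
    P [set o | A (fun t => Z (t + h) o)] = P [set o | A (fun t => Z t o)].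

Definition ergodic (R : realType) d d' (O : measurableType d)
    (T : measurableType d') (P : probability O R) (Z : int -> O -> T) : Prop :=
  forall A : set (pathType int T), measurable A ->
    (fun x : int -> T => fun t => x (t + 1)) @^-1` A = A ->
    P [set o | A (fun t => Z t o)] = 0%E \/ P [set o | A (fun t => Z t o)] = 1%E.

Definition markov_chain (R : realType) d d' (O : measurableType d)
    (T : measurableType d') (P : probability O R) (Z : int -> O -> T) : Prop :=
  exists K : R.-pker T ~> T, forall (t : int) (A : set T), measurable A ->
    cond_prob_is P <<s process_gen [set j | j <= t] Z >>
      (Z (t + 1) @^-1` A) (fun o => fine (K (Z t o) A)).

(* Coordinate k of a path in nat -> S is the state at time k + 1. *)
Definition future (O : Type) d (T : measurableType d) (Z : int -> O -> T)
    (o : O) : pathType nat T := fun k => Z k.+1%:Z o.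

Definition coupling_kernel (R : realType) d d' (S : measurableType d)
    (F : measurableType d') (P0 : R.-pker S ~> F)
    (Pt : R.-pker (S * S) ~> (F * F)%type) : Prop :=
  forall (s s' : S) (A : set F), measurable A ->
    Pt (s, s') (fst @^-1` A) = P0 s A /\ Pt (s, s') (snd @^-1` A) = P0 s' A.

(* The times of interest are t >= 1; the path coordinate t.-1 is time t. *)
Definition coef_a (R : realType) d dX (S : measurableType d)
    (nu : set S -> \bar R)
    (Pt : R.-pker (S * S) ~> (pathType nat S * pathType nat S)%type)
    (g : S -> 'rV[R]_dX) (gam : 'rV[R]_dX -> 'rV[R]_dX -> R) (t : nat) : \bar R :=
  (\int[nu]_s \int[nu]_s' \int[Pt (s, s')]_u
     (gam (g (u.1 t.-1)) (g (u.2 t.-1)))%:E)%E.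

(* kappa_j, with c in place of (c_t) or (a_t) and EX for E|X_0|. *)
Definition kappa (R : realType) (e : nat -> R) (c : nat -> \bar R)
    (EX : \bar R) (j : nat) : \bar R :=
  (\sum_(0 <= s < j) (e s)%:E * c (j - s)%N
   + 2%:E * ((\sum_(j <= s <oo) (e s)%:E) * EX))%E.

(* The common shape of g_j (with c_t for c) and h_j (with a_t for c). *)
Definition rate (R : realType) (b e : nat -> R) (c : nat -> \bar R)
    (EX : \bar R) (j : nat) : \bar R :=
  ((bstar b j.-1)%:E + c j + kappa e c EX j
   + \sum_(0 <= i < j.-1) (bstar b i)%:E * kappa e c EX (j - i - 1)%N)%E.

(* (V_n, V_{n+1}, ...) *)
Definition tail_from (O : Type) d (T : measurableType d) (V : int -> O -> T)
    (n : nat) (o : O) : pathType nat T := fun k => V (n + k)%:Z o.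

(* E[sup_A |P(Z in A | F) - P(Z in A)|], for a regular version k of the
   conditional distribution of Z given F. *)
Definition beta_coef (R : realType) d d' (O : measurableType d)
    (T : measurableType d') (P : probability O R) (Z : O -> T)
    (k : O -> probability T R) : \bar R :=
  (\int[P]_o ereal_sup
     [set `|k o A - P (Z @^-1` A)| | A in [set A : set T | measurable A]])%E.

Definition gamma_bar (R : realType) (E : choiceType) d
    (v v' : E * 'rV[R]_d) : R :=
  (v.1 != v'.1)%:R + l1norm (v.2 - v'.2).

Definition lipschitz1 (R : realType) (E : choiceType) d (l : nat)
    (f : ('I_l -> E * 'rV[R]_d) -> R) : Prop :=
  forall v v', `|f v - f v'| <= \sum_(i < l) gamma_bar (v i) (v' i).

Definition W1 (R : realType) dE (E : measurableType dE) d (l : nat)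
    (mu nu : set (pathType 'I_l (E * rvec R d)%type) -> \bar R) : \bar R :=
  ereal_sup [set (\int[mu]_v (f v)%:E - \int[nu]_v (f v)%:E)%E
            | f in @lipschitz1 R E d l].

(* U_J for J = {j_1 < ... < j_l}, given by its enumeration j. *)
Definition pick_times (O : Type) d (T : measurableType d) (V : int -> O -> T)
    (l : nat) (j : 'I_l -> nat) (o : O) : pathType 'I_l T :=
  fun i => V (j i)%:Z o.

Definition increasing (l : nat) (j : 'I_l -> nat) : Prop :=
  forall i i' : 'I_l, (i < i')%N -> (j i < j i')%N.

(* tau(F_0, U_J), for a regular version k of the conditional distribution of
   U_J given F_0. *)
Definition tau_coef (R : realType) d dE (O : measurableType d)
    (E : measurableType dE) dX (P : probability O R)
    (V : int -> O -> E * rvec R dX) (l : nat) (j : 'I_l -> nat)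
    (k : O -> probability (pathType 'I_l (E * rvec R dX)%type) R) : \bar R :=
  (\int[P]_o W1 (k o) (fun A => P (pick_times V j @^-1` A)))%E.

Definition tau_upto (R : realType) d dE (O : measurableType d)
    (E : measurableType dE) dX (P : probability O R)
    (V : int -> O -> E * rvec R dX)
    (kU : forall l, ('I_l -> nat) ->
       O -> probability (pathType 'I_l (E * rvec R dX)%type) R)
    (k n : nat) : \bar R :=
  (\big[maxe/-oo]_(1 <= l < k.+1)
     ((l%:R^-1)%:E *
      ereal_sup [set tau_coef P V j (kU l j) | j in
        [set j : 'I_l -> nat | increasing j /\ forall i, (n <= j i)%N]]))%E.

Definition tau_sup (R : realType) d dE (O : measurableType d)
    (E : measurableType dE) dX (P : probability O R)
    (V : int -> O -> E * rvec R dX)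
    (kU : forall l, ('I_l -> nat) ->
       O -> probability (pathType 'I_l (E * rvec R dX)%type) R)
    (n : nat) : \bar R :=
  ereal_sup [set tau_upto P V kU k n | k in [set k | (1 <= k)%N]].

(* Main.v *)
Require Import Defs.
From HB Require Import structures.
From mathcomp Require Import all_boot all_order all_algebra.
From mathcomp Require Import all_classical all_reals all_analysis.
From mathcomp Require Import finmap measurable_realfun simple_functions lebesgue_integral_definition ess_sup_inf.
From mathcomp Require Import lra ring zify.

(** Write F for the past: the responses and the states up to time 0. Both
    coefficients compare the law of future observations given F with their
    unconditional law, through test functions that are Lipschitz in the
    observed values.

    The coupling. Take two independent copies of the past and let the two state
    chains run from their states at time 0 under the coupling kernel. Given the
    two covariate paths, the responses are two chains with complete
    connections, run under optimal couplings of their transitions. If the last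
    [n] responses agree, the next ones disagree with probability at most [b n]
    plus the covariate discrepancy [sum_i e_i |x_(t-i) - x'_(t-i)|]. So the
    length of the common suffix moves like the renewal chain, up to additional
    resets charged to the discrepancies, and the responses at time [j] disagree
    with probability at most [bstar b j.-1] plus the discrepancies weighted by
    the probabilities that the renewal chain is back at 0 ([back_coupling]).
    Integrating the discrepancies over the coupling produces [kappa]: the
    distances at positive times are bounded by [a] or [c], those at times at
    most 0 by [2 E|X_0|]. Hence the expected cost of the observation at time
    [j] is at most [rate] at [j] ([integral_coupling_cost]).

    Each side of the coupling must be a copy of the original process jointly
    with its past. This requires the responses up to time 0 to be independent
    of the future states given the states up to time 0
    ([history_law_integral]). It follows from loss of memory: since [b 0 < 1]
    and the [b m] are summable, the renewal chain returns to 0 with vanishing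
    probability, so a response chain started in the remote past forgets its
    initial history ([remote_past]), and the law of the responses given all the
    states is a limit of functions of the covariates up to time 0.

    The suprema. Both coefficients average over F a supremum over uncountably
    many test functions. A countable class suffices: for total variation, the
    sets of a countable algebra of cylinders ([algebra_sup_dist]); for the
    Wasserstein distance, lower envelopes of finitely many cones with rational
    apices, which approximate every 1-Lipschitz function ([W1_le_envelope]).
    Among finitely many test functions, the events on which each is the first
    to maximize the gap are disjoint events of the past, and one and the same
    coupling serves them all, so the sum over these events costs only one
    coupling ([coupled_partition]); monotone convergence reaches the supremum
    over the class ([integral_sup_gap]).

    A set of the algebra depends on finitely many times, and its indicator
    varies by at most the number of times at which two paths differ. For the
    discrete metric this gives the series of rates, where the mean distance
    between the covariates is bounded by [c] through Hoelder's inequality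
    ([integral_gap_discrete]). For the l1 metric, [l] observations cost at most
    [l] times the supremum of the rates ([tau_sup_le]). *)

Set Implicit Arguments.
Unset Strict Implicit.
Unset Printing Implicit Defensive.

Import Order.TTheory GRing.Theory Num.Theory.
Import numFieldNormedType.Exports.

Local Open Scope classical_set_scope.
Local Open Scope ring_scope.

(** * The renewal chain *)

(** Probability that the chain started at [i] sits at 0 after [m] steps, by
    conditioning on the first step; this backward form, unlike the forward
    law, lets the starting state vary, which the inductions below need. *)
Fixpoint ret (R : realType) (b : nat -> R) (m i : nat) : R :=
  if m is m'.+1 then (1 - b i) * ret b m' i.+1 + b i * ret b m' 0
  else (i == 0%N)%:R.

Section renewal.
Context (R : realType) (b : nat -> R).

Lemma renewal_law_ret n m :
  \sum_(i < n.+1) renewal_law b n i * ret b m i = ret b (n + m) 0.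
Proof.
elim: n m => [|n IH] m; first by rewrite big_ord1 /= mul1r.
rewrite addSnnS -IH /=.
rewrite (eq_bigr (fun j : 'I_n.+2 => \sum_(i < n.+1)
  renewal_law b n i * (renewal_transition b i j * ret b m j))); last first.
  by move=> j _; rewrite mulr_suml; apply: eq_bigr => i _; rewrite mulrA.
rewrite exchange_big; apply: eq_bigr => i _; rewrite -mulr_sumr; congr (_ * _).
rewrite /renewal_transition (eq_bigr (fun j : 'I_n.+2 =>
  (if j == i.+1 :> nat then (1 - b i) * ret b m i.+1 else 0) +
  (if j == 0 :> nat then b i * ret b m 0 else 0))); last first.
  move=> j _; rewrite mulrDl; congr (_ + _).
    by case: eqP => [->|_] //; rewrite mul0r.
  by case: eqP => [->|_] //; rewrite mul0r.
rewrite big_split /= -!big_mkcond /=; congr (_ + _).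
- by rewrite (big_pred1 (lift ord0 i)).
- by rewrite (big_pred1 ord0).
Qed.

Lemma renewal_law0E n : renewal_law b n 0%N = ret b n 0.
Proof.
rewrite -{2}(addn0 n) -renewal_law_ret big_ord_recl /= mulr1 big1 ?addr0//.
by move=> i _; rewrite mulr0.
Qed.

Hypothesis b01 : forall i, 0 <= b i <= 1.
Hypothesis b_dec : forall i, b i.+1 <= b i.

Lemma ret01 m i : 0 <= ret b m i <= 1.
Proof.
elim: m i => [|m IH] i /=; first by case: eqP => _; rewrite ?ler01 ?lexx.
have := b01 i; have := IH i.+1; have := IH 0%N.
by move=> /andP[? ?] /andP[? ?] /andP[? ?]; apply/andP; split; nra.
Qed.

Lemma ret_dec m i : ret b m i.+1 <= ret b m i.
Proof.
elim: m i => [|m IH] i /=; first by case: eqP => _; rewrite ?ler01 ?lexx.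
have h0 : ret b m i.+1 <= ret b m 0.
  by elim: (i.+1) => // k; exact: le_trans.
have := b01 i; have := b01 i.+1; have := b_dec i; have := IH i.+1.
move=> ? ? /andP[? ?] /andP[? ?]; nra.
Qed.

Lemma ret_le0 m i : ret b m i <= ret b m 0.
Proof. by elim: i => // k; exact/le_trans/ret_dec. Qed.

Lemma ret_decn m : ret b m.+1 0 <= ret b m 0.
Proof.
by rewrite /=; have := b01 0; have := ret_le0 m 1 => ? /andP[? ?]; nra.
Qed.

(** The convention b*_0 = b_0 replaces P(S_0 = 0) = 1 by P(S_1 = 0), so b* is
    nonincreasing and dominates the return probabilities one step later. *)
Lemma ret_le_bstar m : ret b m.+1 0 <= bstar b m.
Proof.
case: m => [|m]; first by rewrite /= mulr0 add0r mulr1.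
by rewrite /bstar renewal_law0E; exact: ret_decn.
Qed.

(** [p] plays the part of the escape probability [P_i(S never returns)]: its
    subharmonicity makes [1 / p 0] bound the expected number of visits. *)
Lemma ret_green (p : nat -> R) n : 0 < p 0 -> (forall i, p i <= 1) ->
  (forall i, p i <= (1 - b i) * p i.+1) ->
  \sum_(k < n) ret b k 0 <= (p 0)^-1.
Proof.
move=> p0 p1 pS.
suff H i : \sum_(k < n) ret b k i <=
    if i is 0%N then (p 0)^-1 else (1 - p i) / p 0 by exact: (H 0%N).
elim: n i => [|n IH] i.
  rewrite big_ord0; case: i => [|i]; first by rewrite invr_ge0 ltW.
  by rewrite divr_ge0// ?subr_ge0// ltW.
rewrite big_ord_recl /= (eq_bigr (fun k : 'I_n =>
  (1 - b i) * ret b k i.+1 + b i * ret b k 0)); last by [].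
rewrite big_split /= -!mulr_sumr.
have := IH i.+1; have := IH 0%N => /= h0 h1.
have /andP[bi0 bi1] := b01 i.
have {}h1 : (1 - b i) * \sum_(i0 < n) ret b i0 i.+1 <=
  (1 - b i) * ((1 - p i.+1) / p 0) by rewrite ler_wpM2l// subr_ge0.
have {}h0 : b i * \sum_(i0 < n) ret b i0 0 <= b i * (p 0)^-1.
  by rewrite ler_wpM2l.
have : (1 - b i) * ((1 - p i.+1) / p 0) + b i * (p 0)^-1
   <= (1 - p i) / p 0.
  rewrite mulrA -mulrDl ler_pM2r ?invr_gt0//.
  by have := pS i; nra.
case: i h0 h1 {bi0 bi1} => [|i] h0 h1 h2 /=; last by lra.
by have : (1 - p 0) / p 0 = (p 0)^-1 - 1; [by field; lra|lra].
Qed.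

Lemma ret_anti n k : (k <= n)%N -> ret b n 0 <= ret b k 0.
Proof.
elim: n => [|n IH]; first by rewrite leqn0 => /eqP ->.
rewrite leq_eqVlt => /predU1P[->//|/IH]; exact/le_trans/ret_decn.
Qed.

Lemma ret_cvg0_aux C n : (forall n, \sum_(k < n) ret b k 0 <= C) ->
  n%:R * ret b n 0 <= C.
Proof.
move=> /(_ n); apply: le_trans.
rewrite mulr_natl -[X in X <= _](_ : \sum_(k < n) ret b n 0 = _); last first.
  by rewrite sumr_const card_ord.
by apply: ler_sum => k _; exact/ret_anti/ltnW.
Qed.

(** Summability gives a tail [T i = sum_(l >= i) b_l] with [T N <= 1/2]; then
    [1 - T i] is subharmonic from [N] on, and finitely many factors
    [1 - b_0 > 0] carry it down to 0. *)
Lemma ret_cvg0 : b 0 < 1 -> (\sum_(0 <= m <oo) (b m)%:E < +oo)%E ->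
  exists C, forall n, n%:R * ret b n 0 <= C.
Proof.
move=> b0 bs.
have b0n i : (0 <= (b i)%:E)%E by rewrite lee_fin; have /andP[] := b01 i.
pose T i : \bar R := (\sum_(i <= m <oo) (b m)%:E)%E.
have T0 i : (0 <= T i)%E by apply: nneseries_ge0 => *.
have TS i : T i = ((b i)%:E + T i.+1)%E.
  by rewrite /T (@nneseries_split _ _ i 1)// addn1 big_nat1.
have Tfin i : T i \is a fin_num.
  rewrite ge0_fin_numE//; apply: le_lt_trans bs.
  elim: i => // i; by apply: le_trans; rewrite (TS i) leeDr.
have Tcvg : T @ \oo --> 0%E.
  by apply: nneseries_tail_cvg => // k _; exact: b0n.
pose t i := fine (T i).
have tS i : t i = b i + t i.+1 by rewrite /t TS fineD.
have t0 i : 0 <= t i by exact: fine_ge0.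
have [N tN] : exists N, t N <= 2^-1.
  have /fine_cvg/cvgrPdist_le/(_ 2^-1) : T @ \oo --> (0%R)%:E by [].
  move=> HH; have : (0 : R) < 2^-1 by rewrite invr_gt0 ltr0n.
  move=> /HH[N _ NH]; exists N.
  by have /= := NH N; rewrite sub0r normrN ger0_norm//; [exact|exact: t0].
have tdec i : t i.+1 <= t i by rewrite (tS i); have /andP[] := b01 i; lra.
have b_le i : b i <= b 0 by elim: i => // i; exact/le_trans/b_dec.
have tNi i : (N <= i)%N -> t i <= 2^-1.
  move=> /subnKC <-; elim: (i - N)%N => [|k IH]; first by rewrite addn0.
  by rewrite addnS; exact/(le_trans (tdec _)).
pose p i := (1 - b 0) ^+ (N - i) * (1 - t (maxn N i)).
have b00 : 0 <= b 0 by have /andP[] := b01 0.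
exists (p 0)^-1 => n; apply: ret_cvg0_aux => {}n; apply: ret_green.
- rewrite /p mulr_gt0// ?exprn_gt0 ?subr_gt0//.
  by have := tNi (maxn N 0) (leq_maxl _ _); lra.
- move=> i; rewrite /p mulr_ile1 ?exprn_ge0 ?exprn_ile1//; try lra.
    by have := tNi (maxn N i) (leq_maxl _ _); lra.
  by have := t0 (maxn N i); lra.
- move=> i; rewrite /p; have [Ni|iN] := leqP N i.
    rewrite (eqP (_ : (N - i == 0)%N)) ?subn_eq0//.
    rewrite (eqP (_ : (N - i.+1 == 0)%N)) ?subn_eq0//; last exact: leqW.
    rewrite (maxn_idPr (leqW Ni)) (tS i) !expr0 !mul1r.
    by have := t0 i.+1; have /andP[] := b01 i; nra.
  rewrite (maxn_idPl iN) mulrA ler_wpM2r//.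
    by have := tNi N (leqnn _); lra.
  rewrite -(subnSK iN) exprS ler_wpM2r ?exprn_ge0//; first by lra.
  by have := b_le i; lra.
Qed.

End renewal.

(** * Coupling two chains with complete connections *)

Section coupling_step.
Context (R : realType) (T : eqType) (es : seq T).

Lemma seq_argmin (F : T -> R) : es != [::] ->
  exists2 w0, w0 \in es & forall w, w \in es -> F w0 <= F w.
Proof.
elim: es => // w [|w' s] IH _.
  by exists w; rewrite ?mem_head// => v; rewrite inE => /eqP ->.
have [//|w0 w0s w0le] := IH.
have [ww0|w0w] := leP (F w) (F w0).
  exists w; rewrite ?mem_head// => v; rewrite inE => /predU1P[->//|/w0le].
  exact: le_trans.
exists w0; first by rewrite inE w0s orbT.
by move=> v; rewrite inE => /predU1P[->|/w0le//]; exact: ltW.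
Qed.

(** The optimal coupling of [p] and [p'] puts mass [min (p w) (p' w)] on each
    diagonal point, where the gap is at most [D1]; the remaining mass [theta]
    pays at most [D2]. *)
Lemma coupling_step (p p' F F' : T -> R) (D1 D2 : R) :
  let theta := 2^-1 * \sum_(w <- es) `|p w - p' w| in
  (forall w, 0 <= p w) -> (forall w, 0 <= p' w) ->
  \sum_(w <- es) p w = 1 -> \sum_(w <- es) p' w = 1 ->
  (forall w, `|F w - F' w| <= D1) -> (forall w w', `|F w - F' w'| <= D2) ->
  `|\sum_(w <- es) p w * F w - \sum_(w <- es) p' w * F' w|
    <= (1 - theta) * D1 + theta * D2.
Proof.
move=> theta; wlog H : p p' F F' @theta / \sum_(w <- es) p' w * F' w <=
    \sum_(w <- es) p w * F w.
  move=> W p0 p'0 p1 p'1 FD1 FD2.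
  have [|/ltW] := leP (\sum_(w <- es) p' w * F' w) (\sum_(w <- es) p w * F w).
    by move=> h; exact: W.
  move=> h; rewrite distrC.
  have -> : theta = 2^-1 * \sum_(w <- es) `|p' w - p w|.
    by rewrite /theta; congr (_ * _); apply: eq_bigr => w _; exact: distrC.
  by apply: W => // [w|w w']; rewrite distrC.
move=> p0 p'0 p1 p'1 FD1 FD2.
rewrite ger0_norm ?subr_ge0//.
have esn0 : es != [::].
  by apply/eqP => es0; move: p1; rewrite es0 big_nil => /eqP; rewrite eq_sym oner_eq0.
have [w0 _ w0min] := seq_argmin F' esn0.
pose m w := Num.min (p w) (p' w).
have m0 w : 0 <= m w by rewrite le_min p0 p'0.
have mp w : m w <= p w by rewrite ge_min lexx.
have mp' w : m w <= p' w by rewrite ge_min lexx orbT.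
have Em w : `|p w - p' w| = p w + p' w - 2 * m w.
  rewrite /m; have [h|/ltW h] := leP (p w) (p' w).
    by rewrite ler0_norm ?subr_le0//; ring.
  by rewrite ger0_norm ?subr_ge0//; ring.
have thE : theta = 1 - \sum_(w <- es) m w.
  rewrite /theta (eq_bigr _ (fun w _ => Em w)) sumrB big_split /= p1 p'1 -mulr_sumr.
  by field.
set c := F' w0.
have Fc w : F w <= c + D2.
  by have := FD2 w w0; rewrite ler_norml => /andP[_]; rewrite lerBlDl.
have e1 : \sum_(w <- es) p w * F w - \sum_(w <- es) p' w * F' w =
  \sum_(w <- es) (m w * (F w - F' w)) +
  (\sum_(w <- es) (p w - m w) * F w - \sum_(w <- es) (p' w - m w) * F' w).
  by rewrite -!sumrB -big_split; apply: eq_bigr => w _ /=; ring.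
have e2 : (1 - theta) * D1 + theta * D2 = \sum_(w <- es) (m w * D1) +
  (\sum_(w <- es) (p w - m w) * (c + D2) - \sum_(w <- es) (p' w - m w) * c).
  by rewrite -!mulr_suml !sumrB p1 p'1 thE; ring.
rewrite e1 e2 lerD// ?lerB//.
- apply: ler_sum => w _; rewrite ler_wpM2l//.
  by have := FD1 w; rewrite ler_norml => /andP[].
- by apply: ler_sum => w _; rewrite ler_wpM2l// subr_ge0.
- rewrite big_seq [leRHS]big_seq; apply: ler_sum => w wes.
  by rewrite ler_wpM2l ?subr_ge0// w0min.
Qed.

End coupling_step.

Definition scons (T : Type) (w : T) (y : nat -> T) : nat -> T :=
  fun i => if i is i'.+1 then y i' else w.

(** Expectation of [Phi] after [M] steps of the chain started from the history
    [y] at time [k]; [p k] gives the transition out of time [k]. *)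
Fixpoint back (R : realType) (T : eqType) (es : seq T)
    (p : nat -> T -> (nat -> T) -> R) (M k : nat) (Phi : (nat -> T) -> R)
    (y : nat -> T) : R :=
  if M is M'.+1 then
    \sum_(w <- es) p k w y * back es p M' k.+1 Phi (scons w y)
  else Phi y.

Section coupling.
Context (R : realType) (T : eqType) (es : seq T) (b : nat -> R).
Hypothesis b01 : forall i, 0 <= b i <= 1.
Hypothesis b_dec : forall i, b i.+1 <= b i.

(** Bound for the probability that two coupled chains which at time [k] agree
    on their last [n] symbols disagree at time [j]; [delta l] is the part of
    the transition discrepancy out of time [l] caused by the covariates. *)
Definition mismatch (delta : nat -> R) (k j n : nat) : R :=
  ret b (j - k) n + \sum_(k <= l < j) delta l * ret b (j - l.+1) 0.

Lemma mismatchS (delta : nat -> R) k j n theta : (k < j)%N ->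
  0 <= delta k -> theta <= b n + delta k ->
  (1 - theta) * mismatch delta k.+1 j n.+1 + theta * mismatch delta k.+1 j 0
    <= mismatch delta k j n.
Proof.
move=> kj d0 th; rewrite /mismatch [in leRHS]big_ltn// -[in leRHS](subnSK kj) /=.
have := ret_le0 b01 b_dec (j - k.+1) n.+1.
have /andP[] := ret01 b01 (j - k.+1) n.+1.
move: (ret b _ n.+1) (ret b _ 0) (\sum_(_ <= _ < _) _) => r1 r0 s; nra.
Qed.

Lemma mismatch0_le (delta : nat -> R) k j n :
  mismatch delta k j n <= mismatch delta k j 0.
Proof. by rewrite lerD2r; exact: ret_le0. Qed.

Lemma mismatchkk (delta : nat -> R) k n : mismatch delta k k n = (n == 0%N)%:R.
Proof. by rewrite /mismatch subnn big_geq// addr0. Qed.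

(** Running the two chains under optimal couplings of their transitions, by
    induction on the number [M] of remaining steps: agreement on the next
    symbol lengthens the common suffix, disagreement resets it to 0, which is
    the motion of the renewal chain up to the perturbation [delta]. *)
Lemma back_coupling (I : eqType) (s : seq I) (j : I -> nat) (Gam : R)
  (p p' : nat -> T -> (nat -> T) -> R) (delta : nat -> R)
  (Phi Phi' : (nat -> T) -> R) (M k n : nat) (y y' : nat -> T) :
  (forall l w z, 0 <= p l w z) -> (forall l w z, 0 <= p' l w z) ->
  (forall l z, \sum_(w <- es) p l w z = 1) ->
  (forall l z, \sum_(w <- es) p' l w z = 1) ->
  (forall l, 0 <= delta l) ->
  (forall l m z z', (forall i, (i < m)%N -> z i = z' i) ->
     2^-1 * \sum_(w <- es) `|p l w z - p' l w z'| <= b m + delta l) ->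
  (forall i, i \in s -> (j i <= k + M)%N) ->
  (forall z z', `|Phi z - Phi' z'| <=
     \sum_(i <- s) (z (k + M - j i)%N != z' (k + M - j i)%N)%:R + Gam) ->
  (forall i, (i < n)%N -> y i = y' i) ->
  `|back es p M k Phi y - back es p' M k Phi' y'| <=
    \sum_(i <- s) (if (j i <= k)%N then (y (k - j i)%N != y' (k - j i)%N)%:R
                   else mismatch delta k (j i) n) + Gam.
Proof.
move=> p0 p'0 p1 p'1 d0 pp' + PP'.
elim: M k n y y' PP' => [|M IH] k n y y' PP' jM yy'.
  rewrite /= (le_trans (PP' _ _))// lerD2r addn0.
  rewrite [leRHS]big_seq big_seq; apply: ler_sum => i /jM.
  by rewrite addn0 => ->.
rewrite /=; set th := 2^-1 * \sum_(w <- es) `|p k w y - p' k w y'|.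
pose D1 : R := \sum_(i <- s) (if (j i <= k)%N
  then (y (k - j i)%N != y' (k - j i)%N)%:R
  else mismatch delta k.+1 (j i) n.+1) + Gam.
pose D2 : R := \sum_(i <- s) (if (j i <= k)%N
  then (y (k - j i)%N != y' (k - j i)%N)%:R
  else mismatch delta k.+1 (j i) 0) + Gam.
have D12 : D1 <= D2.
  rewrite lerD2r; apply: ler_sum => i _; case: ifP => // _.
  exact: mismatch0_le.
have thb : th <= b n + delta k by exact: pp'.
apply: (@le_trans _ _ ((1 - th) * D1 + th * D2)).
  apply: coupling_step => // [w|w w'].
    apply: le_trans (IH k.+1 n.+1 _ _ _ _ _) _.
    - by rewrite addSnnS.
    - by rewrite addSnnS.
    - by case.
    rewrite lerD2r; apply: ler_sum => i _.
    have [jk|] := leqP (j i) k; first by rewrite ltnW// subSn.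
    rewrite leq_eqVlt => /predU1P[<-|kj]; last by rewrite leqNgt kj.
    by rewrite leqnn subnn /= eqxx mismatchkk.
  have [->|ww'] := eqVneq w w'; last first.
    apply: le_trans (IH k.+1 0 _ _ _ _ _) _.
    - by rewrite addSnnS.
    - by rewrite addSnnS.
    - by [].
    rewrite lerD2r; apply: ler_sum => i _.
    have [jk|] := leqP (j i) k; first by rewrite ltnW// subSn.
    rewrite leq_eqVlt => /predU1P[<-|kj]; last by rewrite leqNgt kj.
    by rewrite leqnn subnn /= mismatchkk; case: eqP; rewrite ?ler01.
  apply: le_trans D12; apply: le_trans (IH k.+1 n.+1 _ _ _ _ _) _.
  - by rewrite addSnnS.
  - by rewrite addSnnS.
  - by case.
  rewrite lerD2r; apply: ler_sum => i _.
  have [jk|] := leqP (j i) k; first by rewrite ltnW// subSn.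
  rewrite leq_eqVlt => /predU1P[<-|kj]; last by rewrite leqNgt kj.
  by rewrite leqnn subnn /= eqxx mismatchkk.
rewrite /D1 /D2 !mulrDr addrACA -[Gam in leRHS]mul1r -mulrDl subrK lerD2r.
rewrite !mulr_sumr -big_split /=; apply: ler_sum => i _.
have [jk|kj] := leqP (j i) k; first by rewrite -mulrDl subrK mul1r.
exact: mismatchS.
Qed.

End coupling.

(** * Integrals of nonnegative functions *)

Section integral_tools.
Local Open Scope ereal_scope.
Import HBNNSimple.

Lemma ge0_measurable_ind d (T : measurableType d) (R : realType)
    (Q : (T -> \bar R) -> Prop) :
  (forall A, measurable A -> Q (fun x => (\1_A x)%:E)) ->
  (forall (k : R) (f : T -> \bar R), (0 <= k)%R -> measurable_fun setT f ->
     (forall x, 0 <= f x) -> Q f -> Q (fun x => k%:E * f x)) ->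
  (forall f g : T -> \bar R, measurable_fun setT f -> (forall x, 0 <= f x) ->
     measurable_fun setT g -> (forall x, 0 <= g x) ->
     Q f -> Q g -> Q (fun x => f x + g x)) ->
  (forall F : nat -> T -> \bar R, (forall n, measurable_fun setT (F n)) ->
     (forall n x, 0 <= F n x) -> (forall x, nondecreasing_seq (F^~ x)) ->
     (forall n, Q (F n)) -> Q (fun x => limn (F^~ x))) ->
  forall f, measurable_fun setT f -> (forall x, 0 <= f x) -> Q f.
Proof.
move=> Qi Qz Qd Ql f mf f0.
pose F n : {nnsfun T >-> R} := nnsfun_approx measurableT mf n.
have -> : f = fun x => limn ((fun n x => (F n x)%:E)^~ x).
  apply/funext => x; apply/esym/cvg_lim => //.
  exact: cvg_nnsfun_approx.
apply: Ql => [n|n x|x m n mn|n].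
- exact/measurable_EFinP.
- by rewrite lee_fin.
- by rewrite lee_fin; exact/lefP/nd_nnsfun_approx.
set h := F n.
rewrite (_ : (fun x => _) = fun x => \sum_(y <- fset_set (range h))
    (y * \1_(h @^-1` [set y]) x)%:E); last first.
  by apply/funext => x; rewrite fimfunE fsbig_finite//= sumEFin.
suff : forall s : seq R, Q (fun x => \sum_(y <- s)
    (y * \1_(h @^-1` [set y]) x)%:E) /\ measurable_fun setT (fun x => \sum_(y <- s)
    (y * \1_(h @^-1` [set y]) x)%:E) by move=> /(_ (fset_set (range h)))[].
have P0 y x : 0 <= (y * \1_(h @^-1` [set y]) x)%:E.
  by rewrite EFinM nnfun_muleindic_ge0.
have mP y : measurable_fun setT (fun x => (y * \1_(h @^-1` [set y]) x)%:E).
  exact/measurable_EFinP/measurableT_comp.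
elim => [|y s [IH1 IH2]].
  rewrite (_ : (fun x => _) = fun x => (\1_set0 x)%:E).
    by split; [exact: Qi|exact/measurable_EFinP].
  by apply/funext => x; rewrite big_nil indic0.
rewrite (_ : (fun x => _) = fun x => (y * \1_(h @^-1` [set y]) x)%:E +
    \sum_(y <- s) (y * \1_(h @^-1` [set y]) x)%:E); last first.
  by apply/funext => x; rewrite big_cons.
split; last exact: emeasurable_funD.
apply: Qd => //; first by move=> x; apply: sume_ge0.
have [y0|y0] := leP 0%R y.
  by apply: (Qz y (fun x => (\1_(h @^-1` [set y]) x)%:E)) => //;
    [exact/measurable_EFinP|exact: Qi].
rewrite (_ : (fun x => _) = fun x => (\1_set0 x)%:E); first exact: Qi.
by apply/funext => x; rewrite preimage_nnfun0// !indic0 mulr0.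
Qed.

(** Monotonicity for a possibly nonmeasurable integrand, which the integral
    defined as a supremum over simple functions enjoys; the measurable bound
    need only hold almost everywhere. *)
Lemma ae_le_integral_nonmeasurable d (T : measurableType d) (R : realType)
    (mu : {measure set T -> \bar R}) (f g : T -> \bar R) :
  (forall x, 0 <= f x) -> (forall x, 0 <= g x) -> measurable_fun setT g ->
  {ae mu, forall x, f x <= g x} -> \int[mu]_x f x <= \int[mu]_x g x.
Proof.
move=> f0 g0 mg [N [mN N0 fgN]].
rewrite ge0_integralTE//; apply: ge_ereal_sup => _ [h /= hf <-].
rewrite -integralT_nnsfun; apply: ae_ge0_le_integral => //.
- by move=> x _; rewrite lee_fin.
- exact/measurable_EFinP.
exists N; split => // x /= fgx; apply: fgN => /= fg; apply: fgx => _.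
exact: le_trans (hf x) fg.
Qed.

Section bind.
Context d (T : measurableType d) (R : realType).

Lemma measurable_fun_ge0_integral d1 (O : measurableType d1)
    (k : O -> {measure set T -> \bar R}) (f : T -> \bar R) :
  (forall A, measurable A -> measurable_fun setT (fun o => k o A)) ->
  measurable_fun setT f -> (forall x, 0 <= f x) ->
  measurable_fun setT (fun o => \int[k o]_x f x).
Proof.
move=> mk; apply: (@ge0_measurable_ind _ T R (fun f =>
  measurable_fun setT (fun o => \int[k o]_x f x))) => {f}.
- move=> A mA; rewrite (_ : (fun _ => _) = fun o => k o A); first exact: mk.
  by apply/funext => o; rewrite integral_indic// setIT.
- move=> c f c0 mf f0 If.
  rewrite (_ : (fun _ => _) = fun o => c%:E * \int[k o]_x f x).
    exact: measurable_funeM.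
  by apply/funext => o; rewrite ge0_integralZl_EFin.
- move=> f g mf f0 mg g0 If Ig.
  rewrite (_ : (fun _ => _) = fun o => \int[k o]_x f x + \int[k o]_x g x).
    exact: emeasurable_funD.
  by apply/funext => o; rewrite ge0_integralD.
- move=> F mF F0 ndF IF.
  apply: (emeasurable_fun_cvg (fun n o => \int[k o]_x F n x)) => // o _.
  by apply: cvg_monotone_convergence.
Qed.

Section bind_eq.
Context d1 (O1 : measurableType d1) d2 (O2 : measurableType d2).
Context (mu : {measure set O1 -> \bar R}) (nu : {measure set O2 -> \bar R}).
Context (h1 : O1 -> R) (h2 : O2 -> R).
Context (k1 : O1 -> {measure set T -> \bar R})
        (k2 : O2 -> {measure set T -> \bar R}).
Hypotheses (h10 : forall o, (0 <= h1 o)%R) (h20 : forall o, (0 <= h2 o)%R).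
Hypotheses (mh1 : measurable_fun setT h1) (mh2 : measurable_fun setT h2).
Hypothesis mk1 : forall A, measurable A -> measurable_fun setT (fun o => k1 o A).
Hypothesis mk2 : forall A, measurable A -> measurable_fun setT (fun o => k2 o A).

(** By monotone class induction from indicators. The weights [h1] and [h2] let
    mixtures be restricted to an event or carry a density. *)
Lemma bind_eq_integral :
  (forall A, measurable A ->
    \int[mu]_o ((h1 o)%:E * k1 o A) = \int[nu]_o ((h2 o)%:E * k2 o A)) ->
  forall f : T -> \bar R, measurable_fun setT f -> (forall x, 0 <= f x) ->
  \int[mu]_o ((h1 o)%:E * \int[k1 o]_x f x) = \int[nu]_o ((h2 o)%:E * \int[k2 o]_x f x).
Proof.
move=> H; apply: (@ge0_measurable_ind _ T R (fun f =>
  \int[mu]_o ((h1 o)%:E * \int[k1 o]_x f x) = \int[nu]_o ((h2 o)%:E * \int[k2 o]_x f x))).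
- move=> A mA.
  under eq_integral => o _ do rewrite integral_indic// setIT.
  under [RHS]eq_integral => o _ do rewrite integral_indic// setIT.
  exact: H.
- move=> c f c0 mf f0 If.
  under eq_integral => o _ do rewrite ge0_integralZl_EFin// muleCA.
  under [RHS]eq_integral => o _ do rewrite ge0_integralZl_EFin// muleCA.
  rewrite !ge0_integralZl_EFin// ?If//.
  + by move=> o _; rewrite mule_ge0 ?lee_fin// integral_ge0.
  + by apply: emeasurable_funM; [exact/measurable_EFinP|exact: measurable_fun_ge0_integral].
  + by move=> o _; rewrite mule_ge0 ?lee_fin// integral_ge0.
  + by apply: emeasurable_funM; [exact/measurable_EFinP|exact: measurable_fun_ge0_integral].
- move=> f g mf f0 mg g0 If Ig.
  under eq_integral => o _.
    rewrite ge0_integralD// ge0_muleDr ?integral_ge0//; over.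
  under [RHS]eq_integral => o _.
    rewrite ge0_integralD// ge0_muleDr ?integral_ge0//; over.
  rewrite !ge0_integralD// ?If ?Ig//; first
    [by move=> o _; rewrite mule_ge0 ?lee_fin// integral_ge0|by
     apply: emeasurable_funM; [exact/measurable_EFinP|exact: measurable_fun_ge0_integral]].
- move=> F mF F0 ndF IF.
  have aux d' (O : measurableType d') (m : {measure set O -> \bar R}) (h : O -> R)
      (k : O -> {measure set T -> \bar R}) :
      (forall o, (0 <= h o)%R) -> measurable_fun setT h ->
      (forall A, measurable A -> measurable_fun setT (fun o => k o A)) ->
      \int[m]_o ((h o)%:E * \int[k o]_x limn (F^~ x)) =
      limn (fun n => \int[m]_o ((h o)%:E * \int[k o]_x F n x)).
    move=> h0 mh mk.
    have ndI o : nondecreasing_seq (fun n => \int[k o]_x F n x).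
      by move=> p q pq; apply: ge0_le_integral => // x _; exact: ndF.
    rewrite -monotone_convergence//.
    + apply: eq_integral => o _; rewrite monotone_convergence//.
      by rewrite limeMl//; exact: ereal_nondecreasing_is_cvgn.
    + by move=> n; apply: emeasurable_funM;
        [exact/measurable_EFinP|exact: measurable_fun_ge0_integral].
    + by move=> n o _; rewrite mule_ge0 ?lee_fin// integral_ge0.
    + by move=> o _ p q pq; rewrite lee_wpmul2l ?lee_fin//; exact: ndI.
  by rewrite !aux//; congr (limn _); apply/funext => n; exact: IF.
Qed.

(** Dynkin's argument for mixtures: finiteness of the total mass allows
    complements. *)
Lemma bind_eq_pi_system (G : set (set T)) : @measurable _ T = <<s G >> ->
  setI_closed G -> G setT ->
  \int[mu]_o ((h1 o)%:E * k1 o setT) < +oo ->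
  (forall A, G A -> \int[mu]_o ((h1 o)%:E * k1 o A) = \int[nu]_o ((h2 o)%:E * k2 o A)) ->
  forall A, measurable A ->
    \int[mu]_o ((h1 o)%:E * k1 o A) = \int[nu]_o ((h2 o)%:E * k2 o A).
Proof.
move=> GE GI GT fin H A; rewrite GE.
have m0 o : forall A, 0 <= (h1 o)%:E * k1 o A by move=> ?; rewrite mule_ge0 ?lee_fin.
have m0' o : forall A, 0 <= (h2 o)%:E * k2 o A by move=> ?; rewrite mule_ge0 ?lee_fin.
have mm B : measurable B -> measurable_fun setT (fun o => (h1 o)%:E * k1 o B).
  by move=> mB; apply: emeasurable_funM; [exact/measurable_EFinP|exact: mk1].
have mm' B : measurable B -> measurable_fun setT (fun o => (h2 o)%:E * k2 o B).
  by move=> mB; apply: emeasurable_funM; [exact/measurable_EFinP|exact: mk2].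
apply: (@dynkin_induction _ T G (fun A =>
  \int[mu]_o ((h1 o)%:E * k1 o A) = \int[nu]_o ((h2 o)%:E * k2 o A))) => //.
- exact: H.
- move=> B mB HB.
  have add1 : \int[mu]_o ((h1 o)%:E * k1 o B) + \int[mu]_o ((h1 o)%:E * k1 o (~` B)) =
      \int[mu]_o ((h1 o)%:E * k1 o setT).
    rewrite -ge0_integralD//; [|exact: mm|exact/mm/measurableC].
    apply: eq_integral => o _; rewrite -ge0_muleDr// -measureU//.
      by rewrite setUv.
    - exact: measurableC.
    - by rewrite setICr.
  have add2 : \int[nu]_o ((h2 o)%:E * k2 o B) + \int[nu]_o ((h2 o)%:E * k2 o (~` B)) =
      \int[nu]_o ((h2 o)%:E * k2 o setT).
    rewrite -ge0_integralD//; [|exact: mm'|exact/mm'/measurableC].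
    apply: eq_integral => o _; rewrite -ge0_muleDr// -measureU//.
      by rewrite setUv.
    - exact: measurableC.
    - by rewrite setICr.
  have finB : \int[mu]_o ((h1 o)%:E * k1 o B) \is a fin_num.
    rewrite ge0_fin_numE ?integral_ge0//; apply: le_lt_trans fin.
    by rewrite -add1 leeDl// integral_ge0.
  move: add2; rewrite -(H _ GT) -add1 -HB.
  rewrite addeC [X in _ = X]addeC => /(congr1 (fun z => z - \int[mu]_o ((h1 o)%:E * k1 o B))).
  by rewrite !addeK.
- move=> F mF tF HF.
  have mU : measurable (\bigcup_k F k) by exact: bigcup_measurable.
  have mbU (m : {measure set T -> \bar R}) :
      m (\bigcup_k F k) = \sum_(i <oo) m (F i).
    by rewrite measure_bigcup//; apply: eq_eseriesl => n; rewrite in_setT.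
  transitivity (\int[mu]_o \sum_(n <oo) ((h1 o)%:E * k1 o (F n))).
    by apply: eq_integral => o _; rewrite mbU nneseriesZl.
  rewrite integral_nneseries//; last by move=> n; exact: mm.
  rewrite (eq_eseriesr (fun n _ => HF n)) -integral_nneseries//; last first.
    by move=> n; exact: mm'.
  by apply: eq_integral => o _; rewrite mbU nneseriesZl.
Qed.

End bind_eq.
End bind.
End integral_tools.

Section pushm.
Context d1 d2 (T1 : measurableType d1) (T2 : measurableType d2) (R : realType).
Context (m : {measure set T1 -> \bar R}) (f : T1 -> T2).
Hypothesis mf : measurable_fun setT f.

(** The image measure with its measure structure, so that it can be a member
    of a measurable family. *)
Definition pushm : {measure set T2 -> \bar R} :=
  ltac:(refine (pushforward m f : measure _ _); exact: mf).

Lemma integral_pushm (h : T2 -> \bar R) :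
  measurable_fun setT h -> (forall x, 0 <= h x)%E ->
  (\int[pushm]_y h y = \int[m]_x h (f x))%E.
Proof. by move=> mh h0; rewrite ge0_integral_pushforward. Qed.

End pushm.

(** * Semidirect products of a probability and a family of probabilities *)

Section semidirect.
Local Open Scope ereal_scope.
Context d1 d2 (T1 : measurableType d1) (T2 : measurableType d2) (R : realType).
Context (P : probability T1 R) (k : T1 -> {measure set T2 -> \bar R}).
Hypothesis mk : forall A, measurable A -> measurable_fun setT (fun x => k x A).
Hypothesis k1 : forall x, k x setT = 1.

(** The proofs are arguments so that the measure structure below applies to the
    term alone. *)
Definition semidirect of (forall A, measurable A -> measurable_fun setT (fun x => k x A))
  & (forall x, k x setT = 1) : set (T1 * T2) -> \bar R :=
  fun A => \int[P]_x k x (xsection A x).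

Lemma measurable_fun_family_xsection (A : set (T1 * T2)) : measurable A ->
  measurable_fun setT (fun x => k x (xsection A x)).
Proof.
pose K1 := isKernel.Build _ _ _ _ R k mk.
pose K0 : R.-ker T1 ~> T2 := HB.pack k K1.
pose K2 := Kernel_isProbability.Build _ _ _ _ R K0 k1.
pose K : R.-pker T1 ~> T2 := HB.pack (Kernel.sort K0) K1 K2.
by move=> mA; apply: (measurable_fun_xsection_finite_kernel K); exact: mem_set.
Qed.

Let mu := semidirect mk k1.

Let mu0 : mu set0 = 0.
Proof. by apply: integral0_eq => x _; rewrite xsection0 measure0. Qed.

Let mu_ge0 A : 0 <= mu A. Proof. exact: integral_ge0. Qed.

Let mu_additive : semi_sigma_additive mu.
Proof.
move=> F mF tF mUF.
have E : mu (\bigcup_n F n) = \sum_(n <oo) mu (F n).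
  rewrite -integral_nneseries//; last first.
    by move=> n; exact: measurable_fun_family_xsection.
  apply: eq_integral => x _; rewrite xsection_bigcup measure_bigcup//.
  - by apply: eq_eseriesl => n; rewrite in_setT.
  - by move=> n _; exact: measurable_xsection.
  - exact: trivIset_xsection.
rewrite E; apply: (is_cvg_nneseries (P := xpredT)) => n _ _; exact: mu_ge0.
Qed.

HB.instance Definition _ := isMeasure.Build _ _ _ (semidirect mk k1) mu0 mu_ge0 mu_additive.

Let mu1 : semidirect mk k1 setT = 1.
Proof.
rewrite /semidirect (eq_integral (cst 1)).
  by rewrite integral_cst// mul1e [LHS]probability_setT.
move=> x _; rewrite -(k1 x); congr (k x _).
by rewrite -setXTT in_xsectionX//; exact: in_setT.
Qed.

HB.instance Definition _ := Measure_isProbability.Build _ _ _ (semidirect mk k1) mu1.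

Lemma integral_semidirect f : measurable_fun setT f -> (forall x, 0 <= f x) ->
  \int[semidirect mk k1]_u f u = \int[P]_x \int[k x]_y f (x, y).
Proof.
have mpair (x : T1) : measurable_fun setT (fun y : T2 => (x, y)).
  by apply: measurable_fun_pair; [exact: measurable_cst|exact: measurable_id].
pose kk x := pushm (k x) (mpair x).
have kkE x A : kk x A = k x (xsection A x).
  by rewrite /kk /pushforward/= xsectionE.
move=> mf f0.
transitivity (\int[semidirect mk k1]_u
    ((cst 1%R u)%:E * \int[dirac u]_v f v)).
  by apply: eq_integral => u _; rewrite mul1e integral_dirac// diracT mul1e.
transitivity (\int[P]_x ((cst 1%R x)%:E * \int[kk x]_v f v)); last first.
  by apply: eq_integral => x _; rewrite mul1e integral_pushm.
apply: bind_eq_integral => //.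
- by move=> A mA; exact: measurable_fun_dirac.
- by move=> A mA; under eq_fun do rewrite kkE; exact: measurable_fun_family_xsection.
- move=> A mA; under [RHS]eq_integral do rewrite mul1e kkE.
  transitivity (\int[semidirect mk k1]_u (\1_A u)%:E); last first.
    by rewrite integral_indic// setIT.
  by apply: eq_integral => u _; rewrite mul1e.
Qed.

End semidirect.

(** * Paths and vectors as measurable spaces *)

Lemma sigma_algebra_sub_preimage (O : Type) d (T : measurableType d)
    (Z : O -> T) (G : set (set O)) :
  (forall B, G B -> exists2 A, measurable A & B = Z @^-1` A) ->
  forall B, <<s G >> B -> exists2 A, measurable A & B = Z @^-1` A.
Proof.
move=> GZ; suff : <<s G >> `<=` preimage_set_system setT Z measurable.
  by move=> H B /H[A mA]; rewrite setTI => <-; exists A.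
apply: smallest_sub.
  exact/sigma_algebra_preimage/sigma_algebra_measurable.
by move=> B /GZ[A mA ->]; exists A => //; rewrite setTI.
Qed.

Section paths.
Context (I : Type) d (T : measurableType d).

Lemma measurable_coord (i : I) :
  measurable_fun setT (fun x : pathType I T => x i).
Proof.
by move=> _ A mA; apply: sub_sigma_algebra; exists i => //; exists A.
Qed.

Lemma measurable_fun_path d' (O : measurableType d') (f : O -> pathType I T) :
  (forall i, measurable_fun setT (fun o => f o i)) -> measurable_fun setT f.
Proof.
move=> mf; apply: (@measurability _ _ O (pathType I T) setT f (@cylinders I _ T)) => //.
move=> _ [_ [i _ [A mA <-]] <-]; rewrite !setTI.
by rewrite -[X in measurable X]setTI; exact: mf.
Qed.

End paths.

(** Boxes over initial segments: closed under intersection, unlike the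
    one-coordinate cylinders that generate the sigma-algebra. *)
Definition nat_cylinders d (T : measurableType d) : set (set (pathType nat T)) :=
  [set C | exists m (A : nat -> set T), (forall i, measurable (A i)) /\
     C = [set x | forall i, (i < m)%N -> A i (x i)]].

Section nat_paths.
Context d (T : measurableType d).

Lemma nat_cylindersI : setI_closed (@nat_cylinders _ T).
Proof.
move=> _ _ [m [A [mA ->]]] [n [B [mB ->]]].
exists (maxn m n), (fun i => (if (i < m)%N then A i else setT) `&`
                             (if (i < n)%N then B i else setT)); split.
  by move=> i; apply: measurableI; case: ifP.
apply/seteqP; split => [x [xA xB] i _|x xAB].
  by split; case: ifP => // h; [exact: xA|exact: xB].
by split=> i im; have := xAB i; rewrite leq_max im ?orbT => /(_ isT)[].
Qed.

Lemma nat_cylindersT : @nat_cylinders _ T setT.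
Proof. by exists 0%N, (fun=> setT); split=> //; apply/seteqP; split. Qed.

Lemma nat_cylindersE : @measurable _ (pathType nat T) = <<s @nat_cylinders _ T >>.
Proof.
apply/seteqP; split.
  apply: smallest_sub; first exact: smallest_sigma_algebra.
  move=> _ [i _ [A mA <-]]; apply: sub_sigma_algebra.
  exists i.+1, (fun j => if j == i then A else setT); split.
    by move=> j; case: ifP.
  apply/seteqP; split => [x [_ /= Ax] j _|x /(_ i (leqnn _))]; rewrite ?eqxx//.
  by case: eqP => // ->.
apply: smallest_sub; first exact: sigma_algebra_measurable.
move=> _ [m [A [mA ->]]].
rewrite (_ : [set x | _] = \bigcap_(i in `I_m) ((fun x => x i) @^-1` A i)) //.
apply: fin_bigcap_measurable => // i _.
by rewrite -[X in measurable X]setTI; exact: measurable_coord.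
Qed.

End nat_paths.

Lemma prod_pi_systemE d1 d2 (T1 : measurableType d1) (T2 : measurableType d2)
    (G1 : set (set T1)) (G2 : set (set T2)) :
  @measurable _ T1 = <<s G1 >> -> @measurable _ T2 = <<s G2 >> ->
  G1 setT -> G2 setT ->
  @measurable _ (T1 * T2)%type = <<s [set A `*` B | A in G1 & B in G2] >>.
Proof.
move=> E1 E2 G1T G2T; apply/seteqP; split; last first.
  apply: smallest_sub; first exact: sigma_algebra_measurable.
  move=> _ [A GA [B GB <-]]; apply: measurableX.
    by rewrite E1; exact: sub_sigma_algebra.
  by rewrite E2; exact: sub_sigma_algebra.
set G := [set A `*` B | A in G1 & B in G2].
apply: smallest_sub; first exact: smallest_sigma_algebra.
rewrite subUset; split.
  rewrite E1 -g_sigma_preimageE; apply: smallest_sub.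
    exact: smallest_sigma_algebra.
  move=> _ [A GA <-]; apply: sub_sigma_algebra; exists A => //; exists setT => //.
  by rewrite setTI; apply/seteqP; split => [x []|].
rewrite E2 -g_sigma_preimageE; apply: smallest_sub.
  exact: smallest_sigma_algebra.
move=> _ [B GB <-]; apply: sub_sigma_algebra; exists setT => //; exists B => //=; rewrite setTI; apply/seteqP; split => [x []|].
Qed.

Lemma prod_pi_systemI (T1 T2 : Type) (G1 : set (set T1)) (G2 : set (set T2)) :
  setI_closed G1 -> setI_closed G2 ->
  setI_closed [set A `*` B | A in G1 & B in G2].
Proof.
move=> I1 I2 _ _ [A1 GA1 [B1 GB1 <-]] [A2 GA2 [B2 GB2 <-]].
by exists (A1 `&` A2); [exact: I1|exists (B1 `&` B2); [exact: I2|rewrite setXI]].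
Qed.

Section rvec.
Context (R : realType) (d : nat).

Lemma measurable_rvec_coord (c : 'I_d) :
  measurable_fun setT (fun x : rvec R d => x 0 c).
Proof.
apply: (measurability (@RGenInftyO.G R)); first exact: RGenInftyO.measurableE.
move=> _ [_ [r ->] <-]; rewrite setTI; apply: sub_sigma_algebra.
apply: (@open_comp _ _ (fun x : 'rV[R]_d => x 0 c)).
  by move=> x _; exact: coord_continuous.
exact: interval_open.
Qed.

(** Boxes with rational corners form a countable base, so the coordinate
    half-spaces with rational bounds generate the Borel sets. *)
Lemma rvec_measurableE : @measurable _ (rvec R d) =
  <<s [set A : set (rvec R d) | exists c : 'I_d, exists r : rat,
         A = [set x : rvec R d | x 0 c < ratr r]] >>.
Proof.
set G := [set A | _].
apply/seteqP; split; last first.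
  apply: smallest_sub; first exact: sigma_algebra_measurable.
  move=> _ [c [r ->]].
  have := @measurable_rvec_coord c measurableT `]-oo, (ratr r : R)[%classic.
  rewrite setTI; rewrite (_ : _ @^-1` _ = [set x : rvec R d | x 0 c < ratr r]); first exact.
  by apply/seteqP; split => x /=; rewrite in_itv.
pose TG : measurableType _ := g_sigma_algebraType (G : set (set 'rV[R]_d)).
have mlt c (r : rat) : measurable ([set x : 'rV[R]_d | x 0 c < ratr r] : set TG).
  by apply: sub_sigma_algebra; exists c, r.
have mgt c (r : rat) : measurable ([set x : 'rV[R]_d | ratr r < x 0 c] : set TG).
  rewrite (_ : [set x | _] = \bigcup_(n : nat)
      ~` [set x : 'rV[R]_d | x 0 c < ratr (r + n.+1%:R^-1)]).
    by apply: bigcupT_measurable => n; exact: measurableC.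
  apply/seteqP; split => x /=.
    move=> /ltr_add_invr[n nx]; exists n => //=; apply/negP; rewrite -leNgt.
    by rewrite rmorphD/= fmorphV/= ratr_nat ltW.
  move=> [n _ /negP]; rewrite -leNgt; apply: lt_le_trans.
  by rewrite rmorphD/= fmorphV/= ratr_nat ltrDl invr_gt0.
apply: smallest_sub; first exact: (@sigma_algebra_measurable _ TG).
move=> U oU.
pose box (p : 'rV[rat]_d * 'rV[rat]_d) : set TG :=
  \bigcap_(c in [set: 'I_d]) ([set x : 'rV[R]_d | ratr (p.1 0 c) < x 0 c] `&`
                              [set x : 'rV[R]_d | x 0 c < ratr (p.2 0 c)]).
have mbox p : measurable (box p).
  apply: fin_bigcap_measurable => // c _; exact: measurableI.
rewrite (_ : U = \bigcup_p if `[< box p `<=` U >] then box p else set0).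
  apply: (@countable_bigcupT_measurable _ TG) => [|p]; first exact: countableP.
  by case: ifP => _; [exact: mbox|exact: measurable0].
apply/seteqP; split => [x Ux|x [p _]]; last by case: ifPn => [/asboolP+|_ []]; exact.
have /nbhs_ballP[e /= e0 eU] : nbhs x U by exact: open_nbhs_nbhs.
have L c : exists r : rat, x 0 c - e < ratr r < x 0 c.
  have [|r] := @rat_in_itvoo R (x 0 c - e) (x 0 c); first by rewrite ltrBlDr ltrDl.
  by rewrite in_itv/=; exists r.
have M c : exists r : rat, x 0 c < ratr r < x 0 c + e.
  have [|r] := @rat_in_itvoo R (x 0 c) (x 0 c + e); first by rewrite ltrDl.
  by rewrite in_itv/=; exists r.
have [l lP] := choice L; have [u uP] := choice M.
exists (\row_c l c, \row_c u c) => //; rewrite ifT.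
  move=> c _ /=; rewrite !mxE.
  by have /andP[_ ->] := lP c; have /andP[-> _] := uP c.
apply/asboolP => y yb; apply: eU; split => // i c; rewrite ord1.
have [] := yb c Logic.I; rewrite /= !mxE => ly yu.
have /andP[l1 _] := lP c; have /andP[_ u1] := uP c.
by rewrite /ball/= ltr_norml; lra.
Qed.

Lemma measurable_l1_metric :
  measurable_fun setT (fun u : rvec R d * rvec R d => l1_metric u.1 u.2).
Proof.
rewrite /l1_metric /l1norm.
apply: measurable_sum => c; apply: measurableT_comp => //.
rewrite (_ : (fun _ => _) = fun u : rvec R d * rvec R d => u.1 0 c - u.2 0 c).
  by apply: measurable_funB; apply: (measurableT_comp (measurable_rvec_coord c)).
by apply/funext => u; rewrite !mxE.
Qed.

Lemma measurable_l1norm :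
  measurable_fun setT (fun x : rvec R d => l1norm (x : 'rV[R]_d)).
Proof.
rewrite /l1norm; apply: measurable_sum => c; apply: measurableT_comp => //.
exact: measurable_rvec_coord.
Qed.

Lemma l1norm_ge0 (x : 'rV[R]_d) : 0 <= l1norm x.
Proof. exact: sumr_ge0. Qed.

Lemma l1norm_eq0 (x : 'rV[R]_d) : l1norm x = 0 -> x = 0.
Proof.
move=> /eqP; rewrite psumr_eq0// => /allP x0; apply/rowP => c; rewrite mxE.
by have := x0 c (mem_index_enum c); rewrite normr_eq0 => /eqP.
Qed.

Lemma l1norm0 : l1norm (0 : 'rV[R]_d) = 0.
Proof. by rewrite /l1norm big1// => c _; rewrite mxE normr0. Qed.

Lemma l1normN (x : 'rV[R]_d) : l1norm (- x) = l1norm x.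
Proof. by apply: eq_bigr => c _; rewrite mxE normrN. Qed.

Lemma ler_l1normD (x y : 'rV[R]_d) : l1norm (x + y) <= l1norm x + l1norm y.
Proof.
rewrite -big_split; apply: ler_sum => c _; rewrite mxE; exact: ler_normD.
Qed.

Lemma l1_metric_ge0 (x y : 'rV[R]_d) : 0 <= l1_metric x y.
Proof. exact: l1norm_ge0. Qed.

Lemma l1_metric_triangle (x y z : 'rV[R]_d) :
  l1_metric x z <= l1_metric x y + l1_metric y z.
Proof.
by rewrite /l1_metric (le_trans _ (ler_l1normD _ _))// addrA subrK.
Qed.

Lemma measurable_discrete_metric :
  measurable_fun setT (fun u : rvec R d * rvec R d => discrete_metric u.1 u.2).
Proof.
pose N : set (rvec R d * rvec R d) :=
  (fun u => l1_metric u.1 u.2) @^-1` `]0, +oo[%classic.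
rewrite (_ : (fun _ => _) = (\1_N : _ -> R)).
  apply: measurable_indic; rewrite -[N]setTI.
  exact: measurable_l1_metric.
apply/funext => -[x y]; rewrite /discrete_metric indicE; congr (_%:R)%R.
congr (nat_of_bool _); apply/idP/idP => [xy|].
  apply/mem_set; rewrite /N /= in_itv/= andbT lt_neqAle l1_metric_ge0 andbT eq_sym.
  by apply: contra xy => /eqP/l1norm_eq0/subr0_eq/eqP.
move=> /set_mem; rewrite /N /= in_itv/= andbT => h; apply: contraTneq h => ->.
by rewrite /l1_metric subrr l1norm0 ltxx.
Qed.

End rvec.

(** * Joint laws from conditional distributions *)

Lemma measurable_dirac_comp (R : realType) d1 d2 (T1 : measurableType d1)
    (T2 : measurableType d2) (f : T1 -> T2) A : measurable_fun setT f ->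
  measurable A -> measurable_fun setT (fun x => \d_(f x) A : \bar R).
Proof.
move=> mf mA; rewrite (_ : (fun x => _) = (fun u => \d_u A) \o f) //.
by apply: measurableT_comp => //; exact: measurable_fun_dirac.
Qed.

Section joint_law.
Local Open Scope ereal_scope.
Context (R : realType) dO (O : measurableType dO) (P : probability O R).
Context dH (H : measurableType dH) dF (F : measurableType dF).
Context (X : O -> H) (Z : O -> F) (k : O -> {measure set F -> \bar R}).
Hypotheses (mX : measurable_fun setT X) (mZ : measurable_fun setT Z).
Hypothesis mk : forall A, measurable A -> measurable_fun setT (fun o => k o A).
Hypothesis k1 : forall o, k o setT = 1.
Context (GH : set (set H)) (GF : set (set F)).
Hypotheses (EH : @measurable _ H = <<s GH >>) (EF : @measurable _ F = <<s GF >>).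
Hypotheses (IH : setI_closed GH) (IF : setI_closed GF).
Hypotheses (TH : GH setT) (TF : GF setT).
Hypothesis rect : forall A C, GH A -> GF C ->
  P (X @^-1` A `&` Z @^-1` C) = \int[P]_(o in X @^-1` A) k o C.

(** A product formula on a generating pi-system of rectangles identifies the
    joint law as a semidirect product. *)
Lemma joint_law_integral (f : H * F -> \bar R) : measurable_fun setT f ->
  (forall u, 0 <= f u) ->
  \int[P]_o f (X o, Z o) = \int[P]_o \int[k o]_s f (X o, s).
Proof.
have mXA A : measurable A -> measurable (X @^-1` A).
  by move=> mA; rewrite -[X in measurable X]setTI; exact: mX.
have mZA A : measurable A -> measurable (Z @^-1` A).
  by move=> mA; rewrite -[X in measurable X]setTI; exact: mZ.
have mp o : measurable_fun setT (fun s : F => (X o, s)).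
  by apply: measurable_fun_pair; [exact: measurable_cst|exact: measurable_id].
pose kk o := pushm (k o) (mp o).
have mkk A : measurable A -> measurable_fun setT (fun o => kk o A).
  move=> mA; pose A' := [set u : O * F | A (X u.1, u.2)].
  have mA' : measurable A'.
    rewrite -[A']setTI; apply: (_ : measurable_fun setT (fun u : O * F => (X u.1, u.2))) => //.
    by apply: measurable_fun_pair => //; exact: measurableT_comp.
  rewrite (_ : (fun o => _) = fun o => k o (xsection A' o)).
    exact: measurable_fun_family_xsection.
  by apply/funext => o; rewrite xsectionE.
pose dd (o : O) : {measure set (H * F) -> \bar R} := dirac (X o, Z o).
have mdd A : measurable A -> measurable_fun setT (fun o => dd o A).
  by apply: measurable_dirac_comp; exact: measurable_fun_pair.
move=> mf f0.
transitivity (\int[P]_o ((cst 1%R o)%:E * \int[dd o]_u f u)).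
  by apply: eq_integral => o _; rewrite mul1e integral_dirac// diracT mul1e.
transitivity (\int[P]_o ((cst 1%R o)%:E * \int[kk o]_u f u)); last first.
  by apply: eq_integral => o _; rewrite mul1e integral_pushm.
apply: bind_eq_integral => //.
apply: (bind_eq_pi_system _ _ _ _ _ _ (prod_pi_systemE EH EF TH TF)) => //.
- exact: prod_pi_systemI.
- by exists setT => //; exists setT => //; rewrite setXTT.
- rewrite (eq_integral (cst 1)).
    by rewrite integral_cst// mul1e [X in X < _]probability_setT ltry.
  by move=> o _; rewrite mul1e [LHS]diracT.
move=> _ [A GA [C GC <-]].
have mA : measurable A by rewrite EH; exact: sub_sigma_algebra.
have mC : measurable C by rewrite EF; exact: sub_sigma_algebra.
transitivity (P (X @^-1` A `&` Z @^-1` C)).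
  transitivity (\int[P]_o (\1_(X @^-1` A `&` Z @^-1` C) o)%:E); last first.
    by rewrite integral_indic ?setIT//; apply: measurableI; [exact: mXA|exact: mZA].
  by apply: eq_integral => o _; rewrite mul1e.
rewrite rect// [LHS]integral_mkcond; apply: eq_integral => o _.
rewrite mul1e patchE /kk /pushm/= /pushforward/=.
case: ifPn => [/set_mem Ao|/negP Ao].
  by congr (k o _); apply/seteqP; split => [s|s []].
rewrite (_ : _ @^-1` _ = set0) ?measure0//.
by apply/seteqP; split => // s [/= As _]; exact/Ao/mem_set.
Qed.

End joint_law.

Section sub_sigma_algebra.
Local Open Scope ereal_scope.
Context (R : realType) dO (O : measurableType dO) (P : probability O R).

Lemma process_gen_measurable (I : Type) d (T : measurableType d) (J : set I)
    (Z : I -> O -> T) : (forall i, measurable_fun setT (Z i)) ->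
  <<s process_gen J Z >> `<=` @measurable _ O.
Proof.
move=> mZ; apply: smallest_sub; first exact: sigma_algebra_measurable.
move=> _ [i _ [A mA <-]]; exact: mZ.
Qed.

Lemma process_gen_subset (I : Type) d (T : measurableType d) (J J' : set I)
    (Z : I -> O -> T) : J `<=` J' ->
  <<s process_gen J Z >> `<=` <<s process_gen J' Z >>.
Proof.
move=> JJ'; apply: sub_sigma_algebra2 => _ [i /JJ' Ji [A mA <-]].
by exists i => //; exists A.
Qed.

Lemma process_gen_preimage (I : Type) d (T : measurableType d) (J : set I)
    (Z : I -> O -> T) i A : J i -> measurable A ->
  <<s process_gen J Z >> (Z i @^-1` A).
Proof.
by move=> Ji mA; apply: sub_sigma_algebra; exists i => //; exists A => //; rewrite setTI.
Qed.

Lemma sigma_algebraI (T : pointedType) (G : set (set T)) A B :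
  <<s G >> A -> <<s G >> B -> <<s G >> (A `&` B).
Proof. exact: (@measurableI _ (g_sigma_algebraType G)). Qed.

Lemma cond_prob_is_integral (F : set (set O)) (B : set O) (phi : O -> R) A :
  F `<=` @measurable _ O -> measurable_fun setT phi ->
  cond_prob_is P F B phi -> F A -> \int[P]_(o in A) (phi o)%:E = P (A `&` B).
Proof.
move=> mF mphi [h [mh hE] hphi] FA; rewrite -(hE A FA).
have mh' : measurable_fun setT h.
  by move=> _ C mC; rewrite setTI; exact/mF/mh.
apply: ae_eq_integral => //.
- exact: mF.
- by apply/measurable_EFinP; exact: measurable_funTS.
- by apply/measurable_EFinP; exact: measurable_funTS.
- case: hphi => N [mN N0 hN]; exists N; split => // o /= ho; apply: hN => /= hh.
  by apply: ho => _; rewrite hh.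
Qed.

End sub_sigma_algebra.

Section markov.
Local Open Scope ereal_scope.
Context (R : realType) dO (O : measurableType dO) (P : probability O R).
Context d (T : measurableType d) (S : int -> {mfun O >-> T}).
Context (P0 : R.-pker T ~> (pathType nat T)).
Hypothesis SM : markov_chain P (fun t => S t).
Hypothesis SP0 : cond_dist P <<s process_gen [set 0%R : int] (fun t => S t) >>
  (future (fun t => S t)) (fun o => P0 (S 0%R o)).

Let F t := <<s process_gen [set j : int | (j <= t)%R] (fun t => S t) >>.

Let mS t : measurable_fun setT (S t) := measurable_funP (S t).

Let mF t : F t `<=` @measurable _ O.
Proof. exact: process_gen_measurable. Qed.

Lemma measurable_pker_comp d1 d2 (T1 : measurableType d1) (T2 : measurableType d2)
    (k : R.-pker T1 ~> T2) (f : O -> T1) A : measurable_fun setT f -> measurable A ->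
  measurable_fun setT (fun o => k (f o) A).
Proof.
by move=> mf mA; apply: (measurableT_comp (measurable_kernel k A mA)).
Qed.

Lemma pker_fin_num d1 d2 (T1 : measurableType d1) (T2 : measurableType d2)
    (k : R.-pker T1 ~> T2) x A : measurable A -> k x A \is a fin_num.
Proof.
move=> mA; rewrite ge0_fin_numE//; apply: le_lt_trans (ltry 1).
by rewrite -(prob_kernel (s := k) x); apply: le_measure => //; exact: mem_set.
Qed.

(** The probability that the chain started at [s] visits the sets of [l] in
    turn, at its next steps. *)
Fixpoint visit (K : R.-pker T ~> T) (l : seq (set T)) (s : T) : \bar R :=
  if l is A :: l' then \int[K s]_s' ((\1_A s')%:E * visit K l' s') else 1.

Lemma visit_ge0 K l s : 0 <= visit K l s.
Proof.
elim: l s => //= A l IH s; apply: integral_ge0 => s' _.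
by rewrite mule_ge0// lee_fin.
Qed.

Lemma measurable_visit K l : (forall A, A \in l -> measurable A) ->
  measurable_fun setT (visit K l).
Proof.
elim: l => /= [_|A l IH mAl]; first exact: measurable_cst.
apply: measurable_fun_ge0_integral => [C mC||s].
- exact: (measurable_kernel K).
- apply: emeasurable_funM.
    by apply/measurable_EFinP/measurable_indic/mAl; rewrite mem_head.
  by apply: IH => C Cl; apply: mAl; rewrite inE Cl orbT.
- by rewrite mule_ge0 ?lee_fin ?visit_ge0.
Qed.

Lemma markov_step (K : R.-pker T ~> T) (t : int) (B : set O) (f : T -> \bar R) :
  (forall A : set T, measurable A -> cond_prob_is P (F t)
      (S (t + 1)%R @^-1` A) (fun o => fine (K (S t o) A))) ->
  F t B -> measurable_fun setT f -> (forall s, 0 <= f s) ->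
  \int[P]_(o in B) f (S (t + 1)%R o) = \int[P]_(o in B) \int[K (S t o)]_s f s.
Proof.
move=> HK FB mf f0.
have mB := mF FB.
transitivity (\int[P]_o ((\1_B o)%:E * \int[dirac (S (t + 1)%R o)]_s f s)).
  rewrite integral_mkcond; apply: eq_integral => o _.
  rewrite patchE integral_dirac// diracT mul1e indicE.
  by case: ifP => _; rewrite ?mul1e ?mul0e.
transitivity (\int[P]_o ((\1_B o)%:E * \int[K (S t o)]_s f s)); last first.
  rewrite [RHS]integral_mkcond; apply: eq_integral => o _.
  by rewrite patchE indicE; case: ifP => _; rewrite ?mul1e ?mul0e.
apply: bind_eq_integral => //.
- by move=> A mA; exact: measurable_dirac_comp.
- by move=> A mA; exact: measurable_pker_comp.
move=> A mA.
have mk : measurable_fun setT (fun o => fine (K (S t o) A)).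
  by apply: measurableT_comp => //; exact: measurable_pker_comp.
transitivity (P (B `&` S (t + 1)%R @^-1` A)); last first.
  rewrite -(cond_prob_is_integral (@mF t) mk (HK A mA) FB) [LHS]integral_mkcond.
  apply: eq_integral => o _; rewrite patchE indicE.
  by case: ifP => _; rewrite ?mul1e ?mul0e ?fineK// pker_fin_num.
transitivity (\int[P]_o (\1_(B `&` S (t + 1)%R @^-1` A) o)%:E).
  by apply: eq_integral => o _; rewrite indicI EFinM.
rewrite integral_indic ?setIT//; apply: measurableI => //.
by rewrite -[X in measurable X]setTI; exact: mS.
Qed.

Lemma markov_visit (K : R.-pker T ~> T) (l : seq (set T)) (t : int) (B : set O) :
  (forall t (A : set T), measurable A -> cond_prob_is P (F t)
      (S (t + 1)%R @^-1` A) (fun o => fine (K (S t o) A))) ->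
  (forall A, A \in l -> measurable A) -> F t B ->
  P (B `&` [set o | forall i, (i < size l)%N -> nth setT l i (S (t + i.+1%:Z)%R o)])
  = \int[P]_(o in B) visit K l (S t o).
Proof.
move=> HK; elim: l t B => [|A l IH] t B mAl FB /=.
  rewrite integral_cst ?mul1e; last exact: mF FB.
  congr (P _); apply/seteqP; split => o; first by case.
  by move=> Bo; split.
have mA : measurable A by apply: mAl; rewrite mem_head.
have mAl' C : C \in l -> measurable C by move=> Cl; apply: mAl; rewrite inE Cl orbT.
have FB' : F (t + 1)%R (B `&` S (t + 1)%R @^-1` A).
  apply: sigma_algebraI.
    by apply: process_gen_subset FB => j /= /le_trans; apply; rewrite lerDl.
  by apply: process_gen_preimage => //=.
rewrite -(markov_step (HK t) FB); first last.
- by move=> s; rewrite mule_ge0 ?lee_fin// visit_ge0.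
- apply: emeasurable_funM; first exact/measurable_EFinP/measurable_indic.
  exact: measurable_visit.
transitivity (\int[P]_(o in B `&` S (t + 1)%R @^-1` A) visit K l (S (t + 1)%R o)).
  rewrite -IH//; congr (P _); apply/seteqP; split => o.
    move=> [Bo Ho]; split; first by split => //; exact: (Ho 0%N).
    by move=> i il; have := Ho i.+1 il; rewrite -addrA -intS.
  move=> [[Bo Ao] Ho]; split => // -[_ //|i il].
  by have := Ho i il; rewrite -addrA -intS.
rewrite integral_mkcond [RHS]integral_mkcond; apply: eq_integral => o _.
rewrite !patchE in_setI indicE.
rewrite (_ : (o \in S (t + 1)%R @^-1` A) = (S (t + 1)%R o \in A))//.
by case: (o \in B) => //=; case: (_ \in A); rewrite ?mul1e ?mul0e.
Qed.

(** The Markov property extends from one step to the whole future, because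
    both [P0 (S 0) C] and the iterated transitions are functions of [S 0] with
    the same integrals over the events of [S 0]. *)
Lemma markov_future (B : set O) (m : nat) (C : nat -> set T) :
  (forall i, measurable (C i)) -> F 0%R B ->
  let CC : set (pathType nat T) := [set x | forall i, (i < m)%N -> C i (x i)] in
  P (B `&` future (fun t => S t) @^-1` CC) = \int[P]_(o in B) P0 (S 0%R o) CC.
Proof.
move=> mC FB CC; case: SM => K HK.
have mCC : measurable CC.
  by rewrite nat_cylindersE; apply: sub_sigma_algebra; exists m, C.
pose l := [seq C i | i <- iota 0 m].
have ml A : A \in l -> measurable A by move=> /mapP[i _ ->].
have CCE D : D `&` future (fun t => S t) @^-1` CC = D `&`
    [set o | forall i, (i < size l)%N -> nth setT l i (S (0 + i.+1%:Z)%R o)].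
  rewrite size_map size_iota; congr (_ `&` _); apply/seteqP; split => o Ho i im.
    by rewrite (nth_map 0%N) ?size_iota// nth_iota// !add0n add0r; exact: Ho.
  by have := Ho i im; rewrite (nth_map 0%N) ?size_iota// nth_iota// !add0n add0r.
rewrite CCE (markov_visit HK ml FB).
pose pi := pushm P (mS 0%R).
have mfin s : P0 s CC \is a fin_num by exact: pker_fin_num.
have mP0C : measurable_fun setT (fun s => P0 s CC) by exact: measurable_kernel.
have aeE : ae_eq pi setT (fun s => P0 s CC) (visit K l).
  apply: integral_ae_eq => //.
  - apply/integrableP; split => //; apply: le_lt_trans (ltry 1).
    apply: (@le_trans _ _ (\int[pi]_s cst 1 s)).
      apply: ge0_le_integral => //; first exact: measurableT_comp.
      move=> s _; rewrite gee0_abs//.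
      by rewrite -(prob_kernel (s := P0) s); apply: le_measure => //; exact: mem_set.
    by rewrite integral_cst// mul1e /pi /pushm/= /pushforward preimage_setT
      [leLHS]probability_setT.
  - exact: measurable_visit.
  - move=> A _ mA.
    have mA' : measurable (S 0%R @^-1` A).
      by rewrite -[X in measurable X]setTI; exact: mS.
    have e1 (h : T -> \bar R) : measurable_fun setT h -> (forall s, 0 <= h s) ->
        \int[pi]_(s in A) h s = \int[P]_(o in S 0%R @^-1` A) h (S 0%R o).
      move=> mh h0; rewrite ge0_integral_pushforward//.
      exact: measurable_funTS.
    rewrite !e1//; [|exact: measurable_visit|by move=> s; exact: visit_ge0].
    rewrite -(markov_visit HK ml); last first.
      exact: process_gen_preimage.
    rewrite -CCE; case: (SP0 mCC) => _ <-.
      by apply: eq_integral => o _; rewrite fineK.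
    exact: process_gen_preimage.
apply: ae_eq_integral.
- exact: mF FB.
- by apply: measurable_funTS; apply: (measurableT_comp (measurable_visit K ml)).
- by apply: measurable_funTS; exact: measurable_pker_comp.
- case: aeE => N [mN N0 HN]; exists (S 0%R @^-1` N); split => //.
  + by rewrite -[X in measurable X]setTI; exact: mS.
  + move=> o /= Ho; apply: HN => /= HE; apply: Ho => _; apply/esym; exact: HE.
Qed.

End markov.

(** * The response process *)

Section transitions.
Context (R : realType) dE (E : measurableType dE) (dX : nat).
Hypotheses (finE : finite_set [set: E]) (discE : forall A : set E, measurable A).
Context (q : E -> (nat -> E) -> (nat -> rvec R dX) -> R)
        (D : set (pathType int (rvec R dX))).
Hypothesis D0 : D !=set0.
Hypothesis q01 : forall w y z, histories D z -> 0 < q w y z < 1.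
Hypothesis q1 : forall y z, histories D z -> \sum_(w \in [set: E]) q w y z = 1.

Definition symbols : seq E := enum_fset (fset_set [set: E]).
Local Notation es := symbols.

Lemma mem_symbols w : w \in es.
Proof. by rewrite [_ \in _]in_fset_set// in_setT. Qed.

Lemma fsum_symbols (f : E -> R) :
  \sum_(w \in [set: E]) f w = \sum_(w <- es) f w.
Proof. by rewrite fsbig_finite. Qed.

Lemma sum_symbols1 (f : E -> R) w0 :
  \sum_(w <- es) (w0 == w)%:R * f w = f w0.
Proof.
rewrite (bigD1_seq w0) ?mem_symbols ?fset_uniq//= eqxx mul1r big1 ?addr0// => w ww0.
by rewrite eq_sym (negbTE ww0) mul0r.
Qed.

Lemma dTV_symbols (p p' : E -> R) : dTV p p' = 2^-1 * \sum_(w <- es) `|p w - p' w|.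
Proof. by rewrite /dTV fsum_symbols. Qed.

Lemma dTV_ge0 (p p' : E -> R) : 0 <= dTV p p'.
Proof. by rewrite dTV_symbols mulr_ge0 ?invr_ge0 ?sumr_ge0. Qed.

Lemma dTV_triangle (p p' p'' : E -> R) : dTV p p'' <= dTV p p' + dTV p' p''.
Proof.
rewrite !dTV_symbols -mulrDr ler_wpM2l ?invr_ge0// -big_split /=.
by apply: ler_sum => w _; rewrite (le_trans _ (ler_normD _ _))// addrA subrK.
Qed.

Lemma q_sum1 y z : histories D z -> \sum_(w <- es) q w y z = 1.
Proof. by move=> Dz; rewrite -(q1 y Dz) fsum_symbols. Qed.

Lemma dTV_q_le1 y y' z z' : histories D z -> histories D z' ->
  dTV (fun w => q w y z) (fun w => q w y' z') <= 1.
Proof.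
move=> Dz Dz'; rewrite dTV_symbols.
have : \sum_(w <- es) `|q w y z - q w y' z'| <= \sum_(w <- es) (q w y z + q w y' z').
  apply: ler_sum => w _; rewrite (le_trans (ler_normB _ _))//.
  have /andP[/ltW ? _] := q01 w y Dz; have /andP[/ltW ? _] := q01 w y' Dz'.
  by rewrite !ger0_norm.
by rewrite big_split/= !q_sum1//; lra.
Qed.

Local Notation b := (coef_b q D).

Let bset m := [set r | exists y y' z,
    [/\ histories D z, forall i, (i < m)%N -> y i = y' i &
        r = dTV (fun w => q w y z) (fun w => q w y' z)]].

Let bset_ub m : ubound (bset m) 1.
Proof. by move=> _ [y [y' [z [Dz _ ->]]]]; exact: dTV_q_le1. Qed.

Lemma histories_past x t : D x -> histories D (past x t).
Proof. by move=> Dx; exists x => //; exists t. Qed.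

Let bset_n0 m : bset m !=set0.
Proof.
have [x Dx] := D0; pose y : nat -> E := fun=> point.
by eexists; exists y, y, (past x 0); split => //; exact: histories_past.
Qed.

Lemma dTV_q_le_b m y y' z : histories D z -> (forall i, (i < m)%N -> y i = y' i) ->
  dTV (fun w => q w y z) (fun w => q w y' z) <= b m.
Proof.
move=> Dz yy'; apply: ub_le_sup; first by exists 1; exact: bset_ub.
by exists y, y', z.
Qed.

Lemma coef_b01 m : 0 <= b m <= 1.
Proof.
apply/andP; split; last by apply: ge_sup; [exact: bset_n0|exact: bset_ub].
have [_ [y [y' [z [Dz yy' _]]]]] := bset_n0 m.
exact: le_trans (dTV_ge0 _ _) (dTV_q_le_b Dz yy').
Qed.

Lemma coef_b_dec m : b m.+1 <= b m.
Proof.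
apply: ge_sup; first exact: bset_n0.
move=> _ [y [y' [z [Dz yy' ->]]]]; apply: dTV_q_le_b => // i im.
by apply: yy'; exact: ltnW.
Qed.

(** [q] is only meaningful, and only measurable, along paths in [D]; outside
    [D] it is replaced by 0, which keeps it nonnegative and measurable. *)
Definition qD (t : int) (w : E) (u : pathType nat E * pathType int (rvec R dX)) : R :=
  if u.2 \in D then q w u.1 (past u.2 t) else 0.

Lemma qD_ge0 t w u : 0 <= qD t w u.
Proof.
rewrite /qD; case: ifPn => // /set_mem Du.
by have /andP[/ltW] := q01 w u.1 (histories_past t Du).
Qed.

Lemma qDE t w y x : D x -> qD t w (y, x) = q w y (past x t).
Proof. by move=> Dx; rewrite /qD mem_set. Qed.

Lemma qD_sum1 t y x : D x -> \sum_(w <- es) qD t w (y, x) = 1.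
Proof.
move=> Dx; under eq_bigr do rewrite qDE//.
exact/q_sum1/histories_past.
Qed.

Hypothesis mD : measurable D.
Hypothesis mq : forall t : int, measurable_fun
     [set u : E * pathType nat E * pathType int (rvec R dX) | D u.2]
     (fun u => q u.1.1 u.1.2 (past u.2 t)).

Lemma measurable_qD t w : measurable_fun setT (qD t w).
Proof.
have mD2 : measurable [set u : pathType nat E * pathType int (rvec R dX) | D u.2].
  by rewrite -[X in measurable X]setTI; exact: measurable_snd.
apply: measurable_fun_if => //.
- apply: (measurable_fun_bool true); rewrite setTI.
  rewrite (_ : _ @^-1` _ = [set u | D u.2])//.
  by apply/seteqP; split => u /= => [/set_mem|/mem_set].
- rewrite setTI.
  have mw : measurable_fun setT (fun u : pathType nat E * pathType int (rvec R dX) =>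
      ((w, u.1), u.2)).
    by apply: measurable_fun_pair => //; apply: measurable_fun_pair.
  rewrite (_ : _ @^-1` _ = [set u | D u.2]); last first.
    by apply/seteqP; split => u /= => [/set_mem|/mem_set].
  apply: (measurable_comp _ _ (mq t) (measurable_funTS mw)).
  + by rewrite -[X in measurable X]setTI; exact: measurable_snd.
  + by move=> _ [u Du <-].
Qed.

End transitions.

Lemma eq_back (R : realType) (T : eqType) (es : seq T)
    (p p' : nat -> T -> (nat -> T) -> R) M k k' Phi y :
  (forall l, (l < M)%N -> p (k + l)%N = p' (k' + l)%N) ->
  back es p M k Phi y = back es p' M k' Phi y.
Proof.
elim: M k k' y => //= M IH k k' y pp'.
apply: eq_bigr => w _; have := pp' 0%N (ltn0Sn _); rewrite !addn0 => ->.
by congr (_ * _); apply: IH => l lM; rewrite !addSnnS; exact: pp'.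
Qed.

Section expectation.
Context (R : realType) dE (E : measurableType dE) (dX : nat).
Hypotheses (finE : finite_set [set: E]) (discE : forall A : set E, measurable A).
Context (q : E -> (nat -> E) -> (nat -> rvec R dX) -> R)
        (D : set (pathType int (rvec R dX))).
Hypothesis D0 : D !=set0.
Hypothesis q01 : forall w y z, histories D z -> 0 < q w y z < 1.
Hypothesis q1 : forall y z, histories D z -> \sum_(w \in [set: E]) q w y z = 1.
Hypothesis mD : measurable D.
Hypothesis mq : forall t : int, measurable_fun
     [set u : E * pathType nat E * pathType int (rvec R dX) | D u.2]
     (fun u => q u.1.1 u.1.2 (past u.2 t)).

Local Notation es := (symbols E).
Local Notation HX := (pathType nat E * pathType int (rvec R dX))%type.
Local Notation b := (coef_b q D).

(** Expectation of [Phi] at time [t + M], given the response history at time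
    [t] and the whole covariate path. *)
Definition expect (t : int) (M : nat) (Phi : HX -> R) (u : HX) : R :=
  back es (fun k w y => qD q D (t + k.+1%:Z) w (y, u.2)) M 0
    (fun y => Phi (y, u.2)) u.1.

Lemma expectS t M Phi u : expect t M.+1 Phi u =
  \sum_(w <- es) qD q D (t + 1) w u * expect (t + 1) M Phi (scons w u.1, u.2).
Proof.
case: u => y x; rewrite /expect /=; apply: eq_bigr => w _; congr (_ * _).
by apply: eq_back => l _; rewrite add1n add0n intS addrA.
Qed.

Lemma measurable_scons (w : E) :
  measurable_fun setT (scons w : pathType nat E -> pathType nat E).
Proof.
apply: measurable_fun_path => -[|i]; first exact: measurable_cst.
exact: measurable_coord.
Qed.

Lemma measurable_expect t M Phi : measurable_fun setT Phi ->
  measurable_fun setT (expect t M Phi).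
Proof.
move=> mPhi; elim: M t => [|M IH] t.
  by rewrite (_ : expect _ _ _ = Phi)//; apply/funext => -[].
rewrite (_ : expect _ _ _ = fun u => \sum_(w <- es) qD q D (t + 1) w u *
  expect (t + 1) M Phi (scons w u.1, u.2)); last by apply/funext => u; rewrite expectS.
apply: measurable_sum => w; apply: measurable_funM.
  exact: (measurable_qD mD mq).
apply: (measurableT_comp (IH (t + 1))).
apply: measurable_fun_pair; last exact: measurable_snd.
exact: measurableT_comp (measurable_scons w) measurable_fst.
Qed.

Lemma expect_ge0 t M Phi : (forall u, 0 <= Phi u) -> forall u, 0 <= expect t M Phi u.
Proof.
move=> P0; elim: M t => [|M IH] t u; first by case: u => y x; exact: P0.
rewrite expectS; apply: sumr_ge0 => w _; rewrite mulr_ge0//.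
exact: (qD_ge0 q01).
Qed.

Lemma expect_past t M Phi y x x' :
  D x -> D x' -> past x (t + M%:Z) = past x' (t + M%:Z) ->
  (forall z, Phi (z, x) = Phi (z, x')) ->
  expect t M Phi (y, x) = expect t M Phi (y, x').
Proof.
move=> Dx Dx'; elim: M t y => [|M IH] t y xx' PP; first exact: PP.
rewrite !expectS; apply: eq_bigr => w _ /=; congr (_ * _).
  rewrite !qDE//; congr (q _ _ _); apply/funext => i.
  have := congr1 (fun z => z (M + i)%N) xx'; rewrite /past.
  by rewrite (_ : t + M.+1%:Z - (M + i)%:Z = t + 1 - i%:Z)//; lia.
by apply: IH => //; rewrite -addrA -intS.
Qed.

(** Comparison of the expectations attached to two covariate paths, the case
    of interest of [back_coupling]. *)
Lemma expect_coupling (I : eqType) (s : seq I) (j : I -> nat) (Gam : R)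
    (delta : nat -> R) (Phi : HX -> R) t M y y' x x' :
  D x -> D x' -> (forall l, 0 <= delta l) ->
  (forall l z, dTV (fun w => q w z (past x (t + l.+1%:Z)))
                   (fun w => q w z (past x' (t + l.+1%:Z))) <= delta l) ->
  (forall i, i \in s -> (0 < j i <= M)%N) ->
  (forall z z', `|Phi (z, x) - Phi (z', x')| <=
     \sum_(i <- s) (z (M - j i)%N != z' (M - j i)%N)%:R + Gam) ->
  `|expect t M Phi (y, x) - expect t M Phi (y', x')| <=
    \sum_(i <- s) mismatch b delta 0 (j i) 0 + Gam.
Proof.
move=> Dx Dx' d0 hd js PP.
have b01 := coef_b01 finE D0 q01 q1.
have b_dec := coef_b_dec finE D0 q01 q1.
have H := @back_coupling R E es b b01 b_dec I s j Gam
  (fun k w y => qD q D (t + k.+1%:Z) w (y, x))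
  (fun k w y => qD q D (t + k.+1%:Z) w (y, x')) delta
  (fun y => Phi (y, x)) (fun y => Phi (y, x')) M 0 0 y y'.
apply: le_trans (H _ _ _ _ d0 _ _ _ _) _ => {H} //.
- by move=> l w z; exact: (qD_ge0 q01).
- by move=> l w z; exact: (qD_ge0 q01).
- by move=> l z; exact: (qD_sum1 finE q1).
- by move=> l z; exact: (qD_sum1 finE q1).
- move=> l m z z' zz'.
  have qe x0 z0 : D x0 -> (fun w => qD q D (t + l.+1%:Z) w (z0, x0)) =
      fun w => q w z0 (past x0 (t + l.+1%:Z)).
    by move=> Dx0; apply/funext => w; rewrite qDE.
  rewrite -(dTV_symbols finE (fun w => qD q D (t + l.+1%:Z) w (z, x))
      (fun w => qD q D (t + l.+1%:Z) w (z', x'))).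
  rewrite !qe//; apply: le_trans (dTV_triangle finE _
    (fun w => q w z' (past x (t + l.+1%:Z))) _) _.
  apply: lerD => //.
  have /= := @dTV_q_le_b R _ _ _ finE q D q01 q1 m z z'.
  by apply => //; exact: histories_past.
- by move=> i /js/andP[].
rewrite lerD2r [leLHS]big_seq [leRHS]big_seq; apply: ler_sum => i /js/andP[j0 _].
by rewrite leqNgt j0.
Qed.

End expectation.

(** * From disjoint past events to the supremum over test functions *)

Fixpoint running_max (R : realType) (x : nat -> R) (n : nat) : R :=
  if n is n'.+1 then Order.max (running_max x n') (x n') else 0.

Section partition.
Context (R : realType) dO (O : measurableType dO) (P : probability O R).
Context d (T : measurableType d) (G : set (set O)) (Z : O -> T).
Context (k : O -> probability T R).
Hypothesis mG : <<s G >> `<=` @measurable _ O.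
Hypothesis mZ : measurable_fun setT Z.
Hypothesis kZ : cond_dist P <<s G >> Z (fun o => k o).

Lemma measurable_cond_dist_gen A : measurable A ->
  @measurable_fun _ _ (g_sigma_algebraType G) (\bar R) setT (fun o => k o A).
Proof.
move=> mA; have [h _] := kZ mA.
rewrite (_ : (fun o => _) = EFin \o fun o => fine (k o A)).
  by apply/measurable_EFinP => _ B mB; rewrite setTI; exact: h.
by apply/funext => o /=; rewrite fineK// fin_num_measure.
Qed.

Lemma measurable_cond_integral_gen (f : T -> \bar R) : measurable_fun setT f ->
  (forall v, 0 <= f v)%E ->
  @measurable_fun _ _ (g_sigma_algebraType G) (\bar R) setT
    (fun o => \int[k o]_v f v)%E.
Proof.
move=> mf f0.
apply: (@measurable_fun_ge0_integral _ _ R _ (g_sigma_algebraType G) k) => //.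
exact: measurable_cond_dist_gen.
Qed.

Lemma measurable_gen_fun d' (U : measurableType d') (f : O -> U) :
  @measurable_fun _ _ (g_sigma_algebraType G) U setT f -> measurable_fun setT f.
Proof. by move=> mf _ A mA; apply: mG; exact: mf. Qed.

Lemma cond_dist_integral (B : set O) (f : T -> \bar R) : <<s G >> B ->
  measurable_fun setT f -> (forall v, 0 <= f v)%E ->
  (\int[P]_(o in B) \int[k o]_v f v = \int[P]_(o in B) f (Z o))%E.
Proof.
move=> GB mf f0; have mB := mG GB.
have mk A : measurable A -> measurable_fun setT (fun o => k o A).
  by move=> mA; apply: measurable_gen_fun; exact: measurable_cond_dist_gen.
have md A : measurable A -> measurable_fun setT (fun o => \d_(Z o) A : \bar R).
  by move=> mA; exact: measurable_dirac_comp.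
have restr (h : O -> \bar R) :
    (\int[P]_(o in B) h o = \int[P]_o ((\1_B o : R)%:E * h o))%E.
  rewrite integral_mkcond; apply: eq_integral => o _; rewrite patchE indicE.
  by case: (_ \in B); rewrite ?mul1e ?mul0e.
rewrite !restr.
transitivity (\int[P]_o ((\1_B o : R)%:E * \int[dirac (Z o)]_v f v))%E; last first.
  by apply: eq_integral => o _; rewrite integral_dirac// diracT mul1e.
apply: (bind_eq_integral (k1 := k) (k2 := fun o => dirac (Z o))) => //.
move=> A mA; rewrite -!restr; have [_ h] := kZ mA.
have := h B GB; under eq_integral do rewrite fineK ?fin_num_measure//.
move=> ->.
have mZA : measurable (Z @^-1` A) by rewrite -[X in measurable X]setTI; exact: mZ.
rewrite -(setIC (Z @^-1` A)) -integral_indic//.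
Qed.

Context (f : nat -> T -> R) (M : nat -> R) (K : \bar R).
Hypothesis mf : forall i, measurable_fun setT (f i).
Hypothesis f_bound : forall i v, 0 <= f i v <= M i.
Hypothesis f0 : forall v, f 0%N v = 0.
Hypothesis f_partition : forall n (B : nat -> set O), (forall i, <<s G >> (B i)) ->
  trivIset setT B ->
  (\sum_(0 <= i < n) \int[P]_(o in B i) (f i (Z o))%:E <=
   \sum_(0 <= i < n) (P (B i) * \int[P]_o (f i (Z o))%:E) + K)%E.

Let u i o : \bar R := (\int[k o]_v (f i v)%:E)%E.
Let m i : \bar R := (\int[P]_o (f i (Z o))%:E)%E.

Let f_ge0 i v : 0 <= f i v. Proof. by have /andP[] := f_bound i v. Qed.
Let mEf i : measurable_fun setT (fun v => (f i v)%:E : \bar R).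
Proof. exact/measurable_EFinP. Qed.

Let u0 i o : (0 <= u i o)%E.
Proof. by apply: integral_ge0 => v _; rewrite lee_fin. Qed.
Let m0 i : (0 <= m i)%E.
Proof. by apply: integral_ge0 => v _; rewrite lee_fin. Qed.

Let finu i o : u i o \is a fin_num.
Proof.
rewrite ge0_fin_numE//; apply: (@le_lt_trans _ _ (\int[k o]_v (M i)%:E)%E).
  apply: ge0_le_integral => //.
  - by move=> v _; rewrite lee_fin.
  - by move=> v _; rewrite lee_fin; have /andP[] := f_bound i v.
by rewrite integral_cst// [X in (_ * X)%E]probability_setT mule1 ltry.
Qed.

Let finm i : m i \is a fin_num.
Proof.
rewrite ge0_fin_numE//; apply: (@le_lt_trans _ _ (\int[P]_o (M i)%:E)%E).
  apply: ge0_le_integral => //.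
  - by move=> v _; rewrite lee_fin.
  - by apply: (measurableT_comp (mEf i)).
  - by move=> v _; rewrite lee_fin; have /andP[] := f_bound i (Z v).
by rewrite integral_cst// [X in (_ * X)%E]probability_setT mule1 ltry.
Qed.

Let a i o : R := fine (u i o) - fine (m i).

Let mu i : @measurable_fun _ _ (g_sigma_algebraType G) (\bar R) setT (u i).
Proof. by apply: measurable_cond_integral_gen => // v; rewrite lee_fin. Qed.

Let ma i : @measurable_fun _ _ (g_sigma_algebraType G) R setT (a i).
Proof.
apply: (@measurable_funB _ (g_sigma_algebraType G)); last exact: measurable_cst.
by apply: (measurableT_comp _ (mu i)).
Qed.

Let top n o : R := running_max (a^~ o) n.

Let topS n o : top n.+1 o = Order.max (top n o) (a n o).
Proof. by []. Qed.

Let mtop n : @measurable_fun _ _ (g_sigma_algebraType G) R setT (top n).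
Proof.
elim: n => [|n IH].
  exact: measurable_cst.
by rewrite (funext (topS n)); exact: measurable_maxr.
Qed.

Let top_ge n i o : (i < n)%N -> a i o <= top n o.
Proof.
elim: n => // n IH; rewrite ltnS leq_eqVlt topS le_max => /predU1P[->|/IH ->//].
by rewrite lexx orbT.
Qed.

Let top_ge0 n o : 0 <= top n o.
Proof. by elim: n => // n IH; rewrite topS le_max IH. Qed.

Let top_mono o : nondecreasing_seq (top^~ o).
Proof.
by apply/nondecreasing_seqP => n; rewrite topS le_max lexx.
Qed.

Let a0 o : a 0%N o = 0.
Proof.
rewrite /a /u /m !integral0_eq ?subrr// => ? _; by rewrite f0.
Qed.

(** The event that the maximum of the first [n] gaps is first attained by [i]. *)
Let B n i : set O :=
  if (i < n)%N then [set o | a i o = top n o /\ forall j, (j < i)%N -> a j o < top n o]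
  else set0.

Let GB n i : <<s G >> (B n i).
Proof.
rewrite /B; case: ifP => _; last exact: (@measurable0 _ (g_sigma_algebraType G)).
have mE h : @measurable_fun _ _ (g_sigma_algebraType G) R setT h ->
    <<s G >> [set o | h o = 0].
  move=> mh; have := mh measurableT [set 0] (measurable_set1 _).
  by rewrite setTI.
have mL h : @measurable_fun _ _ (g_sigma_algebraType G) R setT h ->
    <<s G >> [set o | h o < 0].
  move=> mh; have := mh measurableT `]-oo, 0[%classic (measurable_itv _).
  rewrite setTI => H; rewrite (_ : [set o | _] = h @^-1` `]-oo, 0[%classic)//.
rewrite (_ : [set o | _ /\ _] = [set o | a i o - top n o = 0] `&`
    \bigcap_j [set o | (j < i)%N -> a j o - top n o < 0]).
  apply: (@measurableI _ (g_sigma_algebraType G)); first exact: mE (measurable_funB (ma i) (mtop n)).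
  apply: (@bigcapT_measurable _ (g_sigma_algebraType G)) => j.
  have [ji|ji] := boolP (j < i)%N; last first.
    rewrite (_ : mkset _ = setT); first exact: (@measurableT _ (g_sigma_algebraType G)).
    by apply/seteqP; split => // o _ /=.
  rewrite (_ : mkset _ = [set o | a j o - top n o < 0]); first exact: mL (measurable_funB (ma j) (mtop n)).
  by apply/seteqP; split => o /= h; [exact: h|].
apply/seteqP; split => o /=.
  move=> [-> h]; split; first exact: subrr.
  by move=> j _ /= ji; rewrite subr_lt0 h.
move=> [/subr0_eq-> h]; split => // j ji; rewrite -subr_lt0; exact: (h j).
Qed.

Let trivB n : trivIset setT (B n).
Proof.
apply/trivIsetP => i j _ _ ij; wlog ltij : i j ij / (i < j)%N.
  move=> W; have [|ji|eij] := ltngtP i j; first exact: W.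
    by rewrite setIC; apply: W => //; rewrite eq_sym.
  by rewrite eij eqxx in ij.
rewrite /B; case: ifP => ni; last by rewrite set0I.
case: ifP => nj; last by rewrite setI0.
by rewrite -subset0 => o [[e _] [_ /(_ _ ltij)]]; rewrite e ltxx.
Qed.

Let topE n o : top n.+1 o = \sum_(0 <= i < n.+1) \1_(B n.+1 i) o * a i o.
Proof.
have ex : exists i, (i < n.+1)%N && (a i o == top n.+1 o).
  elim: n => [|n [i /andP[ni /eqP ei]]].
    by exists 0%N; rewrite topS /top /= a0 maxxx.
  rewrite topS maxEle.
  case: ifP => _; first by exists n.+1; rewrite leqnn eqxx.
  by exists i; rewrite (leqW ni) ei eqxx.
have [i /andP[ni /eqP ei] mini] := ex_minnP ex.
rewrite (bigD1_seq i) ?mem_index_iota ?iota_uniq//= big1 ?addr0.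
  rewrite indicE mem_set ?mul1r// /B ni; split => // j ji.
  rewrite lt_neqAle top_ge ?(ltn_trans ji)// andbT; apply/negP => ej.
  by have := mini j; rewrite ej (ltn_trans ji ni) leqNgt ji => /(_ isT).
move=> j ji; rewrite indicE memNset ?mul0r// => Bj.
have Bi : B n.+1 i o.
  rewrite /B ni; split => // j' ji'.
  rewrite lt_neqAle top_ge ?(ltn_trans ji')// andbT; apply/negP => ej.
  by have := mini j'; rewrite ej (ltn_trans ji' ni) leqNgt ji' => /(_ isT).
move/trivIsetP : (@trivB n.+1) => /(_ j i Logic.I Logic.I ji).
by move=> /seteqP[/(_ o (conj Bj Bi))].
Qed.

Let B_ge0 n i o : B n i o -> 0 <= a i o.
Proof. by rewrite /B; case: ifP => // _ [-> _]; exact: top_ge0. Qed.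

Let integral_top n : (\int[P]_o (top n.+1 o)%:E <= K)%E.
Proof.
have mB i : measurable (B n.+1 i) by exact: (mG (GB n.+1 i)).
have maO i : measurable_fun setT (a i) by exact: (measurable_gen_fun (ma i)).
have part_ge0 i o : 0 <= \1_(B n.+1 i) o * a i o.
  rewrite indicE; have [/set_mem/B_ge0 ai|_] := boolP (o \in B n.+1 i).
    by rewrite mul1r.
  by rewrite mul0r.
have cut i : (\int[P]_o (\1_(B n.+1 i) o * a i o)%:E =
    \int[P]_(o in B n.+1 i) (a i o)%:E)%E.
  rewrite [RHS]integral_mkcond; apply: eq_integral => o _; rewrite patchE indicE.
  by case: (_ \in _); rewrite ?mul1r ?mul0r.
have split_u i : (\int[P]_(o in B n.+1 i) (a i o)%:E + P (B n.+1 i) * m i =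
    \int[P]_(o in B n.+1 i) (f i (Z o))%:E)%E.
  rewrite -(@cond_dist_integral (B n.+1 i) (fun v => (f i v)%:E))//; last first.
    by move=> v; rewrite lee_fin.
  rewrite muleC -(fineK (finm i)) -integral_cst// -ge0_integralD//.
  - by apply: eq_integral => o _; rewrite -EFinD subrK fineK.
  - by move=> o /B_ge0; rewrite lee_fin.
  - by apply/measurable_EFinP; exact: measurable_funTS.
  - by move=> o _; rewrite lee_fin fine_ge0.
have E1 : (\int[P]_o (top n.+1 o)%:E =
    \sum_(0 <= i < n.+1) \int[P]_(o in B n.+1 i) (a i o)%:E)%E.
  under eq_integral do rewrite topE -sumEFin.
  rewrite ge0_integral_sum//.
  - by apply: eq_bigr => i _; exact: cut.
  - by move=> i; apply/measurable_EFinP; apply: measurable_funM.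
  - by move=> i o _; rewrite lee_fin part_ge0.
have H := f_partition n.+1 (GB n.+1) (@trivB n.+1).
have finS : (\sum_(0 <= i < n.+1) (P (B n.+1 i) * m i))%E \is a fin_num.
  apply: (big_ind (fun x => x \is a fin_num)) => // [x y xf yf|i _].
    by rewrite fin_numD xf yf.
  by apply: fin_numM => //; exact: fin_num_measure.
move: H; rewrite -(eq_bigr _ (fun i _ => split_u i)) big_split /= -E1 addeC.
by rewrite leeD2lE.
Qed.

(** Events of the past on which each test function is the most favourable one
    are disjoint, so a bound on the average gap summed over disjoint past events
    is a bound on the average of the largest gap. *)
Lemma integral_sup_gap (h : O -> \bar R) : (forall o, 0 <= h o)%E ->
  {ae P, forall o, h o <= ereal_sup (range (fun i => (a i o)%:E))}%E ->
  (\int[P]_o h o <= K)%E.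
Proof.
move=> h0 h_sup.
have mt n : measurable_fun setT (fun o => (top n o)%:E : \bar R).
  by apply/measurable_EFinP; exact: (measurable_gen_fun (mtop n)).
have tmono o : nondecreasing_seq (fun n => (top n o)%:E).
  by move=> n n' nn'; rewrite lee_fin; exact: top_mono.
have t0 n o : (0 <= (top n o)%:E)%E by rewrite lee_fin; exact: top_ge0.
have tcvg o : cvgn (fun n => (top n o)%:E) by exact: ereal_nondecreasing_is_cvgn.
apply: (@le_trans _ _ (\int[P]_o limn (fun n => (top n o)%:E))%E).
  apply: ae_le_integral_nonmeasurable.
  - by [].
  - by move=> o; apply: lime_ge => //; exact: nearW.
  - by apply: emeasurable_fun_cvg mt _ => o _; exact: tcvg.
  apply: filterS h_sup => o /le_trans; apply; apply: ub_ereal_sup => _ [i _ <-].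
  apply: (@le_trans _ _ (top i.+1 o)%:E); first by rewrite lee_fin top_ge.
  by rewrite (cvg_lim _ (ereal_nondecreasing_cvgn (tmono o)))//; apply: ereal_sup_ubound; exists i.+1.
rewrite monotone_convergence//.
apply: lime_le.
  apply: ereal_nondecreasing_is_cvgn => n n' nn'.
  by apply: ge0_le_integral => // o _; exact: tmono.
by exists 1%N => //= -[|n]// _; exact: integral_top.
Qed.

End partition.

(** * Approximation by a countable algebra *)

Section countable_algebra.
Context d (T : measurableType d) (G : nat -> set T).

Definition pattern (n : nat) (v : T) : bitseq := mkseq (fun i => v \in G i) n.

(** Sets that depend on finitely many generators; finite lists of patterns make
    them a countable family. *)
Definition algebra_set (c : nat * seq bitseq) : set T :=
  [set v | pattern c.1 v \in c.2].

Lemma size_pattern n v : size (pattern n v) = n.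
Proof. exact: size_mkseq. Qed.

Lemma patternS n v : pattern n.+1 v = rcons (pattern n v) (v \in G n).
Proof. by rewrite /pattern mkseqS. Qed.

Lemma take_pattern n m v : (n <= m)%N -> take n (pattern m v) = pattern n v.
Proof. by move=> nm; rewrite /pattern /mkseq -map_take take_iota (minn_idPl nm). Qed.

Lemma pattern_set n (Q : pred bitseq) :
  exists c, [set v | Q (pattern n v)] = algebra_set c.
Proof.
exists (n, [seq val w | w <- enum {: n.-tuple bool} & Q (val w)]).
apply/seteqP; split => v /=; last first.
  by move=> /mapP[w]; rewrite mem_filter => /andP[Qw _] ->.
move=> Qv; apply/mapP.
exists (Tuple (introT eqP (size_pattern n v))) => //.
by rewrite mem_filter /= Qv mem_enum.
Qed.

Lemma algebra_setC c : exists c', ~` algebra_set c = algebra_set c'.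
Proof.
have [c' cc'] := pattern_set c.1 (fun p => p \notin c.2).
by exists c'; rewrite -cc'; apply/seteqP; split => v /= /negP.
Qed.

Lemma algebra_setU c c' : exists c'', algebra_set c `|` algebra_set c' = algebra_set c''.
Proof.
have [c'' cc] := pattern_set (maxn c.1 c'.1)
  (fun p => (take c.1 p \in c.2) || (take c'.1 p \in c'.2)).
exists c''; rewrite -cc; apply/seteqP; split => v /=; rewrite !take_pattern ?leq_maxl ?leq_maxr//.
  by move=> [->|->]//; rewrite orbT.
by move=> /orP[]; [left|right].
Qed.

Hypothesis GE : @measurable _ T = <<s range G>>.

Let mG i : measurable (G i).
Proof. by rewrite GE; apply: sub_sigma_algebra; exists i. Qed.

Lemma measurable_algebra_set c : measurable (algebra_set c).
Proof.
have aux n (Q : pred bitseq) : measurable [set v | Q (pattern n v)].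
  elim: n Q => [|n IH] Q.
    have [Q0|Q0] := boolP (Q [::]).
      by rewrite (_ : mkset _ = setT)//; apply/seteqP; split.
    by rewrite (_ : mkset _ = set0)//; apply/seteqP; split => // v /=; rewrite (negbTE Q0).
  rewrite (_ : mkset _ = (G n `&` [set v | Q (rcons (pattern n v) true)]) `|`
                         (~` G n `&` [set v | Q (rcons (pattern n v) false)])).
    apply: measurableU; apply: measurableI => //.
    - exact: (IH (fun p => Q (rcons p true))).
    - exact: measurableC.
    - exact: (IH (fun p => Q (rcons p false))).
  apply/seteqP; split => v /=; rewrite patternS.
    have [vG|vG] := boolP (v \in G n); first by left; split => //; exact: set_mem.
    by right; split => // /mem_set; rewrite (negbTE vG).
  by move=> [[/mem_set ->]//|[Gv]]; rewrite memNset.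
exact: aux c.1 (fun p => p \in c.2).
Qed.

Section approximation.
Context (R : realType) (mu : {measure set T -> \bar R}).
Hypothesis mu_fin : (mu setT < +oo)%E.

Let sd (A B : set T) := (A `\` B) `|` (B `\` A).

Let msd A B : measurable A -> measurable B -> measurable (sd A B).
Proof. by move=> mA mB; apply: measurableU; exact: measurableD. Qed.

Let approx (A : set T) := measurable A /\
  forall eps : R, 0 < eps -> exists c, (mu (sd A (algebra_set c)) <= eps%:E)%E.

Let approx_sub A B C : measurable A -> measurable B -> measurable C ->
  A `<=` B `|` C -> (mu A <= mu B + mu C)%E.
Proof.
move=> mA mB mC ABC; apply: le_trans (measureU2 mu mB mC).
by apply: le_measure => //; apply: mem_set => //; exact: measurableU.
Qed.

Let approxU A B : approx A -> approx B -> approx (A `|` B).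
Proof.
move=> [mA hA] [mB hB]; split; first exact: measurableU.
move=> eps eps0; have eps2 : 0 < eps / 2 by rewrite divr_gt0.
have [c hc] := hA _ eps2; have [c' hc'] := hB _ eps2.
have [c'' cc] := algebra_setU c c'; exists c''; rewrite -cc.
rewrite [eps]splitr EFinD; apply: le_trans (leeD hc hc').
have mc := measurable_algebra_set.
apply: approx_sub; rewrite ?/sd; do ?[exact: msd|exact: measurableU].
by apply: msd; apply: measurableU.
move=> v [[[Av|Bv] /not_orP[nc nc']]|[[cv|cv] /not_orP[nA nB]]].
- by left; left.
- by right; left.
- by left; right.
- by right; right.
Qed.

(** The approximable sets form a sigma-algebra: complements and finite unions
    are taken inside the algebra, and continuity of the measure reduces
    countable unions to finite ones. *)
Lemma algebra_set_dense A (eps : R) : measurable A -> 0 < eps ->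
  exists c, (mu (sd A (algebra_set c)) <= eps%:E)%E.
Proof.
move=> mA; suff [_] : approx A by exact.
move: A mA; rewrite GE; apply: smallest_sub; last first.
  move=> _ [i _ <-]; split => // e e0.
  have [c cE] := pattern_set i.+1 (fun p => nth false p i).
  exists c; rewrite -cE (_ : sd _ _ = set0) ?measure0 ?lee_fin ?ltW//.
  rewrite (_ : [set v | _] = G i) /sd ?setDv ?setU0//.
  by apply/seteqP; split => v /=; rewrite nth_mkseq//; [exact: set_mem|exact: mem_set].
split.
- split => // e e0; have [c cE] := pattern_set 0 pred0.
  exists c; rewrite -cE (_ : sd _ _ = set0) ?measure0 ?lee_fin ?ltW//.
  by rewrite /sd set0D set0U -subset0 => v [].
- move=> A [mA hA]; split; first by rewrite setTD; exact: measurableC.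
  move=> e /hA[c hc]; have [c' cc'] := algebra_setC c.
  exists c'; rewrite -cc' (_ : sd _ _ = sd A (algebra_set c))// setTD.
  by rewrite /sd !setDE !setCK setUC [X in X `|` _]setIC [X in _ `|` X]setIC.
move=> F hF; have mF i : measurable (F i) by have [] := hF i.
split; first exact: bigcup_measurable.
move=> e e0; have e2 : 0 < e / 2 by rewrite divr_gt0.
pose U n := \big[setU/set0]_(i < n) F i.
have mU n : measurable (U n) by exact: bigsetU_measurable.
have hU n : approx (U n).
  elim: n => [|n IH]; last by rewrite /U big_ord_recr; exact: approxU.
  rewrite /U big_ord0; split => // e' e'0; have [c cE] := pattern_set 0 pred0.
  exists c; rewrite -cE (_ : sd _ _ = set0) ?measure0 ?lee_fin ?ltW//.
  by rewrite /sd set0D set0U -subset0 => v [].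
pose A := \bigcup_n F n.
have mA : measurable A by exact: bigcup_measurable.
have rest : mu (A `\` U n) @[n --> \oo] --> 0%E.
  rewrite -(measure0 mu) (_ : set0 = \bigcap_n (A `\` U n)); last first.
    apply/esym; rewrite -subset0 => v h; have [[i _ Fi] _] := h 0%N Logic.I.
    have [_] := h i.+1 Logic.I; apply.
    by rewrite /U -bigcup_mkord; exists i => /=.
  apply: nonincreasing_cvg_mu.
  - apply: le_lt_trans mu_fin; apply: le_measure => //; apply: mem_set => //.
    exact: measurableD.
  - by move=> n; exact: measurableD.
  - by apply: bigcapT_measurable => n; exact: measurableD.
  move=> n n' nn'; apply/subsetPset => v [Av Uv]; split => // Uv'; apply: Uv.
  move: Uv'; rewrite /U -!bigcup_mkord => -[i /= i_n Fi].
  by exists i => //=; exact: leq_trans nn'.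
have [n hn] : exists n, (mu (A `\` U n) <= (e / 2)%:E)%E.
  have : nbhs 0%E [set x | (x < (e / 2)%:E)%E].
    by apply: open_nbhs_nbhs; split; [exact: open_ereal_lt_ereal|rewrite /= lte_fin].
  by move=> /rest[n _ /(_ n (leqnn n)) h]; exists n; exact: ltW.
have [_ /(_ _ e2)[c hc]] := hU n; exists c.
have mc := measurable_algebra_set c.
rewrite [e]splitr EFinD; apply: le_trans (leeD hn hc).
apply: approx_sub; [exact: msd|exact: measurableD|exact: msd|].
move=> v [[Av cv]|[cv nA]].
  by have [Uv|Uv] := pselect (U n v); [right; left|left].
right; right; split => // Uv; apply: nA.
by move: Uv; rewrite /U -bigcup_mkord => -[i _ Fi]; exists i.
Qed.

End approximation.

(** The absolute value costs nothing because the algebra is closed under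
    complement. *)
Lemma algebra_sup_dist (R : realType) (p p' : probability T R) (K : \bar R) :
  (forall c, (p (algebra_set c) - p' (algebra_set c) <= K)%E) ->
  forall A, measurable A -> (`|p A - p' A| <= K)%E.
Proof.
move=> hK.
have half A : measurable A -> (p A - p' A <= K)%E.
  move=> mA; apply/lee_addgt0Pr => eps eps0.
  have e2 : 0 < eps / 2 by rewrite divr_gt0.
  have fin : (measure_add p p' setT < +oo)%E.
    by rewrite measure_addE; apply: lte_add_pinfty; rewrite -ge0_fin_numE//; exact: fin_num_measure.
  have [c] := algebra_set_dense fin mA e2.
  rewrite [X in (X <= _)%E]measure_addE => hc.
  set C := algebra_set c in hc *; have mC : measurable C := measurable_algebra_set c.
  have mAC : measurable (A `\` C) by exact: measurableD.
  have mCA : measurable (C `\` A) by exact: measurableD.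
  have msd : measurable ((A `\` C) `|` (C `\` A)) by exact: measurableU.
  have le1 (m : probability T R) B B' : measurable B -> measurable B' ->
      B `<=` B' -> (m B <= m B')%E.
    by move=> mB mB' BB'; apply: le_measure => //; exact: mem_set.
  have h1 : (p A <= p C + p ((A `\` C) `|` (C `\` A)))%E.
    apply: (@le_trans _ _ (p (C `|` ((A `\` C) `|` (C `\` A))))); last exact: measureU2.
    apply: le1 => //; first exact: measurableU.
    by move=> v Av; have [|] := pselect (C v); [left|right; left].
  have h2 : (p' C <= p' A + p' ((A `\` C) `|` (C `\` A)))%E.
    apply: (@le_trans _ _ (p' (A `|` ((A `\` C) `|` (C `\` A))))); last exact: measureU2.
    apply: le1 => //; first exact: measurableU.
    by move=> v Cv; have [|] := pselect (A v); [left|right; right].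
  have {}hc : (p ((A `\` C) `|` (C `\` A)) + p' ((A `\` C) `|` (C `\` A)) <= (eps / 2)%:E)%E.
    exact: hc.
  have := hK c; rewrite -/C; move: hc h1 h2.
  rewrite -(fineK (fin_num_measure p A mA)) -(fineK (fin_num_measure p' A mA)).
  rewrite -(fineK (fin_num_measure p C mC)) -(fineK (fin_num_measure p' C mC)).
  rewrite -(fineK (fin_num_measure p _ msd)) -(fineK (fin_num_measure p' _ msd)).
  case: K {hK} => [r| |]; rewrite -?EFinN -?EFinD ?lee_fin ?leey//.
  by move=> *; lra.
move=> A mA; have := half _ mA; have := half _ (measurableC mA).
rewrite !probability_setC//.
rewrite -(fineK (fin_num_measure p A mA)) -(fineK (fin_num_measure p' A mA)).
case: K {hK half} => [r| |]; rewrite -?EFinN -?EFinD ?lee_fin ?leey//.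
by move=> h1 h2; rewrite ler_norml; apply/andP; split; lra.
Qed.

End countable_algebra.

(** * A countable algebra on the path space of the observations *)

Section path_generators.
Context (R : realType) dE (E : measurableType dE) (dX : nat).
Hypotheses (finE : finite_set [set: E]) (discE : forall A : set E, measurable A).
Local Notation VN := (pathType nat (E * rvec R dX)%type).
Local Notation code := (nat * (nat + 'I_dX * rat))%type.

(** The first component is the time coordinate a generator looks at. *)
Definition path_gen (n : nat) : set VN :=
  match (choice.unpickle n : option code) with
  | Some (t, inl i) => [set v : VN | (v t).1 = nth point (symbols E) i]
  | Some (t, inr (c, r)) => [set v : VN | ((v t).2 : 'rV[R]_dX) 0 c < ratr r]
  | None => set0
  end.

Definition path_gen_time (n : nat) : nat :=
  if (choice.unpickle n : option code) is Some (t, _) then t else 0%N.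

Lemma path_gen_pickle (x : code) : range path_gen
  match x with
  | (t, inl i) => [set v : VN | (v t).1 = nth point (symbols E) i]
  | (t, inr (c, r)) => [set v : VN | ((v t).2 : 'rV[R]_dX) 0 c < ratr r]
  end.
Proof. by exists (choice.pickle x) => //; rewrite /path_gen choice.pickleK; case: x => t [i|[c r]]. Qed.

Lemma path_genE : @measurable _ VN = <<s range path_gen>>.
Proof.
apply/seteqP; split; last first.
  apply: smallest_sub; first exact: sigma_algebra_measurable.
  move=> _ [n _ <-]; rewrite /path_gen; case: choice.unpickle => [[t [i|[c r]]]|//].
    rewrite (_ : mkset _ = (fun v : VN => (v t).1) @^-1` [set nth point (symbols E) i])//.
    rewrite -[X in measurable X]setTI.
    exact: (measurableT_comp measurable_fst (measurable_coord t)).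
  rewrite (_ : mkset _ = (fun v : VN => ((v t).2 : 'rV[R]_dX) 0 c) @^-1` `]-oo, (ratr r : R)[%classic)//.
  rewrite -[X in measurable X]setTI.
  apply: (measurableT_comp (measurable_rvec_coord c)) => //.
  exact: (measurableT_comp measurable_snd (measurable_coord t)).
apply: smallest_sub; first exact: smallest_sigma_algebra.
move=> _ [t _ [A mA <-]].
pose VG := g_sigma_algebraType (range path_gen).
have mt : @measurable_fun _ _ VG (E * rvec R dX)%type setT (fun v => v t).
  rewrite (_ : (fun v => _) = fun v : VG => ((v t).1, (v t).2)); last first.
    by apply/funext => v; case: (v t).
  apply: measurable_fun_pair.
    move=> _ B _; rewrite setTI.
    rewrite (_ : _ @^-1` B = \bigcup_(i in [set i | (i < size (symbols E))%N /\
        B (nth point (symbols E) i)]) [set v : VG | (v t).1 = nth point (symbols E) i]).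
      apply: (@bigcup_measurable _ VG) => i _; apply: sub_sigma_algebra.
      exact: (path_gen_pickle (t, inl i)).
    apply/seteqP; split => [v Bv|v [i [_ Bi] /= vi]]; last by rewrite /= vi.
    have ve := mem_symbols finE (v t).1.
    exists (index (v t).1 (symbols E)); rewrite /= ?nth_index//.
    by split => //; rewrite index_mem.
  apply: (measurability _ (@rvec_measurableE R dX)).
  move=> _ [_ [c [r ->]] <-]; rewrite setTI; apply: sub_sigma_algebra.
  exact: (path_gen_pickle (t, inr (c, r))).
exact: (mt measurableT A mA).
Qed.

(** A set of the countable algebra looks at finitely many coordinates, so its
    indicator is Lipschitz for the number of coordinates that differ. *)
Lemma algebra_set_local c : exists L : nat, forall v v' : VN,
  `|\1_(algebra_set path_gen c) v - \1_(algebra_set path_gen c) v'| <=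
    \sum_(i <- iota 0 L) (((v i).1 != (v' i).1)%:R + discrete_metric ((v i).2 : 'rV[R]_dX) (v' i).2) :> R.
Proof.
pose L := (\max_(i < c.1) path_gen_time i).+1; exists L => v v'.
have [vv'|/existsNP[i /not_implyP[iL /eqP vi]]] :=
    pselect (forall i, (i < L)%N -> v i = v' i).
  rewrite (_ : \1_(algebra_set path_gen c) v = \1_(algebra_set path_gen c) v').
    rewrite subrr normr0; apply: sumr_ge0 => i _; by rewrite addr_ge0// ler0n.
  rewrite !indicE; congr (_%:R); congr nat_of_bool.
  suff same n : (n <= c.1)%N -> pattern path_gen n v = pattern path_gen n v'.
    by apply/idP/idP => /set_mem; rewrite /algebra_set /= ?same//; move=> h; apply/mem_set;
      rewrite /algebra_set /= ?same// -same.
  elim: n => // n IH nc; rewrite !patternS IH ?(ltnW nc)//; congr rcons.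
  have tL : (path_gen_time n < L)%N.
    by rewrite /L ltnS; exact: (leq_bigmax (Ordinal nc)).
  move: tL; rewrite /path_gen_time /path_gen; case: choice.unpickle => [[t [k|[k r]]] /= tL|_].
  - by apply/idP/idP => /set_mem h; apply/mem_set; move: h; rewrite /= (vv' t tL).
  - by apply/idP/idP => /set_mem h; apply/mem_set; move: h; rewrite /= (vv' t tL).
  - by rewrite !in_set0.
have i_iota : i \in iota 0 L by rewrite mem_iota.
rewrite (bigD1_seq i) ?iota_uniq//=.
have rest : 0 <= \sum_(j <- iota 0 L | j != i)
    (((v j).1 != (v' j).1)%:R + discrete_metric (v j).2 (v' j).2) :> R.
  by apply: sumr_ge0 => j _; rewrite addr_ge0// ler0n.
have one : 1 <= ((v i).1 != (v' i).1)%:R + discrete_metric ((v i).2 : 'rV[R]_dX) (v' i).2 :> R.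
  rewrite /discrete_metric; move: vi; case: (v i) (v' i) => [y x] [y' x'] /=.
  rewrite xpair_eqE negb_and => /orP[->|->]; first by rewrite lerDl ler0n.
  by rewrite lerDr ler0n.
apply: (@le_trans _ _ 1); last lra.
rewrite !indicE; do 2 case: (_ \in _); rewrite ?subrr ?subr0 ?sub0r ?normrN ?normr0 ?normr1//.
Qed.

Lemma path_sup_dist (p p' : probability VN R) (K : \bar R) :
  (forall x, p (algebra_set path_gen x) - p' (algebra_set path_gen x) <= K)%E ->
  forall A, measurable A -> (`|p A - p' A| <= K)%E.
Proof. exact: (algebra_sup_dist path_genE). Qed.

End path_generators.

(** * A countable class of test functions for the Wasserstein distance *)

Section lipschitz_class.
Context (R : realType) dE (E : measurableType dE) (dX l : nat).
Hypotheses (finE : finite_set [set: E]) (discE : forall A : set E, measurable A).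
Local Notation VI := (pathType 'I_l (E * rvec R dX)%type).
Local Notation node := {ffun 'I_l -> nat * 'rV[rat]_dX}.

(** Points with rational coordinates, the symbols being numbered. *)
Definition center (z : node) : VI := fun i =>
  (nth point (symbols E) (z i).1, \row_c ratr ((z i).2 0 c) : rvec R dX).

Definition path_dist (v w : VI) : R := \sum_(i < l) gamma_bar (v i) (w i).

Let cap (N : nat) (s : seq (rat * node)) (v : VI) : R :=
  foldr (fun p acc => Num.min (N%:R + ratr p.1 + path_dist v (center p.2)) acc) (2 * N%:R) s.

(** Truncations to [- N, N], shifted by [N], of the lower envelope of finitely
    many cones with rational apex. *)
Definition envelope (x : nat * seq (rat * node)) (v : VI) : R :=
  Num.max 0 (cap x.1 x.2 v).

Lemma gamma_bar_ge0 (v w : E * 'rV[R]_dX) : 0 <= gamma_bar v w.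
Proof. by rewrite addr_ge0// l1norm_ge0. Qed.

Lemma gamma_barC (v w : E * 'rV[R]_dX) : gamma_bar v w = gamma_bar w v.
Proof. by rewrite /gamma_bar eq_sym -l1normN opprB. Qed.

Lemma gamma_bar_triangle (v w u : E * 'rV[R]_dX) :
  gamma_bar v u <= gamma_bar v w + gamma_bar w u.
Proof.
rewrite /gamma_bar addrACA lerD//; last exact: l1_metric_triangle.
have [->|vw] := eqVneq v.1 w.1; first by rewrite add0r.
by case: (_ != _); rewrite ?lerDl ?ler0n// addr_ge0.
Qed.

Lemma path_dist_ge0 v w : 0 <= path_dist v w.
Proof. by apply: sumr_ge0 => i _; exact: gamma_bar_ge0. Qed.

Lemma path_distC v w : path_dist v w = path_dist w v.
Proof. by apply: eq_bigr => i _; exact: gamma_barC. Qed.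

Lemma path_dist_triangle v w u : path_dist v u <= path_dist v w + path_dist w u.
Proof. by rewrite -big_split; apply: ler_sum => i _; exact: gamma_bar_triangle. Qed.

Lemma measurable_path_dist w : measurable_fun setT (fun v => path_dist v w).
Proof.
apply: measurable_sum => i; apply: measurable_funD.
  rewrite (_ : (fun v => _) = \1_((fun v : VI => (v i).1) @^-1` [set~ (w i).1])).
    apply: measurable_indic; rewrite -[X in measurable X]setTI.
    exact: (measurableT_comp measurable_fst (measurable_coord i)).
  apply/funext => v; rewrite indicE; congr (_%:R); congr nat_of_bool.
  by apply/idP/idP => [/eqP h|/set_mem h]; [exact/mem_set|exact/eqP].
have := @measurable_l1_metric R dX; rewrite /l1_metric => ml1.
apply: (measurableT_comp ml1 (g := fun v : VI => ((v i).2, (w i).2))).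
apply: measurable_fun_pair => //.
exact: (measurableT_comp measurable_snd (measurable_coord i)).
Qed.

Lemma measurable_envelope x : measurable_fun setT (envelope x).
Proof.
case: x => N s; apply: measurable_maxr => //.
rewrite /cap /=; elim: s => [|p s IH] //=; apply: measurable_minr => //.
by apply: measurable_funD => //; exact: measurable_path_dist.
Qed.

Lemma envelope_ge0 x v : 0 <= envelope x v.
Proof. by rewrite le_max lexx. Qed.

Lemma envelope_le N s v : envelope (N, s) v <= 2 * N%:R.
Proof.
rewrite ge_max mulr_ge0//=; elim: s => //= p s IH.
by rewrite ge_min IH orbT.
Qed.

Lemma envelope_lip x v w : `|envelope x v - envelope x w| <= path_dist v w.
Proof.
suff half v' w' : envelope x v' <= envelope x w' + path_dist v' w'.
  rewrite ler_norml; apply/andP; split; last by have := half v w; lra.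
  by have := half w v; rewrite path_distC; lra.
have d0 := path_dist_ge0 v' w'.
rewrite ge_max addr_ge0 ?envelope_ge0//=.
apply: (@le_trans _ _ (cap x.1 x.2 w' + path_dist v' w')); last first.
  by rewrite lerD2r le_max lexx orbT.
case: x => N s /=; elim: s => /= [|p s IH]; first by rewrite lerDl.
rewrite addr_minl le_min !ge_min IH orbT andbT; apply/orP; left.
by have := path_dist_triangle v' w' (center p.2); lra.
Qed.

Lemma center_dense v (eps : R) : 0 < eps -> exists z, path_dist v (center z) <= eps.
Proof.
move=> eps0.
pose del := eps / (l.+1%:R * dX.+1%:R).
have del0 : 0 < del by rewrite divr_gt0// mulr_gt0.
have hr (x : R) : exists r : rat, `|x - ratr r| <= del.
  have [|r] := @rat_in_itvoo R (x - del) x; first by rewrite ltrBlDr ltrDl.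
  rewrite in_itv /= => /andP[h1 h2]; exists r.
  by rewrite ger0_norm; [move: h1|]; lra.
have [r Hr] := choice hr.
exists [ffun i => (index (v i).1 (symbols E), \row_c r (((v i).2 : 'rV[R]_dX) 0 c))].
apply: (@le_trans _ _ (\sum_(i < l) dX%:R * del)).
  apply: ler_sum => i _; rewrite /gamma_bar /center /= ffunE /=.
  rewrite nth_index ?mem_symbols// eqxx add0r /l1norm.
  apply: (@le_trans _ _ (\sum_(c < dX) del)).
    by apply: ler_sum => c _; rewrite !mxE; exact: Hr.
  by rewrite sumr_const card_ord -[leLHS]mulr_natl.
rewrite sumr_const card_ord -[leLHS]mulr_natl /del mulrA mulrCA.
rewrite ger_pMr// ler_pdivrMr ?mulr_gt0// mul1r.
by rewrite ler_pM// ler_nat.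
Qed.

Definition origin : node := [ffun => (0%N, 0)].

(** McShane: a 1-Lipschitz function is the lower envelope of the cones whose
    apex lies on or above its graph; rational apices suffice by density, and the
    cone at the origin, kept in every list, provides the domination. *)
Lemma envelope_approx (f : VI -> R) : @lipschitz1 R E dX l f ->
  exists (s : nat -> seq (rat * node)) (C : R),
  (forall n v, `|envelope (n, s n) v - n%:R| <= C + path_dist v (center origin)) /\
  (forall v, envelope (n, s n) v - n%:R @[n --> \oo] --> f v).
Proof.
move=> f_lip.
have f_le v w : f v <= f w + path_dist v w.
  by have /(le_trans (ler_norm _)) := f_lip v w; rewrite /path_dist; lra.
have [r0 r0f] : exists r : rat, f (center origin) <= ratr r.
  have [|r] := @rat_in_itvoo R (f (center origin)) (f (center origin) + 1).
    by rewrite ltrDl.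
  by rewrite in_itv /= => /andP[/ltW h _]; exists r.
pose good (p : rat * node) := f (center p.2) <= ratr p.1.
pose s n := (r0, origin) ::
  pmap (fun i => if (choice.unpickle i : option (rat * node)) is Some p then
                   if good p then Some p else None else None) (iota 0 n).
have good_s n p : p \in s n -> good p.
  rewrite inE => /predU1P[->|]; first exact: r0f.
  rewrite mem_pmap => /mapP[i _]; case: choice.unpickle => // p'.
  by case: ifP => // gp [->].
have cap_ge N t v : (forall p, p \in t -> good p) ->
    Num.min (f v + N%:R) (2 * N%:R) <= cap N t v.
  move=> gt; elim: t gt => [|p t IH] gt /=; first by rewrite ge_min lexx orbT.
  rewrite le_min IH ?andbT; last by move=> p' p't; apply: gt; rewrite inE p't orbT.
  rewrite ge_min; apply/orP; left.
  have := gt p (mem_head _ _); rewrite /good => gp.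
  by have := f_le v (center p.2); lra.
have cap_le N t v p : p \in t -> cap N t v <= N%:R + ratr p.1 + path_dist v (center p.2).
  elim: t => // p' t IH; rewrite inE /= ge_min => /predU1P[->|/IH ->].
    by rewrite lexx.
  by rewrite orbT.
exists s, (`|f (center origin)| + `|ratr r0|); split => [n v|v].
  have n0 : (0 : R) <= n%:R by [].
  have h1 := cap_le n (s n) v (r0, origin) (mem_head _ _).
  have h2 := cap_ge n (s n) v (@good_s n).
  have h3 := f_le (center origin) v; rewrite path_distC in h3.
  have h4 := ler_norm (- f (center origin)); rewrite normrN in h4.
  have h5 := ler_norm (ratr r0 : R); have h6 := normr_ge0 (f (center origin)).
  have h7 := normr_ge0 (ratr r0 : R); have h8 := path_dist_ge0 v (center origin).
  move: h1 h2; rewrite /envelope /=; move: (cap n (s n) v) => c h1 h2.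
  rewrite ler_norml; apply/andP; split.
    rewrite lerBrDr le_max; move: h2; rewrite ge_min => /orP[h2|h2]; apply/orP;
      right; lra.
  by rewrite lerBlDr ge_max; apply/andP; split; lra.
apply/cvgrPdist_le => eps eps0.
have e3 : 0 < eps / 3 by rewrite divr_gt0.
have [z hz] := center_dense v e3.
have [|r] := @rat_in_itvoo R (f (center z)) (f (center z) + eps / 3).
  by rewrite ltrDl.
rewrite in_itv /= => /andP[/ltW fr rf].
have gzr : good (r, z) by exact: fr.
near=> n.
have nf : `|f v| + eps <= n%:R by near: n; exact: nbhs_infty_ger.
have ni : (choice.pickle (r, z) < n)%N by near: n; exact: nbhs_infty_gt.
have mem_rz : (r, z) \in s n.
  rewrite inE mem_pmap; apply/orP; right; apply/mapP.
  by exists (choice.pickle (r, z)); rewrite ?mem_iota// choice.pickleK gzr.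
have h1 := cap_le n (s n) v _ mem_rz.
have h2 := cap_ge n (s n) v (@good_s n).
have h3 := f_le (center z) v; rewrite path_distC in h3.
have h4 := ler_norm (f v); have h5 := ler_norm (- f v); rewrite normrN in h5.
move: h1 h2; rewrite /envelope /=; move: (cap n (s n) v) => c h1 h2.
rewrite distrC ler_norml; apply/andP; split.
  rewrite -lerBlDr opprK; move: h2; rewrite ge_min => /orP[h2|h2].
    by rewrite lerBrDr le_max; apply/orP; right; lra.
  by rewrite lerBrDr le_max; apply/orP; right; lra.
by rewrite lerBlDr lerBlDr ge_max; apply/andP; split; lra.
Unshelve. all: by end_near.
Qed.

Lemma W1_ge0 (p p' : probability VI R) : (0 <= W1 p p')%E.
Proof.
apply: ereal_sup_ubound; exists (cst 0).
  by move=> v v'; rewrite subrr normr0 path_dist_ge0.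
by rewrite !integral0_eq// sube0.
Qed.

Lemma integral_envelope_shift (p : probability VI R) x :
  (\int[p]_v (envelope x v - x.1%:R)%:E =
   (fine (\int[p]_v (envelope x v)%:E) - x.1%:R)%:E)%E.
Proof.
have me : measurable_fun setT (EFin \o envelope x).
  by apply/measurable_EFinP; exact: measurable_envelope.
have fin : (\int[p]_v (envelope x v)%:E)%E \is a fin_num.
  rewrite ge0_fin_numE; last by apply: integral_ge0 => v _; rewrite lee_fin envelope_ge0.
  apply: (@le_lt_trans _ _ (\int[p]_v (2 * x.1%:R)%:E)%E).
    apply: ge0_le_integral => //.
    - by move=> v _; rewrite lee_fin envelope_ge0.
    - by move=> v _; rewrite lee_fin; case: x {me} => N s; exact: envelope_le.
  by rewrite integral_cst// [X in (_ * X)%E]probability_setT mule1 ltry.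
have ie : p.-integrable setT (EFin \o envelope x).
  apply/integrableP; split => //; rewrite -ge0_fin_numE; last by apply: integral_ge0.
  by under eq_integral do rewrite /= ger0_norm ?envelope_ge0//.
under eq_integral do rewrite EFinB.
rewrite (integralB measurableT ie); last first.
  by apply: (finite_measure_integrable_cst p x.1%:R).
have -> : (\int[p]_v (x.1%:R)%:E = x.1%:R%:E)%E.
  by rewrite (eq_integral (cst x.1%:R%:E))// integral_cst// [X in (_ * X)%E]probability_setT mule1.
by rewrite -[in LHS](fineK fin).
Qed.

(** The Wasserstein supremum ranges over arbitrary 1-Lipschitz functions, with no
    measurability required: measurability comes from the approximation, and the
    common domination allows the limit under both laws. *)
Lemma W1_le_envelope (p p' : probability VI R) (K : \bar R) :
  (\int[p]_v (path_dist v (center origin))%:E < +oo)%E ->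
  (\int[p']_v (path_dist v (center origin))%:E < +oo)%E ->
  (forall x, (fine (\int[p]_v (envelope x v)%:E) -
              fine (\int[p']_v (envelope x v)%:E))%:E <= K)%E ->
  (W1 p p' <= K)%E.
Proof.
move=> fin fin' hK; apply: ub_ereal_sup => _ [f f_lip <-].
have [s [C [s_le s_cvg]]] := envelope_approx f_lip.
have mh n : measurable_fun setT (fun v => (envelope (n, s n) v - n%:R)%:E : \bar R).
  by apply/measurable_EFinP; apply: measurable_funB => //; exact: measurable_envelope.
have mf : measurable_fun setT (f : VI -> R).
  apply: (@measurable_fun_cvg _ _ _ _ (fun n v => envelope (n, s n) v - n%:R)) => // n.
  by apply: measurable_funB => //; exact: measurable_envelope.
have dct (m : probability VI R) : (\int[m]_v (path_dist v (center origin))%:E < +oo)%E ->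
    (\int[m]_v (f v)%:E)%E \is a fin_num /\
    (fine (\int[m]_v (envelope (n, s n) v)%:E) - n%:R)%:E @[n --> \oo] -->
      (\int[m]_v (f v)%:E)%E.
  move=> finm.
  have md : measurable_fun setT (EFin \o path_dist^~ (center origin)).
    by apply/measurable_EFinP; exact: measurable_path_dist.
  have id : m.-integrable setT (fun v => (C + path_dist v (center origin))%:E).
    under [X in _.-integrable _ X]eq_fun do rewrite EFinD.
    apply: integrableD => //; first by apply: (finite_measure_integrable_cst m C).
    apply/integrableP; split => //.
    by under eq_integral do rewrite /= ger0_norm ?path_dist_ge0//.
  have cv v : setT v -> (envelope (n, s n) v - n%:R)%:E @[n --> \oo] --> (f v)%:E.
    by move=> _; apply: cvg_EFin; [exact: nearW|exact: s_cvg].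
  have sl v n : setT v -> (`|(envelope (n, s n) v - n%:R)%:E| <=
      (C + path_dist v (center origin))%:E)%E by move=> _; exact: s_le.
  have [intf _ cvgf] := @dominated_convergence _ _ R m setT measurableT
    (fun n v => (envelope (n, s n) v - n%:R)%:E) (fun v => (f v)%:E)
    (fun v => (C + path_dist v (center origin))%:E) mh
    (proj2 (measurable_EFinP _ _) mf)
    (aeW _ cv) id
    (aeW _ sl).
  split; first exact: integrable_fin_num.
  by under eq_fun do rewrite -(integral_envelope_shift m (_, _)).
have [fp cp] := dct p fin; have [fp' cp'] := dct p' fin'.
have H := @cvgeB _ _ eventually_filter _ _ _ _ _ (fin_num_adde_defr _ fp) cp cp'.
rewrite -(cvg_lim _ H)//; apply: lime_le; first by apply/cvg_ex; eexists; exact: H.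
apply: nearW => n; apply: le_trans (hK (n, s n)).
by rewrite -EFinB lee_fin; lra.
Qed.

End lipschitz_class.

(** * Moments and the discrete metric *)

Section moments.
Local Open Scope ereal_scope.

(** Hoelder's inequality with an indicator, the extreme exponents included. *)
Lemma Lnorm_indicator_le d (T : measurableType d) (R : realType)
    (mu : probability T R) (f : T -> R) (A : set T) (p : \bar R) :
  measurable_fun setT f -> (forall x, 0 <= f x)%R -> measurable A -> 1 <= p ->
  \int[mu]_x (f x * \1_A x)%:E <=
  'N[mu]_p[EFin \o f] * mu A `^ fine (hoelder_conjugate p)^-1.
Proof.
move=> mf f0 mA; have mi : measurable_fun setT (\1_A : T -> R) by exact: measurable_indic.
have miE : measurable_fun setT (EFin \o (\1_A : T -> R)) by apply/measurable_EFinP.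
case: p => [p||]//; last first.
  move=> _; rewrite hoelder_conjugatey inve1 /= poweRe1//.
  have mu_pos : 0 < mu setT by rewrite probability_setT lte01.
  have NE : 'N[mu]_+oo[EFin \o f] = ess_sup mu (abse \o (EFin \o f)).
    by rewrite unlock mu_pos.
  have N0 := @Lnorm_ge0 _ T R mu +oo (EFin \o f).
  apply: (@le_trans _ _ (\int[mu]_x ('N[mu]_+oo[EFin \o f] * (\1_A x)%:E))).
    apply: ae_ge0_le_integral => //.
    - by move=> x _; rewrite lee_fin mulr_ge0.
    - by apply/measurable_EFinP; exact: measurable_funM.
    - by move=> x _; rewrite mule_ge0// lee_fin.
    - apply: emeasurable_funM; first exact: measurable_cst.
      exact: miE.
    apply: filterS (ess_sup_ge mu (abse \o (EFin \o f))) => x + _.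
    rewrite -NE /= ger0_norm// EFinM => fN.
    by rewrite lee_wpmul2r// lee_fin.
  rewrite ge0_integralZl//.
  by rewrite integral_indic// setIT.
rewrite lee_fin le_eqVlt => /predU1P[<-|p1].
  rewrite hoelder_conjugate1 invey /= poweRe0 mule1 Lnorm1.
  apply: ge0_le_integral => //.
  - by move=> x _; rewrite lee_fin mulr_ge0.
  - by apply/measurable_EFinP; exact: measurable_funM.
  - by apply: measurableT_comp => //; exact/measurable_EFinP.
  by move=> x _; rewrite /= ger0_norm// lee_fin ler_piMr// indicE; case: (_ \in _).
have p0 : (0 < p)%R by exact: lt_trans p1.
have pp0 : (0 < p - 1)%R by rewrite subr_gt0.
pose q := (p / (p - 1))%R.
have q0 : (0 < q)%R by rewrite divr_gt0.
have -> : fine (hoelder_conjugate p%:E)^-1 = (q^-1)%R.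
  rewrite /hoelder_conjugate/= eqe (gt_eqF p0) -EFinB inver (gt_eqF pp0) -EFinM.
  by rewrite inver (gt_eqF q0).
have pq : (p^-1 + q^-1 = 1)%R by rewrite /q; field; rewrite !gt_eqF.
have := hoelder mu mf mi p0 q0 pq.
rewrite Lnorm1 (_ : \int[mu]_x _ = \int[mu]_x (f x * \1_A x)%:E); last first.
  by apply: eq_integral => x _; rewrite /= ger0_norm ?mulr_ge0.
move=> /le_trans; apply; apply: lee_wpmul2l; first exact: Lnorm_ge0.
rewrite unlock (_ : \int[mu]_x _ = mu A)//.
transitivity (\int[mu]_x (\1_A x)%:E); last by rewrite integral_indic// setIT.
apply: eq_integral => x _; rewrite /= ger0_norm// indicE; case: (_ \in _).
  by rewrite powR1.
by rewrite powR0// gt_eqF.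
Qed.

Lemma hoelder_conjugate_inv (R : realType) (p : \bar R) : 1 <= p ->
  (0 <= fine (hoelder_conjugate p)^-1 <= 1)%R.
Proof.
move=> /hoelder_conj_ge1; case: (hoelder_conjugate p) => [q||]//.
  rewrite lee_fin => q1; have q0 : (0 < q)%R by exact: lt_le_trans q1.
  by rewrite inver gt_eqF//= invr_ge0 ltW//= invf_le1.
by move=> _; rewrite invey /= lexx ler01.
Qed.

(** For finite [p] the norm is read off the law as an integral, for infinite [p]
    as the least level above which the law has no mass. *)
Lemma Lnorm_law_le d1 d2 (T1 : measurableType d1) (T2 : measurableType d2) (R : realType)
    (mu : probability T1 R) (nu : probability T2 R) (f : T1 -> R) (h : T2 -> R) (p : \bar R) :
  measurable_fun setT f -> measurable_fun setT h -> 1 <= p ->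
  (forall psi : R -> \bar R, measurable_fun setT psi -> (forall x, 0 <= psi x) ->
     \int[mu]_x psi (f x) = \int[nu]_x psi (h x)) ->
  'N[mu]_p[EFin \o f] <= 'N[nu]_p[EFin \o h].
Proof.
move=> mf mh p1 law; case: p p1 => [p||]// p1.
  rewrite unlock (law (fun x => `|x%:E| `^ p))// => [|x]; last exact: poweR_ge0.
  apply: (measurableT_comp (measurable_poweR p)).
  by apply: measurableT_comp => //; exact: measurable_EFin.
have mu_pos : 0 < mu setT by rewrite probability_setT lte01.
have nu_pos : 0 < nu setT by rewrite probability_setT lte01.
rewrite unlock mu_pos nu_pos.
set M := ess_sup nu _; apply/ess_supP.
pose N := [set x : R | M < `|x|%:E].
have mN : measurable N.
  rewrite (_ : N = (fun x : R => `|x|%:E) @^-1` `]M, +oo[%classic).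
    rewrite -[X in measurable X]setTI.
    suff m : measurable_fun setT (fun x : R => `|x|%:E) by apply: m => //; exact: emeasurable_itv.
    by apply/measurable_EFinP; exact: normr_measurable.
  by apply/seteqP; split => x; rewrite /N /= in_itv /= ?andbT.
have mpsi : measurable_fun setT (fun x => (\1_N x)%:E : \bar R).
  by apply/measurable_EFinP; exact: measurable_indic.
have := law _ mpsi (fun x => _); rewrite (_ : \int[nu]_x _ = 0); last first.
  have mhN : measurable (h @^-1` N) by rewrite -[X in measurable X]setTI; exact: mh.
  transitivity (\int[nu]_x (\1_(h @^-1` N) x)%:E); first by apply: eq_integral.
  rewrite integral_indic ?setIT//; apply/negligibleP => //.
  apply: negligibleS (ess_sup_ge nu (abse \o (EFin \o h))) => x /= Nx.
  by rewrite -/M => /(lt_le_trans Nx); rewrite ltxx.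
have mfN : measurable (f @^-1` N) by rewrite -[X in measurable X]setTI; exact: mf.
move=> H; have {}H : mu (f @^-1` N) = 0.
  rewrite -H//.
  transitivity (\int[mu]_x (\1_(f @^-1` N) x)%:E); last by apply: eq_integral.
  by rewrite integral_indic// setIT.
exists (f @^-1` N); split => // x /= /negP; rewrite -ltNge.
by [].
Qed.

End moments.

(** * The process and its past *)

Section process.
Context (R : realType) dO (O : measurableType dO) (P : probability O R).
Context dE (E : measurableType dE) (dX : nat) d (T : measurableType d).
Hypotheses (finE : finite_set [set: E]) (discE : forall A : set E, measurable A).
Context (S : int -> {mfun O >-> T}) (g : {mfun T >-> rvec R dX})
  (Y : int -> {mfun O >-> E}).
Context (q : E -> (nat -> E) -> (nat -> rvec R dX) -> R)
        (D : set (pathType int (rvec R dX))).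
Context (P0 : R.-pker T ~> (pathType nat T)).

Definition resp (t : int) (o : O) : pathType nat E := past (fun s => Y s o) t.
Definition state_path (o : O) : pathType int T := fun t => S t o.
Definition state_past (o : O) : pathType nat T := past (fun s => S s o) 0.
Definition cov_path (o : O) : pathType int (rvec R dX) := fun t => g (S t o).

Hypothesis mD : measurable D.
Hypothesis PD : P [set o | D (cov_path o)] = 1%E.
Hypothesis mq : forall t : int, measurable_fun
     [set u : E * pathType nat E * pathType int (rvec R dX) | D u.2]
     (fun u => q u.1.1 u.1.2 (past u.2 t)).
Hypothesis q01 : forall w y z, histories D z -> 0 < q w y z < 1.
Hypothesis q1 : forall y z, histories D z -> \sum_(w \in [set: E]) q w y z = 1.
Hypothesis SM : markov_chain P (fun t => S t).
Hypothesis SP0 : cond_dist P <<s process_gen [set 0 : int] (fun t => S t) >>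
  (future (fun t => S t)) (fun o => P0 (S 0 o)).
Hypothesis Yq : forall (t : int) (w : E),
  cond_prob_is P
    <<s process_gen [set j | j <= t - 1] (fun t => Y t) `|`
        process_gen [set: int] (fun t => S t) >>
    (Y t @^-1` [set w])
    (fun o => q w (resp (t - 1) o) (past (cov_path o) t)).

Local Notation es := (symbols E).
Local Notation HX := (pathType nat E * pathType int (rvec R dX))%type.
Local Notation HS := (pathType nat E * pathType int T)%type.
Local Notation b := (coef_b q D).
Local Notation expect := (expect q D).

Let mS t : measurable_fun setT (S t) := measurable_funP (S t).
Let mY t : measurable_fun setT (Y t) := measurable_funP (Y t).

Lemma measurable_resp t : measurable_fun setT (resp t).
Proof. by apply: measurable_fun_path => i; exact: mY. Qed.

Lemma measurable_state_path : measurable_fun setT state_path.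
Proof. by apply: measurable_fun_path => i; exact: mS. Qed.

Lemma measurable_state_past : measurable_fun setT state_past.
Proof. by apply: measurable_fun_path => i; exact: mS. Qed.

Lemma measurable_cov_path : measurable_fun setT cov_path.
Proof. by apply: measurable_fun_path => i; exact: measurableT_comp. Qed.

Lemma measurable_future : measurable_fun setT (future (fun t => S t)).
Proof. by apply: measurable_fun_path => i; exact: mS. Qed.

Lemma D_nonempty : D !=set0.
Proof.
apply/set0P/negP => /eqP DE; move: PD; rewrite DE (_ : [set o | _] = set0)//.
by rewrite measure0 => /eqP; rewrite eq_sym onee_eq0.
Qed.

Lemma cov_path_ae : {ae P, forall o, D (cov_path o)}.
Proof.
exists (~` [set o | D (cov_path o)]).
have mC : measurable [set o | D (cov_path o)].
  by rewrite -[X in measurable X]setTI; exact: measurable_cov_path.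
split => //; first exact: measurableC.
by rewrite probability_setC// PD subee.
Qed.

Lemma resp_scons t o : resp (t + 1) o = scons (Y (t + 1) o) (resp t o).
Proof.
apply/funext => -[|i]; rewrite /resp /past /= ?subr0//.
by congr (Y _ o); lia.
Qed.

Lemma response_step t w (psi : HS -> \bar R) :
  measurable_fun setT psi -> (forall u, 0 <= psi u)%E ->
  (\int[P]_o ((Y (t + 1)%R o == w)%:R%:E * psi (resp t o, state_path o)) =
   \int[P]_o ((qD q D (t + 1)%R w (resp t o, cov_path o))%:E *
               psi (resp t o, state_path o)))%E.
Proof.
move=> mpsi psi0.
pose Z o : HS := (resp t o, state_path o).
have mZ : measurable_fun setT Z.
  by apply: measurable_fun_pair; [exact: measurable_resp|exact: measurable_state_path].
pose G := process_gen [set j | j <= t + 1 - 1] (fun t => Y t) `|`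
        process_gen [set: int] (fun t => S t).
have mG : <<s G >> `<=` @measurable _ O.
  apply: smallest_sub; first exact: sigma_algebra_measurable.
  by move=> _ [|] [i _ [A mA <-]]; [exact: mY|exact: mS].
have GZ A : measurable A -> <<s G >> (Z @^-1` A).
  have mZG : @measurable_fun _ _ (g_sigma_algebraType G) HS setT Z.
    apply: measurable_fun_pair; apply: measurable_fun_path => i _ B mB;
      rewrite setTI; apply: sub_sigma_algebra; [left|right].
      exists (t - i%:Z); first by rewrite /= addrK lerBlDr lerDl.
      by exists B => //; rewrite setTI.
    by exists i => //; exists B => //; rewrite setTI.
  by move=> mA; have := mZG measurableT A mA; rewrite setTI.
have mqD : measurable_fun setT (fun o => qD q D (t + 1) w (resp t o, cov_path o)).
  apply: (measurableT_comp (measurable_qD mD mq (t + 1) w)).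
  by apply: measurable_fun_pair; [exact: measurable_resp|exact: measurable_cov_path].
have Yq' : cond_prob_is P <<s G >> (Y (t + 1) @^-1` [set w])
    (fun o => qD q D (t + 1) w (resp t o, cov_path o)).
  have [h hv [N [mN N0 hN]]] := Yq (t + 1) w; exists h => //.
  have [N' [mN' N'0 hN']] := cov_path_ae.
  exists (N `|` N'); split; [exact: measurableU|by rewrite measureU0|].
  move=> o /= H.
  have [Do|nDo] := pselect (D (cov_path o)); last by right; exact: hN'.
  left; apply: hN => /= ho; apply: H.
  by rewrite ho qDE// addrK.
have mYw : measurable (Y (t + 1) @^-1` [set w]).
  by rewrite -[X in measurable X]setTI; exact: mY.
transitivity (\int[P]_o (((Y (t + 1)%R o == w)%:R : R)%:E * \int[dirac (Z o)]_u psi u))%E.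
  by apply: eq_integral => o _; rewrite integral_dirac// diracT mul1e.
transitivity (\int[P]_o ((qD q D (t + 1)%R w (resp t o, cov_path o))%:E *
                          \int[dirac (Z o)]_u psi u))%E; last first.
  by apply: eq_integral => o _; rewrite integral_dirac// diracT mul1e.
have YE : (fun o => (Y (t + 1) o == w)%:R : R) = \1_(Y (t + 1) @^-1` [set w]).
  apply/funext => o; rewrite indicE; congr (_%:R); congr nat_of_bool.
  by apply/eqP/idP => [?|/set_mem//]; exact/mem_set.
apply: bind_eq_integral => //.
- by move=> o; exact: (qD_ge0 q01).
- by rewrite YE.
- by move=> A mA; exact: measurable_dirac_comp.
- by move=> A mA; exact: measurable_dirac_comp.
move=> A mA.
have dE' (h : O -> R) : (\int[P]_o ((h o)%:E * \d_(Z o) A) =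
    \int[P]_(o in Z @^-1` A) (h o)%:E)%E.
  rewrite [RHS]integral_mkcond; apply: eq_integral => o _.
  rewrite patchE diracE (_ : (o \in Z @^-1` A) = (Z o \in A))//.
  by case: (_ \in A); rewrite ?mule1 ?mule0.
rewrite !dE' (cond_prob_is_integral mG mqD Yq' (GZ A mA)).
under eq_integral => o _ do rewrite (congr1 (fun f => f o) YE).
have mZA := mG _ (GZ A mA).
rewrite integral_indic; [by congr (P _); exact: setIC|exact: mZA|exact: mYw].
Qed.

(** Tower property: the responses after time [t] are integrated out one by one
    through their conditional laws given the earlier responses and all the
    states. *)
Lemma response_expect t M (psi : HS -> \bar R) (Phi : HX -> R) :
  measurable_fun setT psi -> (forall u, 0 <= psi u)%E ->
  measurable_fun setT Phi -> (forall u, 0 <= Phi u) ->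
  (\int[P]_o (psi (resp t o, state_path o) *
              (Phi (resp (t + M%:Z)%R o, cov_path o))%:E) =
   \int[P]_o (psi (resp t o, state_path o) *
              (expect t M Phi (resp t o, cov_path o))%:E))%E.
Proof.
move=> + + mPhi Phi0; elim: M t psi => [|M IH] t psi mpsi psi0.
  by apply: eq_integral => o _; rewrite addr0.
have mrest : measurable_fun setT (fun u : HS => (fun i => u.1 i.+1 : E) : pathType nat E).
  apply: measurable_fun_path => i.
  exact: (measurableT_comp (measurable_coord i.+1) measurable_fst).
transitivity (\int[P]_o (psi (resp t o, state_path o) *
    (expect (t + 1)%R M Phi (resp (t + 1)%R o, cov_path o))%:E))%E.
  pose psi' (u : HS) := psi (fun i => u.1 i.+1, u.2).
  have psi'E o : psi' (resp (t + 1) o, state_path o) = psi (resp t o, state_path o).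
    by rewrite /psi' resp_scons.
  under eq_integral do rewrite -psi'E intS addrA.
  have mpsi' : measurable_fun setT psi'.
    by apply: (measurableT_comp mpsi); exact: measurable_fun_pair.
  have psi'0 u : (0 <= psi' u)%E by exact: psi0.
  rewrite (IH _ _ mpsi' psi'0).
  by apply: eq_integral => o _; rewrite psi'E.
have mcov : measurable_fun setT (fun x : pathType int T =>
    (fun i => g (x i)) : pathType int (rvec R dX)).
  apply: measurable_fun_path => i.
  exact: (measurableT_comp (measurable_funP g) (measurable_coord i)).
pose psiw w (u : HS) : \bar R := (psi u *
  (expect (t + 1)%R M Phi (scons w u.1, fun i => g (u.2 i)))%:E)%E.
have psiw0 w u : (0 <= psiw w u)%E.
  by rewrite /psiw mule_ge0// lee_fin (expect_ge0 q01).
have mpsiw w : measurable_fun setT (psiw w).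
  apply: emeasurable_funM => //; apply/measurable_EFinP.
  apply: (measurableT_comp (measurable_expect mD mq (t + 1) M mPhi)).
  apply: measurable_fun_pair; first exact: (measurableT_comp (measurable_scons w) measurable_fst).
  exact: (measurableT_comp mcov measurable_snd).
have mZ : measurable_fun setT (fun o => (resp t o, state_path o) : HS).
  by apply: measurable_fun_pair; [exact: measurable_resp|exact: measurable_state_path].
have mind w : measurable_fun setT (fun o => ((Y (t + 1) o == w)%:R : R)).
  rewrite (_ : (fun o => _) = \1_(Y (t + 1) @^-1` [set w])).
    by apply: measurable_indic; rewrite -[X in measurable X]setTI; exact: mY.
  apply/funext => o; rewrite indicE; congr (_%:R); congr nat_of_bool.
  by apply/eqP/idP => [?|/set_mem//]; exact/mem_set.
transitivity (\sum_(w <- es) \int[P]_o (((Y (t + 1)%R o == w)%:R)%:E *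
    psiw w (resp t o, state_path o)))%E.
  rewrite -ge0_integral_sum//; last 2 first.
  - move=> w; apply: emeasurable_funM; first exact/measurable_EFinP.
    exact: (measurableT_comp (mpsiw w) mZ).
  - by move=> w o _; rewrite mule_ge0// lee_fin.
  apply: eq_integral => o _; rewrite resp_scons.
  rewrite /psiw /=.
  rewrite -(sum_symbols1 finE (fun w => expect (t + 1) M Phi (scons w (resp t o), cov_path o))).
  rewrite -sumEFin ge0_sume_distrr; last first.
    by move=> w _; rewrite lee_fin mulr_ge0// (expect_ge0 q01).
  by apply: eq_bigr => w _; rewrite EFinM muleCA.
transitivity (\sum_(w <- es) \int[P]_o ((qD q D (t + 1)%R w (resp t o, cov_path o))%:E *
    psiw w (resp t o, state_path o)))%E.
  by apply: eq_bigr => w _; exact: response_step.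
rewrite -ge0_integral_sum//; last 2 first.
- move=> w; apply: emeasurable_funM; last exact: (measurableT_comp (mpsiw w) mZ).
  apply/measurable_EFinP; apply: (measurableT_comp (measurable_qD mD mq (t + 1) w)).
  by apply: measurable_fun_pair; [exact: measurable_resp|exact: measurable_cov_path].
- by move=> w o _; rewrite mule_ge0// lee_fin (qD_ge0 q01).
apply: eq_integral => o _; rewrite expectS -sumEFin ge0_sume_distrr; last first.
  by move=> w _; rewrite lee_fin mulr_ge0// ?(qD_ge0 q01)// (expect_ge0 q01).
by apply: eq_bigr => w _; rewrite /psiw /= EFinM muleCA.
Qed.

(** [h] lists the states at times 0, -1, ... and [s] those at times 1, 2, ... *)
Definition glue (h s : pathType nat T) : pathType int (rvec R dX) :=
  fun t => if t is Posz k.+1 then g (s k) else g (h `|t|%N).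

Lemma glue_past h s i : glue h s (0 - i%:Z) = g (h i).
Proof. by case: i => [|i]; [rewrite subr0|rewrite sub0r -NegzE]. Qed.

Lemma past_glue h s : past (glue h s) 0 = fun i => g (h i).
Proof. by apply/funext => i; rewrite /past glue_past. Qed.

Lemma glue_cov_path o : glue (state_past o) (future (fun t => S t) o) = cov_path o.
Proof.
apply/funext => -[[|k]|n]; rewrite /glue /cov_path /state_past /past /future//=.
by rewrite sub0r -NegzE.
Qed.

Lemma measurable_glue :
  measurable_fun setT (fun u : pathType nat T * pathType nat T => glue u.1 u.2).
Proof.
apply: measurable_fun_path => -[[|k]|n] /=;
  apply: (measurableT_comp (measurable_funP g)).
- exact: (measurableT_comp (measurable_coord 0%N) measurable_fst).
- exact: (measurableT_comp (measurable_coord k) measurable_snd).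
- exact: (measurableT_comp (measurable_coord _) measurable_fst).
Qed.

Lemma measurable_glue_comp d' (U : measurableType d') (h s : U -> pathType nat T) :
  measurable_fun setT h -> measurable_fun setT s ->
  measurable_fun setT (fun u => glue (h u) (s u)).
Proof.
move=> mh ms; rewrite (_ : (fun u => _) = (fun u => glue u.1 u.2) \o
  (fun u => (h u, s u)))//.
by apply: (measurableT_comp measurable_glue); exact: measurable_fun_pair.
Qed.

Lemma measurable_P0S A : measurable A ->
  measurable_fun setT (fun o => P0 (S 0 o) A).
Proof. by move=> mA; exact: measurable_pker_comp. Qed.

Lemma state_law_integral (f : pathType nat T * pathType nat T -> \bar R) :
  measurable_fun setT f -> (forall u, 0 <= f u)%E ->
  (\int[P]_o f (state_past o, future (fun t => S t) o) =
   \int[P]_o \int[P0 (S 0%R o)]_s f (state_past o, s))%E.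
Proof.
have EH : @measurable _ (pathType nat T) = <<s @measurable _ (pathType nat T) >>.
  by rewrite sigma_algebra_id//; exact: sigma_algebra_measurable.
apply: (joint_law_integral measurable_state_past measurable_future measurable_P0S
  (fun o => prob_kernel (S 0 o)) EH (@nat_cylindersE _ T) (@measurableI _ _)
  (@nat_cylindersI _ T) measurableT (@nat_cylindersT _ T)).
move=> A _ mA [m [C [mC ->]]].
apply: (markov_future SM SP0) => //.
have mG : @measurable_fun _ _ (g_sigma_algebraType
    (process_gen [set j : int | j <= 0] (fun t => S t))) (pathType nat T) setT state_past.
  apply: measurable_fun_path => i _ B mB; rewrite setTI.
  apply: (process_gen_preimage (i := (0 : int) - i%:Z)) => //.
  by rewrite /mkset lerBlDr add0r.
by have := mG measurableT A mA; rewrite setTI.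
Qed.

(** The paths that a kernel builds from the current state lie almost surely in
    [D], since gluing the true future gives the covariate path. *)
Lemma glue_ae : {ae P, forall o, {ae P0 (S 0 o), forall s, D (glue (state_past o) s)}}.
Proof.
pose N := [set u : pathType nat T * pathType nat T | ~ D (glue u.1 u.2)].
have mN : measurable N.
  have := measurable_glue measurableT (measurableC mD); rewrite setTI; exact.
have E0 : (\int[P]_o \int[P0 (S 0%R o)]_s (\1_N (state_past o, s))%:E = 0)%E.
  have mi : measurable_fun setT (fun u => (\1_N u)%:E : \bar R).
    exact/measurable_EFinP/measurable_indic.
  rewrite -(state_law_integral mi); last by move=> u; rewrite lee_fin.
  have [N' [mN' N'0 hN']] := cov_path_ae.
  have mii : measurable_fun setT
      (fun o => (\1_N (state_past o, future (fun t => S t) o))%:E : \bar R).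
    apply: (measurableT_comp mi).
    by apply: measurable_fun_pair; [exact: measurable_state_past|exact: measurable_future].
  rewrite (ge0_negligible_integral mN' measurableT mii _ N'0)//.
  rewrite integral0_eq// => o [_ N'o]; rewrite indicE memNset//=.
  by rewrite /N /= glue_cov_path => nD; apply: N'o; exact: hN'.
have mNo o : measurable [set s | N (state_past o, s)].
  by rewrite -[X in measurable X]/(_ @^-1` _) -xsectionE; exact: measurable_xsection.
have IE o : (\int[P0 (S 0%R o)]_s (\1_N (state_past o, s))%:E =
    P0 (S 0%R o) [set s | N (state_past o, s)])%E.
  transitivity (\int[P0 (S 0%R o)]_s (\1_[set s | N (state_past o, s)] s)%:E)%E; last first.
    by rewrite integral_indic// setIT.
  by apply: eq_integral.
have mI : measurable_fun setT (fun o =>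
    \int[P0 (S 0%R o)]_s (\1_N (state_past o, s))%:E)%E.
  pose N2 := [set u : O * pathType nat T | N (state_past u.1, u.2)].
  have mN2 : measurable N2.
    have mm : measurable_fun setT (fun u : O * pathType nat T => (state_past u.1, u.2)).
      by apply: measurable_fun_pair => //; apply: measurableT_comp => //; exact: measurable_state_past.
    by have := mm measurableT N mN; rewrite setTI.
  rewrite (_ : (fun o => _) = fun o => P0 (S 0%R o) (xsection N2 o)).
    apply: measurable_fun_family_xsection => //; first exact: measurable_P0S.
    by move=> o; exact: prob_kernel.
  by apply/funext => o; rewrite IE xsectionE.
have [N' [mN' N'0 hN']] : ae_eq P setT (fun o =>
    \int[P0 (S 0%R o)]_s (\1_N (state_past o, s))%:E)%E (cst 0%E).
  apply/(ae_eq_integral_abs P measurableT mI); rewrite -[RHS]E0.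
  by apply: eq_integral => o _; rewrite gee0_abs// integral_ge0// => s _; rewrite lee_fin.
exists N'; split => // o /= H; apply: hN' => /= HH; apply: H.
exists [set s | N (state_past o, s)]; split => //.
by rewrite -IE; exact: HH.
Qed.

Hypothesis b0_lt1 : b 0%N < 1.
Hypothesis b_sum : (\sum_(0 <= m <oo) (b m)%:E < +oo)%E.

(** Memory loss: two response chains driven by the same covariates from time
    [- M] on disagree somewhere among the last [m] times with probability at
    most [m] times a return probability of the renewal chain, taken at a time
    that grows with [M]. *)
Lemma remote_past (m : nat) (A : nat -> set E) (eps : R) : 0 < eps ->
  exists M : nat, forall y y' x, D x ->
  let Phi (u : HX) : R := \1_[set z : pathType nat E | forall i, (i < m)%N -> A i (z i)] u.1 in
  `|expect (- M%:Z) M Phi (y, x) - expect (- M%:Z) M Phi (y', x)| <= eps.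
Proof.
move=> eps0.
have b01 := coef_b01 finE D_nonempty q01 q1.
have b_dec := coef_b_dec finE D_nonempty q01 q1.
have [C HC] := ret_cvg0 b01 b_dec b0_lt1 b_sum.
pose K := (Num.truncn (m%:R * C / eps)).+1.
have K0 : (0 : R) < K%:R by rewrite ltr0n.
have mret : m%:R * ret b K 0 <= eps.
  rewrite -(ler_pM2l K0) mulrCA.
  have h1 := ler_wpM2l (ler0n R m) (HC K).
  apply: le_trans h1 _; rewrite -ler_pdivrMr// ltW//; exact: truncnS_gt.
exists (m + K)%N; move=> y y' x Dx; set Phi := fun u : HX => _.
set M := (m + K)%N.
have := @expect_coupling R dE E dX finE q D D_nonempty q01 q1 nat (iota 0 m)
  (fun i => (M - i)%N) 0 (fun=> 0) Phi (- M%:Z) M y y' x x Dx Dx.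
rewrite addr0 => H; apply: (le_trans (H _ _ _ _)).
- by [].
- move=> l z; rewrite dTV_symbols// big1 ?mulr0// => w _.
  by rewrite subrr normr0.
- move=> i; rewrite mem_iota add0n leq_subr andbT /= subn_gt0 => im.
  by rewrite /M ltn_addr.
- move=> z z'; rewrite addr0.
  have [zz'|/existsNP[i /not_implyP[im zi]]] :=
      pselect (forall i, (i < m)%N -> z i = z' i).
    rewrite (_ : Phi (z, x) = Phi (z', x)) ?subrr ?normr0 ?sumr_ge0//.
    rewrite /Phi !indicE /=; congr (_%:R); congr nat_of_bool.
    by apply/idP/idP => /set_mem Az; apply/mem_set => i im; have := Az i im;
      rewrite zz'.
  rewrite (bigD1_seq i) ?mem_iota ?iota_uniq//=.
  rewrite subKn; last by rewrite (leq_trans (ltnW im))// leq_addr.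
  move/eqP: zi => -> /=; apply: (@le_trans _ _ 1); last first.
    by rewrite lerDl sumr_ge0.
  rewrite /Phi !indicE; case: (_ \in _); case: (_ \in _);
    by rewrite ?subrr ?subr0 ?sub0r ?normrN ?normr1 ?normr0 ?ler01.
apply: le_trans mret.
rewrite mulr_natl -[m in leRHS]subn0 -sumr_const_nat /index_iota subn0.
rewrite [leRHS]big_seq big_seq; apply: ler_sum => i.
rewrite mem_iota add0n => /= im.
rewrite /mismatch subn0 big1 ?addr0; last by move=> l _; rewrite mul0r.
suff : ret b (M - i) 0 <= ret b K 0 by [].
by apply: (ret_anti b01 b_dec); rewrite /M -addnBAC ?leq_addl// ltnW.
Qed.

Lemma le_integral_shift (psi F G : O -> R) (eps : R) : 0 <= eps ->
  measurable_fun setT psi -> measurable_fun setT F -> measurable_fun setT G ->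
  (forall o, 0 <= psi o <= 1) -> (forall o, 0 <= F o) -> (forall o, 0 <= G o) ->
  {ae P, forall o, F o <= G o + eps} ->
  (\int[P]_o (psi o * F o)%:E <= \int[P]_o (psi o * G o)%:E + eps%:E)%E.
Proof.
move=> eps0 mpsi mF mG psi01 F0 G0 FG.
have psi0 o : 0 <= psi o by have /andP[] := psi01 o.
apply: (@le_trans _ _ (\int[P]_o ((psi o * G o)%:E + eps%:E))%E).
  apply: ae_ge0_le_integral => //.
  - by move=> o _; rewrite lee_fin mulr_ge0.
  - exact/measurable_EFinP/measurable_funM.
  - by move=> o _; rewrite -EFinD lee_fin addr_ge0 ?mulr_ge0.
  - by apply: emeasurable_funD => //; exact/measurable_EFinP/measurable_funM.
  apply: filterS FG => o FGo _; rewrite -EFinD lee_fin.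
  by have /andP[? ?] := psi01 o; nra.
rewrite ge0_integralD//.
- rewrite leeD2l// integral_cst//.
  by rewrite [X in (_ * X <= _)%E]probability_setT mule1.
- by move=> o _; rewrite lee_fin mulr_ge0.
- exact/measurable_EFinP/measurable_funM.
Qed.

Lemma measurable_integral_P0S (f : pathType nat T * pathType nat T -> \bar R) :
  measurable_fun setT f -> (forall u, 0 <= f u)%E ->
  measurable_fun setT (fun o => \int[P0 (S 0%R o)]_s f (state_past o, s))%E.
Proof.
move=> mf f0.
have mp o : measurable_fun setT (fun s : pathType nat T => (state_past o, s)).
  by apply: measurable_fun_pair; [exact: measurable_cst|exact: measurable_id].
rewrite (_ : (fun o => _) = fun o => \int[pushm (P0 (S 0%R o)) (mp o)]_u f u)%E; last first.
  by apply/funext => o; rewrite integral_pushm.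
apply: measurable_fun_ge0_integral => // A mA.
pose A2 := [set u : O * pathType nat T | A (state_past u.1, u.2)].
have mA2 : measurable A2.
  have mm : measurable_fun setT (fun u : O * pathType nat T => (state_past u.1, u.2)).
    by apply: measurable_fun_pair => //; apply: measurableT_comp => //; exact: measurable_state_past.
  by have := mm measurableT A mA; rewrite setTI.
rewrite (_ : (fun o => _) = fun o => P0 (S 0%R o) (xsection A2 o)).
  apply: measurable_fun_family_xsection => //; first exact: measurable_P0S.
  by move=> o; exact: prob_kernel.
by apply/funext => o; rewrite xsectionE.
Qed.

(** Given the states up to time 0, the responses up to time 0 are independent
    of the future states: by [remote_past] their conditional law given all the
    states is a limit of functions of the covariates up to time 0. *)
Lemma history_law_rect A1 A2 C : @nat_cylinders _ E A1 ->
  measurable (A2 : set (pathType nat T)) -> @nat_cylinders _ T C ->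
  (P ((fun o => (resp 0 o, state_past o)) @^-1` (A1 `*` A2) `&`
      future (fun t => S t) @^-1` C) =
   \int[P]_(o in (fun o => (resp 0%R o, state_past o)) @^-1` (A1 `*` A2))
      P0 (S 0%R o) C)%E.
Proof.
move=> CA1 mA2 CC.
have mA1 : measurable A1 by rewrite nat_cylindersE; exact: sub_sigma_algebra.
have mC : measurable C by rewrite nat_cylindersE; exact: sub_sigma_algebra.
have [m [A [mA A1E]]] := CA1.
pose Phi (u : HX) : R := \1_A1 u.1.
have mPhi : measurable_fun setT Phi.
  exact: (measurableT_comp (measurable_indic mA1) measurable_fst).
have Phi0 u : 0 <= Phi u by [].
pose k (o : O) : R := fine (P0 (S 0 o) C).
have kE o : (k o)%:E = P0 (S 0 o) C by rewrite fineK// pker_fin_num.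
have k01 o : 0 <= k o <= 1.
  rewrite -!lee_fin kE measure_ge0/= -(prob_kernel (s := P0) (S 0 o)).
  by apply: le_measure => //; exact: mem_set.
have mk : measurable_fun setT k.
  by apply: measurableT_comp => //; exact: measurable_P0S.
pose psi1 (o : O) : R := \1_A2 (state_past o) * \1_C (future (fun t => S t) o).
pose psi2 (o : O) : R := \1_A2 (state_past o) * k o.
have i01 (U : Type) (B : set U) u : 0 <= (\1_B u : R) <= 1.
  by rewrite indicE; case: (_ \in _); rewrite ?lexx ?ler01.
have psi01 o : 0 <= psi1 o <= 1.
  have := i01 _ A2 (state_past o); have := i01 _ C (future (fun t => S t) o).
  by rewrite /psi1 => /andP[? ?] /andP[? ?]; apply/andP; split; nra.
have psi02 o : 0 <= psi2 o <= 1.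
  have := i01 _ A2 (state_past o); have := k01 o.
  by rewrite /psi2 => /andP[? ?] /andP[? ?]; apply/andP; split; nra.
have mA2s : measurable_fun setT (fun o => \1_A2 (state_past o) : R).
  exact: (measurableT_comp (measurable_indic mA2) measurable_state_past).
have mCs : measurable_fun setT (fun o => \1_C (future (fun t => S t) o) : R).
  exact: (measurableT_comp (measurable_indic mC) measurable_future).
have mpsi1 : measurable_fun setT psi1 by exact: measurable_funM.
have mpsi2 : measurable_fun setT psi2 by exact: measurable_funM.
pose Phir o := Phi (resp 0 o, cov_path o).
have mPhir : measurable_fun setT Phir.
  apply: (measurableT_comp mPhi).
  by apply: measurable_fun_pair; [exact: measurable_resp|exact: measurable_cov_path].
have lhsE : P ((fun o => (resp 0 o, state_past o)) @^-1` (A1 `*` A2) `&`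
      future (fun t => S t) @^-1` C) = (\int[P]_o (psi1 o * Phir o)%:E)%E.
  transitivity (\int[P]_o (\1_((fun o => (resp 0%R o, state_past o)) @^-1` (A1 `*` A2) `&`
      future (fun t => S t) @^-1` C) o)%:E)%E.
    rewrite integral_indic ?setIT//; apply: measurableI.
      have mp : measurable_fun setT (fun o => (resp 0 o, state_past o)).
        by apply: measurable_fun_pair; [exact: measurable_resp|exact: measurable_state_past].
      by rewrite -[X in measurable X]setTI; apply: mp => //; exact: measurableX.
    by rewrite -[X in measurable X]setTI; exact: measurable_future.
  apply: eq_integral => o _; congr EFin.
  rewrite /psi1 /Phir /Phi !indicE -!natrM !mulnb; congr (_%:R); congr nat_of_bool.
  apply/idP/idP => [/set_mem[[? ?] ?]|/andP[/andP[/set_mem ? /set_mem ?] /set_mem ?]].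
    by rewrite !mem_set.
  by apply/mem_set.
have rhsE : (\int[P]_(o in (fun o => (resp 0%R o, state_past o)) @^-1` (A1 `*` A2))
      P0 (S 0%R o) C)%E = (\int[P]_o (psi2 o * Phir o)%:E)%E.
  rewrite integral_mkcond; apply: eq_integral => o _.
  rewrite patchE /psi2 /Phir /Phi -kE !indicE.
  rewrite (_ : (o \in _) = (state_past o \in A2) && (resp 0 o \in A1)).
    by case: (_ \in A2); case: (_ \in A1); rewrite /= ?mul1r ?mulr1 ?mul0r ?mulr0.
  apply/idP/andP => [/set_mem[? ?]|[/set_mem ? /set_mem ?]].
    by rewrite !mem_set.
  by apply/mem_set.
rewrite lhsE rhsE {lhsE rhsE}.
pose y0 : nat -> E := fun=> point.
pose F M o := expect (- M%:Z) M Phi (resp (- M%:Z) o, cov_path o).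
pose G M o := expect (- M%:Z) M Phi (y0, cov_path o).
have F0 M o : 0 <= F M o by exact: (expect_ge0 q01).
have G0 M o : 0 <= G M o by exact: (expect_ge0 q01).
have mF M : measurable_fun setT (F M).
  apply: (measurableT_comp (measurable_expect mD mq _ _ mPhi)).
  by apply: measurable_fun_pair; [exact: measurable_resp|exact: measurable_cov_path].
have mGx M : measurable_fun setT (fun x : pathType int (rvec R dX) =>
    expect (- M%:Z) M Phi (y0, x)).
  apply: (measurableT_comp (measurable_expect mD mq _ _ mPhi)).
  by apply: measurable_fun_pair; [exact: measurable_cst|exact: measurable_id].
have mG M : measurable_fun setT (G M).
  exact: (measurableT_comp (mGx M) measurable_cov_path).
have tower (f : pathType int T -> \bar R) M : measurable_fun setT f ->
    (forall x, 0 <= f x)%E ->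
    (\int[P]_o (f (state_path o) * (Phir o)%:E) =
     \int[P]_o (f (state_path o) * (F M o)%:E))%E.
  move=> mf f0.
  have := @response_expect (- M%:Z) M (fun u => f u.2) Phi
    (measurableT_comp mf measurable_snd) (fun u => f0 u.2) mPhi Phi0.
  by rewrite /= addNr.
have tower1 M : (\int[P]_o (psi1 o * Phir o)%:E = \int[P]_o (psi1 o * F M o)%:E)%E.
  pose f (x : pathType int T) : \bar R :=
    ((\1_A2 ((fun i => x (0 - i%:Z)) : pathType nat T) *
      \1_C ((fun i => x i.+1%:Z) : pathType nat T) : R)%:E)%E.
  have := @tower f M; rewrite /f; apply.
    apply/measurable_EFinP; apply: measurable_funM.
      apply: (measurableT_comp (measurable_indic mA2)).
      by apply: measurable_fun_path => i; exact: measurable_coord.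
    apply: (measurableT_comp (measurable_indic mC)).
    by apply: measurable_fun_path => i; exact: measurable_coord.
  by move=> x; rewrite lee_fin mulr_ge0.
have tower2 M : (\int[P]_o (psi2 o * Phir o)%:E = \int[P]_o (psi2 o * F M o)%:E)%E.
  pose f (x : pathType int T) : \bar R :=
    ((\1_A2 ((fun i => x (0 - i%:Z)) : pathType nat T) * fine (P0 (x 0) C) : R)%:E)%E.
  have := @tower f M; rewrite /f; apply.
    apply/measurable_EFinP; apply: measurable_funM.
      apply: (measurableT_comp (measurable_indic mA2)).
      by apply: measurable_fun_path => i; exact: measurable_coord.
    apply: measurableT_comp => //.
    exact: (measurableT_comp (measurable_kernel P0 C mC) (measurable_coord 0)).
  by move=> x; rewrite lee_fin mulr_ge0// fine_ge0.
have same M : (\int[P]_o (psi1 o * G M o)%:E = \int[P]_o (psi2 o * G M o)%:E)%E.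
  pose f (u : pathType nat T * pathType nat T) : \bar R :=
    ((\1_A2 u.1 * \1_C u.2 * expect (- M%:Z) M Phi (y0, glue u.1 u.2) : R)%:E)%E.
  have mf : measurable_fun setT f.
    apply/measurable_EFinP; apply: measurable_funM.
      apply: measurable_funM.
        exact: (measurableT_comp (measurable_indic mA2) measurable_fst).
      exact: (measurableT_comp (measurable_indic mC) measurable_snd).
    exact: (measurableT_comp (mGx M) measurable_glue).
  have f0 u : (0 <= f u)%E.
    by rewrite lee_fin !mulr_ge0// (expect_ge0 q01).
  transitivity (\int[P]_o f (state_past o, future (fun t => S t) o))%E.
    by apply: eq_integral => o _; rewrite /f /= glue_cov_path.
  rewrite state_law_integral//; apply: ae_eq_integral => //.
  - exact: measurable_integral_P0S.
  - by apply/measurable_EFinP; exact: measurable_funM.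
  have HD := cov_path_ae; have HG := glue_ae.
  apply: filterS2 HD HG => o Do Ds _.
  have mfo : measurable_fun setT (fun s => f (state_past o, s)).
    by apply: (measurableT_comp mf); apply: measurable_fun_pair;
      [exact: measurable_cst|exact: measurable_id].
  transitivity (\int[P0 (S 0%R o)]_s ((\1_A2 (state_past o) * G M o)%:E * (\1_C s)%:E))%E.
    apply: ae_eq_integral => //.
      by apply: emeasurable_funM => //; exact/measurable_EFinP/measurable_indic.
    apply: filterS Ds => s Ds _; rewrite /f /= -EFinM mulrAC /G; congr (_ * _ * _)%:E.
    apply: expect_past => //.
    by rewrite addNr -glue_cov_path !past_glue.
  rewrite ge0_integralZl_EFin//.
  - rewrite integral_indic// setIT -kE -EFinM; congr EFin; rewrite /psi2; ring.
  - exact/measurable_EFinP/measurable_indic.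
  - by rewrite mulr_ge0.
have close M eps : (forall y y' x, D x ->
    `|expect (- M%:Z) M Phi (y, x) - expect (- M%:Z) M Phi (y', x)| <= eps) ->
    {ae P, forall o, F M o <= G M o + eps} /\ {ae P, forall o, G M o <= F M o + eps}.
  by move=> H; split; apply: filterS cov_path_ae => o Do;
    [have := H (resp (- M%:Z) o) y0 _ Do|have := H y0 (resp (- M%:Z) o) _ Do];
    rewrite ler_norml => /andP[_]; rewrite lerBlDl.
have main (psi psi' : O -> R) : measurable_fun setT psi -> measurable_fun setT psi' ->
    (forall o, 0 <= psi o <= 1) -> (forall o, 0 <= psi' o <= 1) ->
    (forall M, \int[P]_o (psi o * Phir o)%:E = \int[P]_o (psi o * F M o)%:E)%E ->
    (forall M, \int[P]_o (psi' o * Phir o)%:E = \int[P]_o (psi' o * F M o)%:E)%E ->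
    (forall M, \int[P]_o (psi o * G M o)%:E = \int[P]_o (psi' o * G M o)%:E)%E ->
    (\int[P]_o (psi o * Phir o)%:E <= \int[P]_o (psi' o * Phir o)%:E)%E.
  move=> mpsi mpsi' p01 p01' t1 t2 tG; apply/lee_addgt0Pr => eps eps0.
  have eps2 : 0 < eps / 2 by rewrite divr_gt0.
  have [M HM] := remote_past m A eps2.
  have [|c1 c2] := close M (eps / 2).
    by move=> y y' x Dx; have := HM y y' x Dx; rewrite /Phi A1E.
  rewrite (t1 M) (t2 M) [eps in (_ + eps%:E)%E]splitr EFinD addeA.
  apply: (le_trans (le_integral_shift (ltW eps2) mpsi (mF M) (mG M) p01 (F0 M) (G0 M) c1)).
  rewrite tG leeD2r//.
  exact: (le_integral_shift (ltW eps2) mpsi' (mG M) (mF M) p01' (G0 M) (F0 M) c2).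
by apply/eqP; rewrite eq_le !main.
Qed.

(** The future states interact with the history, responses included, through
    the current state only, so integrating them under [P0 (S 0)] restores the
    joint law. *)
Lemma history_law_integral
    (f : (pathType nat E * pathType nat T) * pathType nat T -> \bar R) :
  measurable_fun setT f -> (forall u, 0 <= f u)%E ->
  (\int[P]_o f ((resp 0%R o, state_past o), future (fun t => S t) o) =
   \int[P]_o \int[P0 (S 0%R o)]_s f ((resp 0%R o, state_past o), s))%E.
Proof.
have ET : @measurable _ (pathType nat T) = <<s @measurable _ (pathType nat T) >>.
  by rewrite sigma_algebra_id//; exact: sigma_algebra_measurable.
have EH := prod_pi_systemE (@nat_cylindersE _ E) ET (@nat_cylindersT _ E) measurableT.
have TH : [set A `*` B | A in @nat_cylinders _ E & B in @measurable _ (pathType nat T)]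
    setT.
  by exists setT; [exact: nat_cylindersT|exists setT => //; rewrite setXTT].
have mp : measurable_fun setT (fun o => (resp 0 o, state_past o)).
  by apply: measurable_fun_pair; [exact: measurable_resp|exact: measurable_state_past].
apply: (joint_law_integral mp measurable_future measurable_P0S
  (fun o => prob_kernel (S 0 o)) EH (@nat_cylindersE _ T)
  (prod_pi_systemI (@nat_cylindersI _ E) (@measurableI _ _))
  (@nat_cylindersI _ T) TH (@nat_cylindersT _ T)).
by move=> _ C [A1 CA1 [A2 mA2 <-]] CC; exact: history_law_rect.
Qed.

(** * The coupled futures *)

Context (Pt : R.-pker (T * T) ~> (pathType nat T * pathType nat T)%type).
Hypothesis PtP0 : coupling_kernel P0 Pt.

Local Notation F := (pathType nat T).
Local Notation OF := ((O * O) * (F * F))%type.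

Definition coupled_states (o : O * O) : {measure set (F * F) -> \bar R} :=
  Pt (S 0 o.1, S 0 o.2).

Lemma measurable_coupled_states A : measurable A ->
  measurable_fun setT (fun o => coupled_states o A).
Proof.
move=> mA; apply: (measurableT_comp (measurable_kernel Pt A mA)).
by apply: measurable_fun_pair; exact: measurableT_comp.
Qed.

Lemma coupled_states1 o : coupled_states o setT = 1%E.
Proof. exact: prob_kernel. Qed.

Lemma measurable_cstP A : measurable A ->
  measurable_fun setT (fun _ : O => (P : {measure set O -> \bar R}) A).
Proof. by move=> _; exact: measurable_cst. Qed.

Lemma cstP1 (o : O) : (P : {measure set O -> \bar R}) setT = 1%E.
Proof. exact: probability_setT. Qed.

(** Two independent copies of the whole space up to time 0, followed by the
    coupling of the futures of their states. *)
Definition coupled : probability OF R :=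
  semidirect (semidirect P measurable_cstP cstP1)
    measurable_coupled_states coupled_states1.

Lemma integral_coupled (f : OF -> \bar R) : measurable_fun setT f ->
  (forall m, 0 <= f m)%E ->
  (\int[coupled]_m f m =
   \int[P]_o \int[P]_o' \int[coupled_states (o, o')]_u f ((o, o'), u))%E.
Proof.
move=> mf f0; rewrite integral_semidirect//.
rewrite (@integral_semidirect _ _ O O R P (fun=> P) measurable_cstP cstP1
  (fun o => \int[coupled_states o]_u f (o, u))%E) //; last first.
  by move=> o; apply: integral_ge0 => u _.
have mp o : measurable_fun setT (fun u : F * F => (o, u) : OF).
  by apply: measurable_fun_pair; [exact: measurable_cst|exact: measurable_id].
rewrite (_ : (fun o => _) = fun o => \int[pushm (coupled_states o) (mp o)]_u f u)%E; last first.
  by apply/funext => o; rewrite integral_pushm.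
apply: measurable_fun_ge0_integral => // A mA.
rewrite (_ : (fun o => _) = fun o => coupled_states o (xsection A o)).
  apply: measurable_fun_family_xsection => //; first exact: measurable_coupled_states.
  exact: coupled_states1.
by apply/funext => o; rewrite xsectionE.
Qed.

Lemma integral_coupled_fst o o' (f : F -> \bar R) : measurable_fun setT f ->
  (forall s, 0 <= f s)%E ->
  (\int[coupled_states (o, o')]_u f u.1 = \int[P0 (S 0%R o)]_s f s)%E.
Proof.
move=> mf f0; rewrite -(integral_pushm (coupled_states (o, o')) measurable_fst mf f0).
by apply: eq_measure_integral => A mA _; have [+ _] := PtP0 (S 0 o) (S 0 o') mA.
Qed.

Lemma integral_coupled_snd o o' (f : F -> \bar R) : measurable_fun setT f ->
  (forall s, 0 <= f s)%E ->
  (\int[coupled_states (o, o')]_u f u.2 = \int[P0 (S 0%R o')]_s f s)%E.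
Proof.
move=> mf f0; rewrite -(integral_pushm (coupled_states (o, o')) measurable_snd mf f0).
by apply: eq_measure_integral => A mA _; have [_ +] := PtP0 (S 0 o) (S 0 o') mA.
Qed.

Definition cov_l (m : OF) : pathType int (rvec R dX) := glue (state_past m.1.1) m.2.1.
Definition cov_r (m : OF) : pathType int (rvec R dX) := glue (state_past m.1.2) m.2.2.

Lemma measurable_cov_l : measurable_fun setT cov_l.
Proof.
apply: measurable_glue_comp.
  apply: (measurableT_comp measurable_state_past).
  exact: (measurableT_comp measurable_fst measurable_fst).
exact: (measurableT_comp measurable_fst measurable_snd).
Qed.

Lemma measurable_cov_r : measurable_fun setT cov_r.
Proof.
apply: measurable_glue_comp.
  apply: (measurableT_comp measurable_state_past).
  exact: (measurableT_comp measurable_snd measurable_fst).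
exact: (measurableT_comp measurable_snd measurable_snd).
Qed.

Local Notation HH := (pathType nat E * pathType nat T)%type.
Definition history (o : O) : HH := (resp 0 o, state_past o).

Lemma measurable_history : measurable_fun setT history.
Proof.
by apply: measurable_fun_pair; [exact: measurable_resp|exact: measurable_state_past].
Qed.

Let one_copy (psi : HH -> \bar R) (phi : HX -> \bar R) :
  measurable_fun setT psi -> measurable_fun setT phi ->
  (forall h, 0 <= psi h)%E -> (forall u, 0 <= phi u)%E ->
  (\int[P]_o \int[P0 (S 0%R o)]_s (psi (history o) *
      phi (resp 0%R o, glue (state_past o) s)) =
   \int[P]_o (psi (history o) * phi (resp 0%R o, cov_path o)))%E.
Proof.
move=> mpsi mphi psi0 phi0.
pose f (u : HH * F) : \bar R := (psi u.1 * phi (u.1.1, glue u.1.2 u.2))%E.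
have mf : measurable_fun setT f.
  apply: emeasurable_funM; first exact: (measurableT_comp mpsi measurable_fst).
  apply: (measurableT_comp mphi); apply: measurable_fun_pair.
    exact: (measurableT_comp measurable_fst measurable_fst).
  apply: measurable_glue_comp => //.
  exact: (measurableT_comp measurable_snd measurable_fst).
have := history_law_integral mf (fun u => mule_ge0 (psi0 _) (phi0 _)).
rewrite /f /= => <-.
by apply: eq_integral => o _; rewrite glue_cov_path.
Qed.

Lemma measurable_left (phi : HX -> \bar R) : measurable_fun setT phi ->
  measurable_fun setT (fun m : OF => phi (resp 0 m.1.1, cov_l m)).
Proof.
move=> mphi; apply: (measurableT_comp mphi); apply: measurable_fun_pair.
  apply: (measurableT_comp (measurable_resp 0)).
  exact: (measurableT_comp measurable_fst measurable_fst).
exact: measurable_cov_l.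
Qed.

Lemma measurable_right (phi : HX -> \bar R) : measurable_fun setT phi ->
  measurable_fun setT (fun m : OF => phi (resp 0 m.1.2, cov_r m)).
Proof.
move=> mphi; apply: (measurableT_comp mphi); apply: measurable_fun_pair.
  apply: (measurableT_comp (measurable_resp 0)).
  exact: (measurableT_comp measurable_snd measurable_fst).
exact: measurable_cov_r.
Qed.

Lemma measurable_history_l (psi : HH -> \bar R) : measurable_fun setT psi ->
  measurable_fun setT (fun m : OF => psi (history m.1.1)).
Proof.
move=> mpsi; apply: (measurableT_comp mpsi); apply: (measurableT_comp measurable_history).
exact: (measurableT_comp measurable_fst measurable_fst).
Qed.

Let msec (phi : HX -> \bar R) o : measurable_fun setT phi ->
  measurable_fun setT (fun s : F => phi (resp 0 o, glue (state_past o) s)).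
Proof.
move=> mphi; apply: (measurableT_comp mphi); apply: measurable_fun_pair.
  exact: measurable_cst.
by apply: (@measurable_glue_comp _ _ (fun=> state_past o) id);
  [exact: measurable_cst|exact: measurable_id].
Qed.

Lemma coupled_left (psi : HH -> \bar R) (phi : HX -> \bar R) :
  measurable_fun setT psi -> measurable_fun setT phi ->
  (forall h, 0 <= psi h)%E -> (forall u, 0 <= phi u)%E ->
  (\int[coupled]_m (psi (history m.1.1) * phi (resp 0%R m.1.1, cov_l m)) =
   \int[P]_o (psi (history o) * phi (resp 0%R o, cov_path o)))%E.
Proof.
move=> mpsi mphi psi0 phi0.
have mf : measurable_fun setT (fun m : OF =>
    psi (history m.1.1) * phi (resp 0%R m.1.1, cov_l m))%E.
  by apply: emeasurable_funM; [exact: measurable_history_l|exact: measurable_left].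
rewrite -one_copy// (integral_coupled mf); last by move=> m; rewrite mule_ge0.
apply: eq_integral => o _.
have mg : measurable_fun setT (fun s : F => psi (history o) *
    phi (resp 0%R o, glue (state_past o) s))%E.
  by apply: emeasurable_funM; [exact: measurable_cst|exact: msec].
transitivity (\int[P]_o' (cst (\int[P0 (S 0%R o)]_s (psi (history o) *
    phi (resp 0%R o, glue (state_past o) s))) (o' : O)))%E.
  apply: eq_integral => o' _.
  exact: (integral_coupled_fst o o' mg (fun s => mule_ge0 (psi0 _) (phi0 _))).
rewrite integral_cst//.
by rewrite [X in (_ * X)%E]probability_setT mule1.
Qed.

Lemma coupled_right (psi : HH -> R) (phi : HX -> \bar R) :
  measurable_fun setT psi -> measurable_fun setT phi ->
  (forall h, 0 <= psi h) -> (forall u, 0 <= phi u)%E ->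
  (\int[coupled]_m ((psi (history m.1.1))%:E * phi (resp 0%R m.1.2, cov_r m)) =
   (\int[P]_o (psi (history o))%:E) * \int[P]_o phi (resp 0%R o, cov_path o))%E.
Proof.
move=> mpsi mphi psi0 phi0.
have -> : (\int[P]_o phi (resp 0%R o, cov_path o) =
    \int[P]_o \int[P0 (S 0%R o)]_s phi (resp 0%R o, glue (state_past o) s))%E.
  have := @one_copy (cst 1%E) phi (@measurable_cst _ _ _ _ _ _) mphi (fun=> lee01) phi0.
  under eq_integral do under eq_integral do rewrite mul1e.
  by under [RHS]eq_integral do rewrite mul1e; move=> ->.
set K := (\int[P]_o \int[P0 (S 0%R o)]_s phi _)%E.
have K0 : (0 <= K)%E by apply: integral_ge0 => o _; exact: integral_ge0.
have mf : measurable_fun setT (fun m : OF =>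
    (psi (history m.1.1))%:E * phi (resp 0%R m.1.2, cov_r m))%E.
  apply: emeasurable_funM; last exact: measurable_right.
  by apply: (@measurable_history_l (fun h => (psi h)%:E)); exact/measurable_EFinP.
rewrite (integral_coupled mf); last by move=> m; rewrite mule_ge0// lee_fin.
have mpsih : measurable_fun setT (fun o => (psi (history o))%:E : \bar R).
  by apply/measurable_EFinP; exact: (measurableT_comp mpsi measurable_history).
rewrite -(ge0_integralZr P measurableT mpsih _ K0); last by move=> o _; rewrite lee_fin.
apply: eq_integral => o _.
have mI : measurable_fun setT (fun o' : O =>
    \int[P0 (S 0%R o')]_s phi (resp 0%R o', glue (state_past o') s))%E.
  have mp (o' : O) : measurable_fun setT (fun s : F => (o', s)).
    by apply: measurable_fun_pair; [exact: measurable_cst|exact: measurable_id].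
  pose ff (u : O * F) := phi (resp 0 u.1, glue (state_past u.1) u.2).
  have mff : measurable_fun setT ff.
    apply: (measurableT_comp mphi); apply: measurable_fun_pair.
      exact: (measurableT_comp (measurable_resp 0) measurable_fst).
    apply: measurable_glue_comp => //.
    exact: (measurableT_comp measurable_state_past measurable_fst).
  rewrite (_ : (fun o' => _) = fun o' => \int[pushm (P0 (S 0%R o')) (mp o')]_u ff u)%E; last first.
    by apply/funext => o'; rewrite integral_pushm// => u; exact: phi0.
  apply: measurable_fun_ge0_integral => // [A mA|u]; last exact: phi0.
  rewrite (_ : (fun o' => _) = fun o' => P0 (S 0%R o') (xsection A o')).
    apply: measurable_fun_family_xsection => //; first exact: measurable_P0S.
    by move=> o'; exact: prob_kernel.
  by apply/funext => o'; rewrite xsectionE.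
rewrite /K -ge0_integralZl_EFin//; last by move=> o' _; exact: integral_ge0.
apply: eq_integral => o' _.
have mg : measurable_fun setT (fun s : F => (psi (history o))%:E *
    phi (resp 0%R o', glue (state_past o') s))%E.
  by apply: emeasurable_funM; [exact: measurable_cst|exact: msec].
rewrite (integral_coupled_snd o o' mg); last by move=> s; rewrite mule_ge0// lee_fin.
by rewrite ge0_integralZl_EFin//; exact: msec.
Qed.

Lemma coupled_ae : {ae coupled, forall m, D (cov_l m) /\ D (cov_r m)}.
Proof.
pose phi (u : HX) : \bar R := (\1_(~` D) u.2)%:E.
have mphi : measurable_fun setT phi.
  apply/measurable_EFinP.
  exact: (measurableT_comp (measurable_indic (measurableC mD)) measurable_snd).
have phi0 u : (0 <= phi u)%E by rewrite lee_fin.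
have E0 : (\int[P]_o phi (resp 0%R o, cov_path o) = 0)%E.
  have [N [mN N0 hN]] := cov_path_ae.
  have mii : measurable_fun setT (fun o => phi (resp 0 o, cov_path o)).
    apply: (measurableT_comp mphi).
    by apply: measurable_fun_pair; [exact: measurable_resp|exact: measurable_cov_path].
  rewrite (ge0_negligible_integral mN measurableT mii _ N0)//.
  rewrite integral0_eq// => o [_ No]; rewrite /phi indicE memNset//=.
  by move=> nD; apply: No; exact: hN.
have aux (c : OF -> pathType int (rvec R dX)) : measurable_fun setT c ->
    (\int[coupled]_m (\1_(~` D) (c m))%:E = 0)%E -> {ae coupled, forall m, D (c m)}.
  move=> mc c0; have mDc : measurable (c @^-1` (~` D)).
    by rewrite -[X in measurable X]setTI; apply: mc => //; exact: measurableC.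
  exists (c @^-1` (~` D)); split => //.
  rewrite -c0; transitivity (\int[coupled]_m (\1_(c @^-1` (~` D)) m)%:E)%E.
    by rewrite integral_indic// setIT.
  by apply: eq_integral.
apply: filterS2 (aux _ measurable_cov_l _) (aux _ measurable_cov_r _) => //.
- have := @coupled_left (cst 1%E) phi (@measurable_cst _ _ _ _ _ _) mphi (fun=> lee01) phi0.
  under eq_integral do rewrite mul1e; move=> ->.
  by under eq_integral do rewrite mul1e.
- have := @coupled_right (cst 1) phi (@measurable_cst _ _ _ _ _ _) mphi (fun=> ler01) phi0.
  by under eq_integral do rewrite mul1e; move=> ->; rewrite E0 mule0.
Qed.

Context (e : nat -> R) (gam : 'rV[R]_dX -> 'rV[R]_dX -> R).
Hypothesis e0 : forall m, 0 <= e m.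
Hypothesis q_lip : forall y z z', histories D z -> histories D z' ->
  ((dTV (fun w => q w y z) (fun w => q w y z'))%:E <=
   \sum_(0 <= i <oo) (e i * l1norm (z i - z' i : 'rV[R]_dX))%:E)%E.
Hypothesis gam0 : forall x x', 0 <= gam x x'.
Hypothesis gamxx : forall x, gam x x = 0.
Hypothesis mgam : measurable_fun setT (fun u : rvec R dX * rvec R dX => gam u.1 u.2).
Hypothesis stX : stationary P (fun t o => g (S t o)).

Let EX : \bar R := (\int[P]_o (l1norm (g (S 0%R o) : 'rV[R]_dX))%:E)%E.

(** What the Lipschitz condition on [q] allows the covariates to contribute to
    the distance between the two transitions out of time [l]. *)
Definition discrepancy (m : OF) (l : nat) : \bar R :=
  (\sum_(0 <= i <oo) (e i * l1_metric (cov_l m (l.+1%:Z - i%:Z)%R)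
                                      (cov_r m (l.+1%:Z - i%:Z)%R))%:E)%E.

(** The total variation distance is at most 1, so the discrepancy may be capped
   at 1; this makes it a real number. *)
Definition discrepancy1 (m : OF) (l : nat) : R := fine (mine 1%E (discrepancy m l)).

Lemma discrepancy_ge0 m l : (0 <= discrepancy m l)%E.
Proof. by apply: nneseries_ge0 => i _ _; rewrite lee_fin mulr_ge0// l1_metric_ge0. Qed.

Lemma discrepancy1E m l : (discrepancy1 m l)%:E = mine 1%E (discrepancy m l).
Proof.
rewrite fineK// ge0_fin_numE; last by rewrite le_min lee01 discrepancy_ge0.
by rewrite gt_min ltry.
Qed.

Lemma discrepancy1_ge0 m l : 0 <= discrepancy1 m l.
Proof. by rewrite -lee_fin discrepancy1E le_min lee01 discrepancy_ge0. Qed.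

Lemma measurable_gap (gam' : 'rV[R]_dX -> 'rV[R]_dX -> R) t :
  measurable_fun setT (fun u : rvec R dX * rvec R dX => gam' u.1 u.2) ->
  measurable_fun setT (fun m : OF => gam' (cov_l m t) (cov_r m t)).
Proof.
move=> mg; rewrite (_ : (fun m => _) = (fun u : rvec R dX * rvec R dX => gam' u.1 u.2) \o
  (fun m : OF => (cov_l m t, cov_r m t)))//.
apply: (measurableT_comp mg); apply: measurable_fun_pair.
  exact: (measurableT_comp (measurable_coord t) measurable_cov_l).
exact: (measurableT_comp (measurable_coord t) measurable_cov_r).
Qed.

Lemma measurable_discrepancy l : measurable_fun setT (discrepancy^~ l).
Proof.
apply: ge0_emeasurable_sum => [i m _ _|i _].
  by rewrite lee_fin mulr_ge0// l1_metric_ge0.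
apply/measurable_EFinP; apply: measurable_funM => //.
exact: (measurable_gap _ (@measurable_l1_metric R dX)).
Qed.

Lemma measurable_discrepancy1 l : measurable_fun setT (discrepancy1^~ l).
Proof.
apply: measurableT_comp => //; apply: measurable_mine => //.
exact: measurable_discrepancy.
Qed.

Lemma stationary_integral t (f : rvec R dX -> \bar R) : measurable_fun setT f ->
  (forall x, 0 <= f x)%E ->
  (\int[P]_o f (g (S t o)) = \int[P]_o f (g (S 0%R o)))%E.
Proof.
move=> mf f0.
have mX s : measurable_fun setT (fun o => g (S s o) : rvec R dX).
  exact: measurableT_comp.
rewrite -(integral_pushm P (mX t) mf f0) -(integral_pushm P (mX 0) mf f0).
apply: eq_measure_integral => A mA _.
have mA' : measurable ((fun x : pathType int (rvec R dX) => x 0) @^-1` A).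
  by rewrite -[X in measurable X]setTI; exact: measurable_coord.
have := stX t mA'; rewrite /preimage /= => H.
by move: H; under eq_set do rewrite add0r.
Qed.

Section functional.
Context (I : choiceType) (s : seq I) (j : I -> nat).
Local Notation VI := (pathType I (E * rvec R dX)%type).

Definition picked (o : O) : VI := fun i => (Y (j i) o, g (S (j i) o)).

Definition coupling_cost (m : OF) : R :=
  \sum_(i <- s) (gam (cov_l m (j i)) (cov_r m (j i)) +
                 mismatch b (discrepancy1 m) 0 (j i) 0).

Hypothesis j0 : forall i, i \in s -> (0 < j i)%N.

Let b01 := coef_b01 finE D_nonempty q01 q1.
Let b_dec := coef_b_dec finE D_nonempty q01 q1.

Let mm_ge0 m i : 0 <= mismatch b (discrepancy1 m) 0 (j i) 0.
Proof.
rewrite /mismatch addr_ge0//; first by have /andP[] := ret01 b01 (j i - 0) 0.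
apply: sumr_ge0 => l _; rewrite mulr_ge0// ?discrepancy1_ge0//.
by have /andP[] := ret01 b01 (j i - l.+1) 0.
Qed.

Lemma coupling_cost_ge0 m : 0 <= coupling_cost m.
Proof. by apply: sumr_ge0 => i _; rewrite addr_ge0. Qed.

Lemma measurable_coupling_cost : measurable_fun setT coupling_cost.
Proof.
apply: measurable_sum => i; apply: measurable_funD; first exact: measurable_gap.
apply: measurable_funD => //; apply: measurable_sum => l.
by apply: measurable_funM => //; exact: measurable_discrepancy1.
Qed.

Lemma measurable_picked : measurable_fun setT picked.
Proof.
apply: measurable_fun_path => i; apply: measurable_fun_pair; first exact: mY.
exact: measurableT_comp.
Qed.

(** On each side, the tower property replaces the observed value by its
    expectation given the history at time 0 and the covariate path. The event
    [A] concerns the left copy only, of which the right copy is independent: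
    this makes the product of expectations appear. *)
Lemma coupled_comparison (f : VI -> R) (A : set HH) :
  measurable_fun setT f -> (forall v, 0 <= f v) -> measurable A ->
  (forall v v', `|f v - f v'| <=
     \sum_(i <- s) (((v i).1 != (v' i).1)%:R + gam (v i).2 (v' i).2)) ->
  (\int[P]_(o in history @^-1` A) (f (picked o))%:E <=
   P (history @^-1` A) * \int[P]_o (f (picked o))%:E +
   \int[coupled]_m ((\1_A (history m.1.1) * coupling_cost m)%:E))%E.
Proof.
move=> mf f0 mA f_lip.
pose M := (\max_(i <- s) j i)%N.
have jM i : i \in s -> (j i <= M)%N by move=> si; exact: leq_bigmax_seq.
have f_eq v v' : (forall i, i \in s -> v i = v' i) -> f v = f v'.
  move=> vv'; apply/eqP; rewrite -subr_eq0 -normr_le0.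
  rewrite (le_trans (f_lip v v'))// big_seq big1// => i /vv' ->.
  by rewrite eqxx gamxx addr0.
pose pick (u : HX) : VI := fun i => (u.1 (M - j i)%N, u.2 (j i)).
pose Phi u := f (pick u).
have mPhi : measurable_fun setT Phi.
  apply: (measurableT_comp mf); apply: measurable_fun_path => i.
  apply: measurable_fun_pair.
    exact: (measurableT_comp (measurable_coord (M - j i)%N) measurable_fst).
  exact: (measurableT_comp (measurable_coord (j i : int)) measurable_snd).
have Phi0 u : 0 <= Phi u by exact: f0.
have fPhi o : f (picked o) = Phi (resp (0 + M%:Z) o, cov_path o).
  apply: f_eq => i si; rewrite /pick /picked /resp /past /cov_path /=.
  congr (Y _ o, _); have := jM i si; lia.
pose ex := expect 0 M Phi.
have mex : measurable_fun setT ex by exact: (measurable_expect mD mq).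
have ex0 u : 0 <= ex u by exact: (expect_ge0 q01).
have mpast : measurable_fun setT (fun u : HS => (u.1, past u.2 0) : HH).
  apply: measurable_fun_pair => //; apply: measurable_fun_path => i.
  exact: (measurableT_comp (measurable_coord (0 - i%:Z)) measurable_snd).
have tower (psi : HH -> \bar R) : measurable_fun setT psi -> (forall h, 0 <= psi h)%E ->
    (\int[P]_o (psi (history o) * (f (picked o))%:E) =
     \int[P]_o (psi (history o) * (ex (resp 0%R o, cov_path o))%:E))%E.
  move=> mpsi psi0.
  have := @response_expect 0 M (fun u => psi (u.1, past u.2 0)) Phi
    (measurableT_comp mpsi mpast) (fun u => psi0 _) mPhi Phi0.
  by move=> <-; apply: eq_integral => o _; rewrite fPhi.
pose psi (h : HH) : R := \1_A h.
have mpsi : measurable_fun setT psi by exact: measurable_indic.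
have psi0 h : 0 <= psi h by rewrite /psi indicE.
have mEex : measurable_fun setT (EFin \o ex) by exact/measurable_EFinP.
have lhsE : (\int[P]_(o in history @^-1` A) (f (picked o))%:E =
    \int[coupled]_m ((psi (history m.1.1))%:E * (ex (resp 0%R m.1.1, cov_l m))%:E))%E.
  rewrite (@coupled_left (EFin \o psi) (EFin \o ex))//; last by apply/measurable_EFinP.
  rewrite /= -(tower (EFin \o psi))//; last by apply/measurable_EFinP.
  rewrite integral_mkcond; apply: eq_integral => o _; rewrite patchE /psi /= indicE.
  rewrite (_ : (o \in history @^-1` A) = (history o \in A))//.
  by case: (_ \in A); rewrite ?mul1e ?mul0e.
have rhsE : (P (history @^-1` A) * \int[P]_o (f (picked o))%:E =
    \int[coupled]_m ((psi (history m.1.1))%:E * (ex (resp 0%R m.1.2, cov_r m))%:E))%E.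
  rewrite (@coupled_right psi (EFin \o ex))//; congr (_ * _)%E.
    transitivity (\int[P]_o (\1_(history @^-1` A) o)%:E)%E; last by apply: eq_integral.
    rewrite integral_indic ?setIT//.
    by rewrite -[X in measurable X]setTI; exact: measurable_history.
  have := @tower (cst 1%E) (@measurable_cst _ _ _ _ _ _) (fun=> lee01).
  under eq_integral do rewrite mul1e; move=> ->.
  by under eq_integral do rewrite mul1e.
rewrite lhsE rhsE -ge0_integralD//; first last.
- apply/measurable_EFinP; apply: measurable_funM; last exact: measurable_coupling_cost.
  apply: (measurableT_comp mpsi); apply: (measurableT_comp measurable_history).
  exact: (measurableT_comp measurable_fst measurable_fst).
- by move=> m _; rewrite lee_fin mulr_ge0 ?coupling_cost_ge0.
- apply: emeasurable_funM; last exact: (@measurable_right (EFin \o ex)).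
  by apply: (@measurable_history_l (EFin \o psi)); exact/measurable_EFinP.
- by move=> m _; rewrite -EFinM lee_fin mulr_ge0.
apply: ae_ge0_le_integral => //.
- by move=> m _; rewrite -EFinM lee_fin mulr_ge0.
- apply: emeasurable_funM; last exact: (@measurable_left (EFin \o ex)).
  by apply: (@measurable_history_l (EFin \o psi)); exact/measurable_EFinP.
- by move=> m _; rewrite -EFinM -EFinD lee_fin addr_ge0 ?mulr_ge0 ?coupling_cost_ge0.
- apply: emeasurable_funD.
    apply: emeasurable_funM; last exact: (@measurable_right (EFin \o ex)).
    by apply: (@measurable_history_l (EFin \o psi)); exact/measurable_EFinP.
  apply/measurable_EFinP; apply: measurable_funM; last exact: measurable_coupling_cost.
  apply: (measurableT_comp mpsi); apply: (measurableT_comp measurable_history).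
  exact: (measurableT_comp measurable_fst measurable_fst).
apply: filterS coupled_ae => m [Dl Dr] _.
rewrite -!EFinM -EFinD lee_fin -/(psi _) -mulrDr ler_wpM2l// -lerBlDl.
apply: le_trans (ler_norm _) _.
rewrite /coupling_cost big_split /= [leRHS]addrC.
rewrite /ex; have H := @expect_coupling R dE E dX finE q D D_nonempty q01 q1 I s j
  (\sum_(i <- s) gam (cov_l m (j i)) (cov_r m (j i))) (discrepancy1 m) Phi 0 M
  (resp 0 m.1.1) (resp 0 m.1.2) _ _ Dl Dr.
apply: H => //.
- exact: discrepancy1_ge0.
- move=> l z; rewrite -lee_fin discrepancy1E le_min lee_fin.
  rewrite (dTV_q_le1 finE q01 q1 _ _ (histories_past _ Dl) (histories_past _ Dr)) /=.
  apply: le_trans (q_lip _ (histories_past _ Dl) (histories_past _ Dr)) _.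
  by rewrite /discrepancy /past add0r.
- by move=> i si; rewrite j0// jM.
move=> z z'; rewrite /Phi (le_trans (f_lip _ _))//.
by rewrite big_split.
Qed.

End functional.

Lemma tail_sum_mul n (K : \bar R) : (0 <= K)%E ->
  (\sum_(n <= i <oo) (e i)%:E * K <= (\sum_(n <= i <oo) (e i)%:E) * K)%E.
Proof.
have s0 : (0 <= \sum_(n <= i <oo) (e i)%:E)%E.
  by apply: nneseries_ge0 => i _ _; rewrite lee_fin.
case: K => [k||]// k0.
  under eq_eseriesr do rewrite muleC.
  by rewrite nneseriesZl 1?muleC// => i _; rewrite lee_fin.
have [Z|NZ] := eqVneq (\sum_(n <= i <oo) (e i)%:E)%E 0%E; last first.
  by rewrite [leRHS]gt0_muley ?leey// lt_neqAle eq_sym NZ.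
rewrite Z mul0e eseries0// => i ni _; suff -> : e i = 0 by rewrite mul0e.
have : ((e i)%:E <= \sum_(n <= i <oo) (e i)%:E)%E.
  apply: le_trans (nneseries_lim_ge i.+1 _); last by move=> *; rewrite lee_fin.
  by rewrite big_nat_recr//= leeDr// sume_ge0// => *; rewrite lee_fin.
by rewrite Z lee_fin => ei; apply/eqP; rewrite eq_le ei e0.
Qed.

(** Each side is a copy of the covariate process, and stationarity moves time
    [t] to 0. *)
Lemma coupled_law t (psi : rvec R dX -> \bar R) : measurable_fun setT psi ->
  (forall x, 0 <= psi x)%E ->
  (\int[coupled]_m psi (cov_l m t) = \int[P]_o psi (g (S 0%R o)))%E /\
  (\int[coupled]_m psi (cov_r m t) = \int[P]_o psi (g (S 0%R o)))%E.
Proof.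
move=> mpsi psi0; rewrite -(stationary_integral t mpsi psi0).
pose phi (u : HX) : \bar R := psi (u.2 t).
have mphi : measurable_fun setT phi.
  apply: (measurableT_comp mpsi).
  exact: (measurableT_comp (measurable_coord t) measurable_snd).
have phi0 u : (0 <= phi u)%E by exact: psi0.
split.
- have := @coupled_left (cst 1%E) phi (@measurable_cst _ _ _ _ _ _) mphi (fun=> lee01) phi0.
  under eq_integral do rewrite mul1e; move=> ->.
  by apply: eq_integral => o _; rewrite mul1e.
have := @coupled_right (cst 1) phi (@measurable_cst _ _ _ _ _ _) mphi (fun=> ler01) phi0.
under eq_integral do rewrite mul1e; move=> ->.
have -> : (\int[P]_o (cst (1 : R) (history o))%:E = 1)%E.
  by rewrite (eq_integral (cst 1%E))// integral_cst// mul1e [LHS]probability_setT.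
by rewrite mul1e.
Qed.

Let norm_at (x : rvec R dX) : \bar R := (l1norm (x : 'rV[R]_dX))%:E.
Let mnorm_at : measurable_fun setT norm_at.
Proof. by apply/measurable_EFinP; exact: measurable_l1norm. Qed.
Let norm_at0 x : (0 <= norm_at x)%E.
Proof. by rewrite lee_fin l1norm_ge0. Qed.

Let mgap1 t : measurable_fun setT (fun m : OF => l1_metric (cov_l m t) (cov_r m t)).
Proof. exact: (measurable_gap t (@measurable_l1_metric R dX)). Qed.

Let mleft t : measurable_fun setT (fun m : OF => l1norm (cov_l m t : 'rV[R]_dX)).
Proof.
apply: (measurableT_comp (@measurable_l1norm R dX)).
exact: (measurableT_comp (measurable_coord t) measurable_cov_l).
Qed.

Let mright t : measurable_fun setT (fun m : OF => l1norm (cov_r m t : 'rV[R]_dX)).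
Proof.
apply: (measurableT_comp (@measurable_l1norm R dX)).
exact: (measurableT_comp (measurable_coord t) measurable_cov_r).
Qed.

Let gap_le t (m : OF) : l1_metric (cov_l m t) (cov_r m t) <=
  l1norm (cov_l m t : 'rV[R]_dX) + l1norm (cov_r m t : 'rV[R]_dX).
Proof. by rewrite /l1_metric (le_trans (ler_l1normD _ _))// l1normN. Qed.

Lemma integral_gap_past t :
  (\int[coupled]_m (l1_metric (cov_l m t) (cov_r m t))%:E <= 2%:E * EX)%E.
Proof.
apply: (@le_trans _ _ (\int[coupled]_m (norm_at (cov_l m t) + norm_at (cov_r m t)))%E).
  apply: ge0_le_integral => //.
  - by move=> m _; rewrite lee_fin l1_metric_ge0.
  - by apply/measurable_EFinP.
  - by apply: emeasurable_funD; exact/measurable_EFinP.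
  - by move=> m _; rewrite -EFinD lee_fin.
have [L L'] := coupled_law t mnorm_at norm_at0.
rewrite ge0_integralD//; [|exact/measurable_EFinP|exact/measurable_EFinP].
by rewrite L L' -mule2n mule_natl.
Qed.

Lemma integral_gap n : (0 < n)%N ->
  (\int[coupled]_m (gam (cov_l m n) (cov_r m n))%:E =
   coef_a (distribution P (S 0)) Pt g gam n)%E.
Proof.
case: n => // n _.
pose G (u : F * F) : \bar R := (gam (g (u.1 n)) (g (u.2 n)))%:E.
have mG : measurable_fun setT G.
  apply/measurable_EFinP; apply: (measurableT_comp mgam
    (g := fun u : F * F => (g (u.1 n) : rvec R dX, g (u.2 n) : rvec R dX))).
  apply: measurable_fun_pair; apply: (measurableT_comp (measurable_funP g)).
    exact: (measurableT_comp (measurable_coord n) measurable_fst).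
  exact: (measurableT_comp (measurable_coord n) measurable_snd).
have G0 u : (0 <= G u)%E by rewrite lee_fin.
pose Phi (s : T * T) : \bar R := (\int[Pt s]_u G u)%E.
have Phi0 s : (0 <= Phi s)%E by exact: integral_ge0.
have mPhi : measurable_fun setT Phi.
  by apply: measurable_fun_ge0_integral => // A mA; exact: measurable_kernel.
rewrite integral_coupled; first last.
- by move=> m; rewrite lee_fin.
- by apply/measurable_EFinP; exact: measurable_gap.
rewrite /coef_a ge0_integral_distribution; first last.
- by move=> s; apply: integral_ge0 => s' _; exact: (Phi0 (s, s')).
- exact: (@measurable_fun_fubini_tonelli_F _ _ _ _ _ (distribution P (S 0)) Phi).
apply: eq_integral => o _ /=; rewrite ge0_integral_distribution//; first last.
- by move=> s'; exact: (Phi0 (_, s')).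
- apply: (measurableT_comp mPhi (g := fun s' => (S 0 o, s'))).
  by apply: measurable_fun_pair => //; exact: measurable_cst.
Qed.

(** When the covariates agree with high probability, Hoelder's inequality turns
    the probability of disagreement into a bound on the mean distance. *)
Lemma integral_gap_discrete (p : \bar R) n : gam = @discrete_metric R dX ->
  (1 <= p)%E -> (0 < n)%N ->
  (\int[coupled]_m (l1_metric (cov_l m n) (cov_r m n))%:E <=
   2%:E * 'N[P]_p[(fun o => (l1norm (g (S 0 o) : 'rV[R]_dX))%:E)] *
   coef_a (distribution P (S 0)) Pt g gam n `^ fine ((hoelder_conjugate p)^-1)%E)%E.
Proof.
move=> gamE p1 n0; rewrite -integral_gap//.
pose A : set OF := (fun m : OF => gam (cov_l m n) (cov_r m n)) @^-1` [set 1].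
have mA : measurable A.
  by rewrite -[X in measurable X]setTI; apply: (measurable_gap n mgam).
have gapA m : gam (cov_l m n) (cov_r m n) = \1_A m.
  have [eqlr|ne] := eqVneq (cov_l m n) (cov_r m n).
    have g0 : gam (cov_l m n) (cov_r m n) = 0 by rewrite eqlr gamxx.
    rewrite g0 indicE memNset// => Am.
    have : gam (cov_l m n) (cov_r m n) = 1 by exact: Am.
    by rewrite g0 => /eqP; rewrite eq_sym oner_eq0.
  have g1 : gam (cov_l m n) (cov_r m n) = 1 by rewrite gamE /discrete_metric ne.
  by rewrite g1 indicE mem_set.
have -> : (\int[coupled]_m (gam (cov_l m n) (cov_r m n))%:E = coupled A)%E.
  by under eq_integral do rewrite gapA; rewrite integral_indic// setIT.
pose fl (m : OF) := l1norm (cov_l m n : 'rV[R]_dX).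
pose fr (m : OF) := l1norm (cov_r m n : 'rV[R]_dX).
have fl0 m : 0 <= fl m by exact: l1norm_ge0.
have fr0 m : 0 <= fr m by exact: l1norm_ge0.
have mfl : measurable_fun setT fl := mleft n.
have mfr : measurable_fun setT fr := mright n.
have m1A : measurable_fun setT (\1_A : OF -> R) by exact: measurable_indic.
apply: (@le_trans _ _ (\int[coupled]_m ((fl m * \1_A m)%:E + (fr m * \1_A m)%:E))%E).
  apply: ge0_le_integral => //.
  - by move=> m _; rewrite lee_fin l1_metric_ge0.
  - by apply/measurable_EFinP.
  - by apply: emeasurable_funD; apply/measurable_EFinP; apply: measurable_funM.
  move=> m _; rewrite -EFinD lee_fin -mulrDl -gapA gamE /discrete_metric.
  have [eqlr|ne] := eqVneq (cov_l m n) (cov_r m n).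
    by rewrite mulr0 /l1_metric eqlr subrr l1norm0.
  by rewrite mulr1; exact: gap_le.
rewrite ge0_integralD//; first last.
- by apply/measurable_EFinP; apply: measurable_funM.
- by move=> m _; rewrite lee_fin mulr_ge0.
- by apply/measurable_EFinP; apply: measurable_funM.
- by move=> m _; rewrite lee_fin mulr_ge0.
have half (f : OF -> R) : measurable_fun setT f -> (forall m, 0 <= f m) ->
    (forall psi : R -> \bar R, measurable_fun setT psi -> (forall x, 0 <= psi x)%E ->
      \int[coupled]_m psi (f m) = \int[P]_o psi (l1norm (g (S 0%R o) : 'rV[R]_dX)))%E ->
    (\int[coupled]_m (f m * \1_A m)%:E <=
     'N[P]_p[(fun o => (l1norm (g (S 0%R o) : 'rV[R]_dX))%:E)] *
       coupled A `^ fine ((hoelder_conjugate p)^-1)%E)%E.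
  move=> mf f0 law; apply: le_trans (Lnorm_indicator_le coupled mf f0 mA p1) _.
  apply: lee_wpmul2r; first exact: poweR_ge0.
  apply: Lnorm_law_le => //; apply: (measurableT_comp (@measurable_l1norm R dX)).
  exact: measurableT_comp.
rewrite -muleA [leRHS]mule_natl mule2n; apply: leeD; apply: half => //.
- by move=> psi mpsi psi0; have [-> _] := coupled_law n
    (measurableT_comp mpsi (@measurable_l1norm R dX)) (fun x => psi0 _).
- by move=> psi mpsi psi0; have [_ ->] := coupled_law n
    (measurableT_comp mpsi (@measurable_l1norm R dX)) (fun x => psi0 _).
Qed.

(** For the discrete metric [a n] is a probability. *)
Lemma coef_a_le_power (r : R) n : gam = @discrete_metric R dX -> 0 <= r <= 1 ->
  (0 < n)%N ->
  (coef_a (distribution P (S 0)) Pt g gam n <=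
   coef_a (distribution P (S 0)) Pt g gam n `^ r)%E.
Proof.
move=> gamE /andP[r0 r1] n0; rewrite -integral_gap//.
set I := (\int[coupled]_m _)%E.
have I0 : (0 <= I)%E by apply: integral_ge0 => m _; rewrite lee_fin.
have I1 : (I <= 1)%E.
  apply: (@le_trans _ _ (\int[coupled]_m (cst 1%E m))%E).
    apply: ge0_le_integral => //.
    - by move=> m _; rewrite lee_fin.
    - by apply/measurable_EFinP; exact: measurable_gap.
    - by move=> m _; rewrite lee_fin gamE /discrete_metric; case: (_ != _).
  by rewrite integral_cst// [X in (_ * X)%E]probability_setT mule1.
move: I I0 I1 => [x||]//; rewrite /= !lee_fin [0 <= x]le_eqVlt => /predU1P[<-|x0] x1.
  exact: powR_ge0.
by rewrite -[leLHS]powRr1 ?(ltW x0)//; apply: ger_powR => //; rewrite x0.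
Qed.

Context (c : nat -> \bar R).
Hypothesis hc : forall t : nat, (0 < t)%N ->
  (\int[coupled]_m (l1_metric (cov_l m t) (cov_r m t))%:E <= c t)%E.
Hypothesis hg : forall t : nat, (0 < t)%N ->
  (\int[coupled]_m (gam (cov_l m t) (cov_r m t))%:E <= c t)%E.

(** Times in the sum that are at least 1 are controlled by [c], earlier ones by
    the triangle inequality and stationarity; these are the two parts of
    [kappa]. *)
Lemma integral_discrepancy l :
  (\int[coupled]_m discrepancy m l <= kappa e c EX l.+1)%E.
Proof.
pose gap t m := l1_metric (cov_l m t) (cov_r m t).
have mgap t : measurable_fun setT (gap t).
  exact: (measurable_gap _ (@measurable_l1_metric R dX)).
have gap0 t m : 0 <= gap t m by exact: l1_metric_ge0.
have gapE i : (\int[coupled]_m (e i * gap (l.+1%:Z - i%:Z)%R m)%:E =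
    (e i)%:E * \int[coupled]_m (gap (l.+1%:Z - i%:Z)%R m)%:E)%E.
  under eq_integral do rewrite EFinM.
  rewrite ge0_integralZl_EFin//; first by move=> m _; rewrite lee_fin.
  exact/measurable_EFinP.
have -> : (\int[coupled]_m discrepancy m l =
    \sum_(0 <= i <oo) \int[coupled]_m (e i * gap (l.+1%:Z - i%:Z)%R m)%:E)%E.
  apply: (@integral_nneseries _ _ R coupled setT measurableT
    (fun i m => (e i * gap (l.+1%:Z - i%:Z)%R m)%:E)).
    by move=> i; apply/measurable_EFinP; exact: measurable_funM.
  by move=> i m _; rewrite lee_fin mulr_ge0// gap0.
rewrite (eq_eseriesr (fun i _ => gapE i)) /kappa.
rewrite (@nneseries_split _ _ 0 l.+1); last first.
  move=> i _; rewrite mule_ge0 ?lee_fin// integral_ge0// => m _.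
  by rewrite lee_fin.
rewrite add0n; apply: leeD.
  rewrite big_nat [leRHS]big_nat; apply: lee_sum => i /andP[_ il].
  by rewrite lee_wpmul2l ?lee_fin// subzn ?(ltnW il)// hc// subn_gt0.
apply: (@le_trans _ _ (\sum_(l.+1 <= i <oo) (e i)%:E * (2%:E * EX))%E).
  apply: lee_nneseries => [i _ _|i _].
    rewrite mule_ge0 ?lee_fin// integral_ge0// => m _; by rewrite lee_fin.
  by rewrite lee_wpmul2l ?lee_fin//; exact: integral_gap_past.
have EX0 : (0 <= EX)%E by apply: integral_ge0 => o _; rewrite lee_fin l1norm_ge0.
apply: le_trans (tail_sum_mul _ _) _; first by rewrite mule_ge0.
by rewrite muleCA.
Qed.

Lemma kappa_ge0 n : (0 <= kappa e c EX n)%E.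
Proof.
have c0 t : (0 < t)%N -> (0 <= c t)%E.
  by move=> /hc; apply: le_trans; apply: integral_ge0 => m _; rewrite lee_fin l1_metric_ge0.
have EX0 : (0 <= EX)%E by apply: integral_ge0 => o _; rewrite lee_fin l1norm_ge0.
rewrite /kappa adde_ge0//.
  rewrite big_nat; apply: sume_ge0 => i /andP[_ ?].
  by rewrite mule_ge0 ?lee_fin// c0// subn_gt0.
rewrite mule_ge0// mule_ge0//; apply: nneseries_ge0 => i _ _; by rewrite lee_fin.
Qed.

(** The mean of the mismatch at time [j] is the sum of the mean discrepancies at
    the earlier times [l], each multiplied by the probability that the renewal
    chain is at 0 after [j - l.+1] steps, which [bstar] dominates with a shift of
    one step; the term [l = j.-1], whose factor is 1, gives the isolated [kappa]
    of [rate]. *)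
Lemma integral_coupling_cost (I : choiceType) (s : seq I) (j : I -> nat) :
  (forall i, i \in s -> (0 < j i)%N) ->
  (\int[coupled]_m (coupling_cost s j m)%:E <= \sum_(i <- s) rate b e c EX (j i))%E.
Proof.
move=> j0.
have b01 := coef_b01 finE D_nonempty q01 q1.
have b_dec := coef_b_dec finE D_nonempty q01 q1.
have ret0 n i : 0 <= ret b n i by have /andP[] := ret01 b01 n i.
have mmg t : measurable_fun setT (fun m : OF => (gam (cov_l m t) (cov_r m t))%:E).
  by apply/measurable_EFinP; exact: measurable_gap.
have mdis l (k : R) : measurable_fun setT (fun m : OF => (discrepancy1 m l * k)%:E).
  by apply/measurable_EFinP; apply: measurable_funM => //; exact: measurable_discrepancy1.
have dis0 l n m : (0 <= (discrepancy1 m l * ret b n 0)%:E)%E.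
  by rewrite lee_fin mulr_ge0// discrepancy1_ge0.
pose g1 i m : \bar R := ((gam (cov_l m (j i)) (cov_r m (j i)))%:E +
  ((ret b (j i) 0)%:E + \sum_(0 <= l < j i) (discrepancy1 m l * ret b (j i - l.+1) 0)%:E))%E.
have mg2 i : measurable_fun setT (fun m : OF =>
    \sum_(0 <= l < j i) (discrepancy1 m l * ret b (j i - l.+1) 0)%:E : \bar R)%E.
  by apply: emeasurable_sum => l.
have mg1 i : measurable_fun setT (g1 i).
  by apply: emeasurable_funD => //; apply: emeasurable_funD.
have g20 i m : (0 <= \sum_(0 <= l < j i) (discrepancy1 m l * ret b (j i - l.+1) 0)%:E)%E.
  by apply: sume_ge0 => l _.
have g10 i m : (0 <= g1 i m)%E.
  by rewrite /g1 !adde_ge0// lee_fin.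
have -> : (\int[coupled]_m (coupling_cost s j m)%:E =
    \int[coupled]_m \sum_(i <- s) g1 i m)%E.
  apply: eq_integral => m _; rewrite /coupling_cost -sumEFin; apply: eq_bigr => i _.
  rewrite /g1 /mismatch EFinD subn0 EFinD; congr (_ + (_ + _))%E.
  by rewrite -sumEFin.
rewrite ge0_integral_sum//; rewrite big_seq [leRHS]big_seq; apply: lee_sum => i si.
have ji := j0 i si.
rewrite ge0_integralD//; first last.
- by apply: emeasurable_funD.
- by move=> m _; rewrite adde_ge0// lee_fin.
- by move=> m _; rewrite lee_fin.
rewrite ge0_integralD//; last by move=> m _; rewrite lee_fin.
rewrite integral_cst// [X in (_ * X)%E]probability_setT mule1.
rewrite ge0_integral_sum//.
have disE l n : (\int[coupled]_m (discrepancy1 m l * ret b n 0)%:E <=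
    kappa e c EX l.+1 * (ret b n 0)%:E)%E.
  under eq_integral do rewrite mulrC EFinM.
  rewrite ge0_integralZl_EFin//; first last.
  - by apply/measurable_EFinP; exact: measurable_discrepancy1.
  - by move=> m _; rewrite lee_fin discrepancy1_ge0.
  rewrite muleC lee_wpmul2r ?lee_fin//; apply: le_trans (integral_discrepancy l).
  apply: ge0_le_integral => //.
  - by move=> m _; rewrite lee_fin discrepancy1_ge0.
  - by apply/measurable_EFinP; exact: measurable_discrepancy1.
  - exact: measurable_discrepancy.
  - by move=> m _; rewrite discrepancy1E ge_min lexx orbT.
case: (j i) ji => // n _.
rewrite /rate [n.+1.-1]/=.
rewrite [leRHS](_ : _ = c n.+1 + ((bstar b n)%:E + (kappa e c EX n.+1 +
  \sum_(0 <= i < n) (bstar b i)%:E * kappa e c EX (n.+1 - i - 1)%N)))%E; last first.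
  by rewrite -!addeA addeCA.
apply: leeD; first exact: hg.
apply: leeD; first by rewrite lee_fin; exact: ret_le_bstar.
rewrite big_nat_recr// addeC; apply: leeD; last first.
  by apply: le_trans (disE _ _) _; rewrite subnn /= mule1.
rewrite big_nat_rev /= add0n big_nat [leRHS]big_nat; apply: lee_sum => l /andP[_ ln].
apply: le_trans (disE _ _) _.
rewrite (_ : (n - l.+1).+1 = n.+1 - l - 1)%N; last by lia.
rewrite (_ : (n.+1 - (n.+1 - l - 1))%N = l.+1); last by lia.
rewrite muleC lee_wpmul2r ?kappa_ge0// lee_fin.
exact: ret_le_bstar.
Qed.

(** The coupling depends neither on the event [B k] nor on the test function
    [f k], and the events are disjoint, so its cost is paid only once however
    many events there are. *)
Lemma coupled_partition (I : choiceType) (s : seq I) (j : I -> nat) (n : nat)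
    (f : nat -> pathType I (E * rvec R dX)%type -> R) (B : nat -> set O) :
  (forall i, i \in s -> (0 < j i)%N) ->
  (forall k, measurable_fun setT (f k)) -> (forall k v, 0 <= f k v) ->
  (forall k, (k < n)%N -> forall v v', `|f k v - f k v'| <=
     \sum_(i <- s) (((v i).1 != (v' i).1)%:R + gam (v i).2 (v' i).2)) ->
  (forall k, exists2 A, measurable A & B k = history @^-1` A) ->
  trivIset setT B ->
  (\sum_(0 <= k < n) \int[P]_(o in B k) (f k (picked j o))%:E <=
   \sum_(0 <= k < n) (P (B k) * \int[P]_o (f k (picked j o))%:E) +
   \sum_(i <- s) rate b e c EX (j i))%E.
Proof.
move=> j0 mf f0 flip hB tB.
have [A HA] := choice (fun k => let: ex_intro2 a b c := hB k in ex_intro (fun A =>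
  measurable A /\ B k = history @^-1` A) a (conj b c)).
apply: (@le_trans _ _ (\sum_(0 <= k < n) (P (B k) * \int[P]_o (f k (picked j o))%:E +
   \int[coupled]_m ((\1_(A k) (history m.1.1) * coupling_cost s j m)%:E)))%E).
  rewrite big_nat [leRHS]big_nat; apply: lee_sum => k /andP[_ kn].
  have [mA ->] := HA k; apply: coupled_comparison => //; exact: flip.
rewrite big_split /= leeD2l//; apply: le_trans (integral_coupling_cost j0).
have mcost k : measurable_fun setT
    (fun m : OF => (\1_(A k) (history m.1.1) * coupling_cost s j m)%:E).
  apply/measurable_EFinP; apply: measurable_funM; last exact: measurable_coupling_cost.
  have [mA _] := HA k.
  apply: (measurableT_comp (measurable_indic mA)); apply: (measurableT_comp measurable_history).
  exact: (measurableT_comp measurable_fst measurable_fst).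
have cost0 m : 0 <= coupling_cost s j m by exact: coupling_cost_ge0.
rewrite -ge0_integral_sum//; last by move=> k m _; rewrite lee_fin mulr_ge0.
apply: ge0_le_integral => //.
- by move=> m _; apply: sume_ge0 => k _; rewrite lee_fin mulr_ge0.
- by apply: emeasurable_sum => k.
- by apply/measurable_EFinP; exact: measurable_coupling_cost.
move=> m _; rewrite sumEFin lee_fin -mulr_suml ler_piMl//.
have one k : \1_(A k) (history m.1.1) = (m.1.1 \in B k)%:R :> R.
  by have [_ ->] := HA k; rewrite indicE.
under eq_bigr do rewrite one.
have [[k [kn Bk]]|none] := pselect (exists k, (k < n)%N /\ B k m.1.1).
  rewrite (bigD1_seq k) ?mem_index_iota ?iota_uniq//= mem_set// big1 ?addr0// => k' k'k.
  rewrite memNset// => Bk'; move/trivIsetP : tB => /(_ k' k Logic.I Logic.I k'k).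
  by move=> /seteqP[/(_ m.1.1 (conj Bk' Bk))].
rewrite big_nat big1// => k /andP[_ kn]; rewrite memNset// => Bk.
by apply: none; exists k.
Qed.

(** * The conditional law of the process given its past *)

Local Notation V := (fun t o => (Y t o, g (S t o) : rvec R dX)).

Lemma rate_ge0 n : (0 < n)%N -> (0 <= rate b e c EX n)%E.
Proof.
move=> n0; have b01 := coef_b01 finE D_nonempty q01 q1.
have b_dec := coef_b_dec finE D_nonempty q01 q1.
have bs0 m : (0 <= (bstar b m)%:E)%E.
  rewrite lee_fin; apply: le_trans (ret_le_bstar b01 b_dec m).
  by have /andP[] := ret01 b01 m.+1 0.
have c0 : (0 <= c n)%E.
  apply: le_trans (hc n0); apply: integral_ge0 => m _.
  by rewrite lee_fin l1_metric_ge0.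
rewrite /rate; apply: adde_ge0; last by apply: sume_ge0 => i _; rewrite mule_ge0 ?kappa_ge0.
by rewrite adde_ge0 ?kappa_ge0// adde_ge0.
Qed.

Section conditional_law.
Context (I : choiceType) (j : I -> nat) (G : set (set O)).
Local Notation VI := (pathType I (E * rvec R dX)%type).
Context (k : O -> probability VI R).
Hypothesis mG : <<s G >> `<=` @measurable _ O.
Hypothesis G_past : forall B, G B -> exists2 A, measurable A & B = history @^-1` A.
Hypothesis k_cond : cond_dist P <<s G >> (picked j) (fun o => k o).
Context (f : nat -> VI -> R) (M : nat -> R) (K : \bar R).
Hypothesis mf : forall i, measurable_fun setT (f i).
Hypothesis f_bound : forall i v, 0 <= f i v <= M i.
Hypothesis f0 : forall v, f 0%N v = 0.
Hypothesis f_cost : forall n : nat, exists s : seq I, [/\ forall i, i \in s -> (0 < j i)%N,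
  forall l, (l < n)%N -> forall v v', `|f l v - f l v'| <=
     \sum_(i <- s) (((v i).1 != (v' i).1)%:R + gam (v i).2 (v' i).2) &
  (\sum_(i <- s) rate b e c EX (j i) <= K)%E].

Lemma conditional_gap (h : O -> \bar R) : (forall o, 0 <= h o)%E ->
  {ae P, forall o, h o <= ereal_sup (range (fun l =>
     (fine (\int[k o]_v (f l v)%:E) - fine (\int[P]_o (f l (picked j o))%:E))%:E))}%E ->
  (\int[P]_o h o <= K)%E.
Proof.
move=> h0 h_sup.
apply: (integral_sup_gap mG (measurable_picked j) k_cond mf f_bound f0 _ h0 h_sup) => n B GB tB.
have [s [j0 f_lip sK]] := f_cost n.
apply: le_trans (coupled_partition j0 mf _ f_lip _ tB) _.
- by move=> l v; have /andP[] := f_bound l v.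
- by move=> l; apply: (sigma_algebra_sub_preimage G_past); exact: GB.
by apply: leeD2l.
Qed.

End conditional_law.

Let past_index (i : int) : i <= 0 -> exists l : nat, i = 0 - l%:Z.
Proof. by case: i => [[|m]|m] // _; [exists 0%N|exists m.+1; rewrite sub0r -NegzE]. Qed.

Lemma process_past B : process_gen [set i | i <= 0] V B ->
  exists2 A, measurable A & B = history @^-1` A.
Proof.
move=> [i /= i0 [A mA <-]]; rewrite setTI.
have [l il] := past_index i0.
exists ((fun u : HH => (u.1 l, g (u.2 l) : rvec R dX)) @^-1` A); last by rewrite il.
rewrite -[X in measurable X]setTI.
suff mh : measurable_fun setT (fun u : HH => (u.1 l, g (u.2 l) : rvec R dX)) by exact: mh.
apply: measurable_fun_pair.
  exact: (measurableT_comp (measurable_coord l) measurable_fst).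
apply: (measurableT_comp (measurable_funP g)).
exact: (measurableT_comp (measurable_coord l) measurable_snd).
Qed.

Lemma state_response_past B : (process_gen [set i | i <= 0] (fun t => Y t) `|`
    process_gen [set i | i <= 0] (fun t => S t)) B ->
  exists2 A, measurable A & B = history @^-1` A.
Proof.
move=> [] [i /= i0 [A mA <-]]; rewrite setTI;
  have [l il] := past_index i0.
- exists ((fun u : HH => u.1 l) @^-1` A); last by rewrite il.
  rewrite -[X in measurable X]setTI.
  exact: (measurableT_comp (measurable_coord l) measurable_fst).
- exists ((fun u : HH => u.2 l) @^-1` A); last by rewrite il.
  rewrite -[X in measurable X]setTI.
  exact: (measurableT_comp (measurable_coord l) measurable_snd).
Qed.

Lemma measurable_past G : (forall B, G B -> exists2 A, measurable A & B = history @^-1` A) ->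
  <<s G >> `<=` @measurable _ O.
Proof.
move=> GA B /(sigma_algebra_sub_preimage GA)[A mA ->].
by rewrite -[X in measurable X]setTI; exact: measurable_history.
Qed.

(** The truncated sums of rates needed for finitely many test sets are all
    bounded by the series. *)
Lemma beta_coef_le n (k : O -> probability (pathType nat (E * rvec R dX)%type) R) :
  gam = @discrete_metric R dX -> (0 < n)%N ->
  cond_dist P <<s process_gen [set i | i <= 0] V >> (tail_from V n) (fun o => k o) ->
  (beta_coef P (tail_from V n) k <= \sum_(n <= l <oo) rate b e c EX l)%E.
Proof.
move=> gamE n0 k_cond.
pose alg (x : nat * seq bitseq) := algebra_set (@path_gen R dE E dX) x.
pose f (l : nat) : pathType nat (E * rvec R dX)%type -> R :=
  if l is l'.+1 then
    if (choice.unpickle l' : option (nat * seq bitseq)) is Some x then \1_(alg x) else cst 0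
  else cst 0.
have malg x : measurable (alg x) by apply: measurable_algebra_set; exact: path_genE.
have mtail : measurable_fun setT (tail_from V n) by exact: measurable_picked.
have mV A : measurable A -> measurable (tail_from V n @^-1` A).
  by move=> mA; rewrite -[X in measurable X]setTI; exact: mtail.
pose nu : probability (pathType nat (E * rvec R dX)%type) R := distribution P (mfun_Sub (mem_set mtail)).
rewrite /beta_coef.
apply: (conditional_gap (j := fun i => (n + i)%N) (measurable_past process_past)
  process_past k_cond (f := f) (M := fun=> 1)).
- by case=> // l /=; case: choice.unpickle => // x; exact: measurable_indic.
- move=> [|l] v /=; first by rewrite lexx ler01.
  case: choice.unpickle => [x|]; last by rewrite lexx ler01.
  by rewrite indicE; case: (_ \in _); rewrite ?lexx ?ler01.
- by [].
- move=> N.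
  have local l : exists L : nat, forall v v', `|f l v - f l v'| <= \sum_(i <- iota 0 L)
      (((v i).1 != (v' i).1)%:R + gam (v i).2 (v' i).2).
    case: l => [|l]; first by exists 0%N => v v'; rewrite subrr normr0 big_nil.
    rewrite /f; case: choice.unpickle => [x|]; last first.
      by exists 0%N => v v'; rewrite subrr normr0 big_nil.
    by have [L HL] := @algebra_set_local R dE E dX x; exists L; rewrite gamE; exact: HL.
  have [L HL] := choice local.
  pose L' := (\max_(l < N) L l)%N.
  exists (iota 0 L'); split.
  + by move=> i _; rewrite addn_gt0 n0.
  + move=> l lN v v'; apply: le_trans (HL l v v') _.
    have LL : (L l <= L')%N by exact: (leq_bigmax (Ordinal lN)).
    rewrite -(subnKC LL) iotaD big_cat/= lerDl; apply: sumr_ge0 => i _.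
    by rewrite addr_ge0.
  apply: (@le_trans _ _ (\sum_(n <= l < n + L') rate b e c EX l)%E); last first.
    apply: nneseries_lim_ge => l nl _; apply: rate_ge0; exact: leq_trans nl.
  rewrite -{2}[n]add0n big_addn addKn /index_iota subn0.
  by under [leRHS]eq_bigr do rewrite addnC.
- move=> o; apply: (@le_trans _ _ `|k o set0 - P (tail_from V n @^-1` set0)|%E).
    exact: abse_ge0.
  by apply: ereal_sup_ubound; exists set0 => //; exact: measurable0.
apply: aeW => o; apply: ub_ereal_sup => _ [A mA <-].
set K := ereal_sup _; rewrite -[P _]/(nu A).
apply: (@path_sup_dist R dE E dX finE discE (k o) nu K) => // x.
apply: ereal_sup_ubound; exists (choice.pickle x).+1 => //=.
rewrite choice.pickleK.
have -> : (\int[P]_o (\1_(alg x) (picked (fun i => n + i)%N o))%:E = nu (alg x))%E.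
  transitivity (\int[P]_o (\1_(tail_from V n @^-1` alg x) o)%:E)%E.
    by apply: eq_integral.
  by rewrite integral_indic ?setIT//; apply: mV; exact: malg.
rewrite integral_indic ?setIT//.
by rewrite EFinB !fineK//; apply: fin_num_measure; exact: malg.
Qed.

Local Notation base l := (@center R dE E dX l (@origin dX l)).

Lemma past_gap_integrable l (j : 'I_l -> nat) : (EX < +oo)%E ->
  (\int[P]_o (path_dist (picked j o) (base l))%:E < +oo)%E.
Proof.
move=> finEX.
have ml1 := @measurable_l1norm R dX.
have mn i : measurable_fun setT (fun o => (l1norm (g (S (j i) o) : 'rV[R]_dX))%:E : \bar R).
  apply/measurable_EFinP; apply: (measurableT_comp ml1); exact: measurableT_comp.
apply: (@le_lt_trans _ _ (\int[P]_o \sum_(i < l) (1 + (l1norm (g (S (j i) o) : 'rV[R]_dX))%:E))%E).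
  apply: ge0_le_integral => //.
  - by move=> o _; rewrite lee_fin path_dist_ge0.
  - apply/measurable_EFinP; apply: (measurableT_comp (measurable_path_dist _ _)) => //.
    exact: measurable_picked.
  - by apply: emeasurable_sum => i; apply: emeasurable_funD.
  move=> o _; rewrite -sumEFin; apply: lee_sum => i _.
  rewrite /gamma_bar EFinD; apply: leeD; first by rewrite lee_fin; case: (_ != _).
  rewrite lee_fin /picked /center /= ffunE (_ : \row_c _ = 0) ?subr0//.
  by apply/rowP => c0; rewrite !mxE rmorph0.
rewrite ge0_integral_sum//; last first.
- by move=> i o _; rewrite adde_ge0// lee_fin l1norm_ge0.
- by move=> i; apply: emeasurable_funD.
rewrite -ge0_fin_numE; last first.
  by apply: sume_ge0 => i _; apply: integral_ge0 => o _; rewrite adde_ge0// lee_fin l1norm_ge0.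
apply: (big_ind (fun x => x \is a fin_num)) => // [x y xf yf|i _]; first by rewrite fin_numD xf yf.
rewrite ge0_integralD//; last by move=> o _; rewrite lee_fin l1norm_ge0.
rewrite fin_numD; apply/andP; split.
  rewrite (eq_integral (cst 1%E))// integral_cst// mul1e; exact: fin_num_measure.
have -> : (\int[P]_o (l1norm (g (S (j i) o) : 'rV[R]_dX))%:E = EX)%E.
  apply: (@stationary_integral (j i) (fun x => (l1norm (x : 'rV[R]_dX))%:E)).
    exact/measurable_EFinP.
  by move=> x; rewrite lee_fin l1norm_ge0.
by rewrite ge0_fin_numE//; apply: integral_ge0 => o _; rewrite lee_fin l1norm_ge0.
Qed.

Lemma tau_coef_le l (j : 'I_l -> nat) (k : O -> probability (pathType 'I_l (E * rvec R dX)%type) R) :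
  gam = @l1_metric R dX -> (EX < +oo)%E -> (forall i, (0 < j i)%N) ->
  cond_dist P <<s process_gen [set i | i <= 0] (fun t => Y t) `|`
                  process_gen [set i | i <= 0] (fun t => S t) >>
    (pick_times V j) (fun o => k o) ->
  (tau_coef P V j k <= \sum_(i < l) rate b e c EX (j i))%E.
Proof.
move=> gamE finEX j0 k_cond.
pose env (x : nat * seq (rat * {ffun 'I_l -> nat * 'rV[rat]_dX})) := @envelope R dE E dX l x.
pose f (i : nat) : pathType 'I_l (E * rvec R dX)%type -> R :=
  if i is i'.+1 then
    if (choice.unpickle i' : option (nat * seq (rat * {ffun 'I_l -> nat * 'rV[rat]_dX}))) is Some x
    then env x else cst 0
  else cst 0.
pose M (i : nat) : R :=
  if i is i'.+1 then
    if (choice.unpickle i' : option (nat * seq (rat * {ffun 'I_l -> nat * 'rV[rat]_dX}))) is Some x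
    then 2 * x.1%:R else 0
  else 0.
have mpick : measurable_fun setT (pick_times V j) by exact: measurable_picked.
have mG := measurable_past state_response_past.
pose nu : probability (pathType 'I_l (E * rvec R dX)%type) R :=
  distribution P (mfun_Sub (mem_set mpick)).
have md : measurable_fun setT (fun v : pathType 'I_l (E * rvec R dX)%type =>
    (path_dist v (base l))%:E : \bar R).
  by apply/measurable_EFinP; exact: measurable_path_dist.
have d0 v : (0 <= (path_dist v (base l))%:E :> \bar R)%E.
  by rewrite lee_fin path_dist_ge0.
have fin_nu : (\int[nu]_v (path_dist v (base l))%:E < +oo)%E.
  by rewrite ge0_integral_distribution//; exact: past_gap_integrable.
have fin_k : {ae P, forall o, \int[k o]_v (path_dist v (base l))%:E < +oo}%E.
  have mi := measurable_gen_fun mG (measurable_cond_integral_gen k_cond md d0).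
  have int_k : P.-integrable setT (fun o => \int[k o]_v (path_dist v (base l))%:E)%E.
    apply/integrableP; split => //.
    under eq_integral do rewrite gee0_abs ?integral_ge0//.
    rewrite (cond_dist_integral mG mpick k_cond _ md d0)//; last first.
      exact: (@measurableT _ (g_sigma_algebraType _)).
    exact: past_gap_integrable.
  apply: filterS (integrable_ae measurableT int_k) => o /(_ Logic.I).
  by rewrite ge0_fin_numE// integral_ge0.
rewrite /tau_coef.
apply: (conditional_gap (j := j) mG state_response_past k_cond (f := f) (M := M)).
- case=> [|i] /=; first exact: measurable_cst.
  by case: choice.unpickle => [x|]; [exact: measurable_envelope|exact: measurable_cst].
- move=> [|i] v /=; first by rewrite lexx.
  case: choice.unpickle => [[N s]|]; last by rewrite lexx.
  by rewrite envelope_ge0 envelope_le.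
- by [].
- move=> N; exists (index_enum 'I_l); split => //.
  move=> i _ v v'.
  have pd0 := path_dist_ge0 v v'.
  rewrite gamE -[leRHS]/(path_dist v v').
  case: i => [|i] /=; first by rewrite subrr normr0.
  by case: choice.unpickle => [x|]; [exact: envelope_lip|rewrite subrr normr0].
- by move=> o; exact: (@W1_ge0 R dE E dX l (k o) nu).
apply: filterS fin_k => o fin_ko.
apply: (@W1_le_envelope R dE E dX l finE discE (k o) nu) => // x.
apply: ereal_sup_ubound; exists (choice.pickle x).+1 => //=.
rewrite choice.pickleK; congr (_ - fine _)%:E.
rewrite ge0_integral_distribution//.
- by apply/measurable_EFinP; exact: measurable_envelope.
- by move=> v; rewrite lee_fin envelope_ge0.
Qed.

(** With [l] observation times the sum of the rates is at most [l] times their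
    supremum, which the factor [l^-1] cancels. *)
Lemma tau_sup_le (kU : forall l, ('I_l -> nat) ->
    O -> probability (pathType 'I_l (E * rvec R dX)%type) R) n :
  gam = @l1_metric R dX -> (EX < +oo)%E -> (0 < n)%N ->
  (forall l (j : 'I_l -> nat), (0 < l)%N -> increasing j ->
     cond_dist P <<s process_gen [set i | i <= 0] (fun t => Y t) `|`
                     process_gen [set i | i <= 0] (fun t => S t) >>
       (pick_times V j) (fun o => kU l j o)) ->
  (tau_sup P V kU n <= ereal_sup [set rate b e c EX j | j in [set j | (n <= j)%N]])%E.
Proof.
move=> gamE finEX n0 k_cond; set K := ereal_sup _.
have rateK i : (n <= i)%N -> (rate b e c EX i <= K)%E.
  by move=> ni; apply: ereal_sup_ubound; exists i.
have K0 : (0 <= K)%E by apply: le_trans (rateK n (leqnn n)); exact: rate_ge0.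
apply: ub_ereal_sup => _ [m _ <-]; rewrite /tau_upto big_nat.
apply: (big_ind (fun x => x <= K)%E) => [|x y xK yK|l /andP[l0 _]].
- exact: leNye.
- by rewrite ge_max xK.
have l0' : (0 : R) < l%:R by rewrite ltr0n.
rewrite -lee_pdivlMl ?invr_gt0// invrK.
apply: ub_ereal_sup => _ [j [j_inc nj] <-].
apply: (@le_trans _ _ (\sum_(i < l) rate b e c EX (j i))%E).
  apply: tau_coef_le => //; last exact: k_cond.
  by move=> i; exact: leq_trans (nj i).
apply: (@le_trans _ _ (\sum_(i < l) K)%E); first by apply: lee_sum => i _; exact: rateK.
by rewrite sumr_const card_ord mule_natl.
Qed.

End process.

Theorem theorem2 (R : realType)
  (dO : measure_display) (O : measurableType dO) (P : probability O R)
  (dE : measure_display) (E : measurableType dE)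
  (finE : finite_set [set: E]) (discE : forall A : set E, measurable A)
  (dX : nat) (Sp : ptopologicalType) (polSp : polish R Sp)
  (S : int -> {mfun O >-> borelType Sp})
  (g : {mfun borelType Sp >-> rvec R dX})
  (Y : int -> {mfun O >-> E})
  (q : E -> (nat -> E) -> (nat -> rvec R dX) -> R)
  (D : set (pathType int (rvec R dX)))
  (P0 : R.-pker (borelType Sp) ~> (pathType nat (borelType Sp)))
  (Pt : R.-pker (borelType Sp * borelType Sp) ~>
          (pathType nat (borelType Sp) * pathType nat (borelType Sp))%type)
  (gam : 'rV[R]_dX -> 'rV[R]_dX -> R)
  (e : nat -> R) :
  let X (t : int) (o : O) : rvec R dX := g (S t o) in
  let V (t : int) (o : O) : E * rvec R dX := (Y t o, X t o) in
  let b := coef_b q D in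
  let a := coef_a (distribution P (S 0)) Pt g gam in
  let EX : \bar R := (\int[P]_o (l1norm (X 0 o))%:E)%E in
  (* D and q *)
  measurable D ->
  P [set o | D (fun t => X t o)] = 1%E ->
  (forall t : int, measurable_fun
     [set u : E * pathType nat E * pathType int (rvec R dX) | D u.2]
     (fun u => q u.1.1 u.1.2 (past u.2 t))) ->
  (forall w y z, histories D z -> 0 < q w y z < 1) ->
  (forall y z, histories D z -> \sum_(w \in [set: E]) q w y z = 1) ->
  (* the chain S and the conditional law P0 of its future *)
  stationary P (fun t => S t) ->
  markov_chain P (fun t => S t) ->
  cond_dist P <<s process_gen [set 0 : int] (fun t => S t) >>
    (future (fun t => S t)) (fun o => P0 (S 0 o)) ->
  (* the response Y *)
  (forall (t : int) (w : E),
     cond_prob_is P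
       <<s process_gen [set j | j <= t - 1] (fun t => Y t) `|`
           process_gen [set: int] (fun t => S t) >>
       (Y t @^-1` [set w])
       (fun o => q w (past (fun s => Y s o) (t - 1))
                     (past (fun s => X s o) t))) ->
  (* the coupling kernel and the metric *)
  coupling_kernel P0 Pt ->
  gam = @discrete_metric R dX \/ gam = @l1_metric R dX ->
  (* (S1) *)
  stationary P X -> ergodic P X ->
  (* (S1') *)
  a @ \oo --> 0%E ->
  (* (S2) *)
  b 0%N < 1 -> (\sum_(0 <= m <oo) (b m)%:E < +oo)%E ->
  (* (S3) *)
  (forall m, 0 <= e m) -> (\sum_(1 <= m <oo) (e m)%:E < +oo)%E ->
  (forall y z z', histories D z -> histories D z' ->
     ((dTV (fun w => q w y z) (fun w => q w y z'))%:E <=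
      \sum_(0 <= i <oo) (e i * l1norm (z i - z' i : 'rV[R]_dX))%:E)%E) ->
  (gam = @discrete_metric R dX ->
   forall p : \bar R, (1 <= p)%E ->
   let NX := 'N[P]_p[(fun o => (l1norm (X 0 o))%:E)]%E in
   (NX < +oo)%E ->
   let c (t : nat) : \bar R :=
     (maxe 1 (2%:E * NX) * a t `^ fine ((hoelder_conjugate p)^-1)%E)%E in
   forall kV : nat -> O -> probability (pathType nat (E * rvec R dX)%type) R,
   (forall n, cond_dist P <<s process_gen [set i | i <= 0] V >>
      (tail_from V n) (fun o => kV n o)) ->
   forall n : nat, (0 < n)%N ->
   (beta_coef P (tail_from V n) (kV n)
    <= \sum_(n <= j <oo) rate b e c EX j)%E)
  /\
  (gam = @l1_metric R dX ->
   (EX < +oo)%E ->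
   forall kU : (forall l, ('I_l -> nat) ->
     O -> probability (pathType 'I_l (E * rvec R dX)%type) R),
   (forall l (j : 'I_l -> nat), (0 < l)%N -> increasing j ->
      cond_dist P
        <<s process_gen [set i | i <= 0] (fun t => Y t) `|`
            process_gen [set i | i <= 0] (fun t => S t) >>
        (pick_times V j) (fun o => kU l j o)) ->
   forall n : nat, (0 < n)%N ->
   (tau_sup P V kU n
    <= ereal_sup [set rate b e a EX j | j in [set j | (n <= j)%N]])%E).
Proof.
move=> X V b a EX mD PD mq q01 q1 _ SM SP0 Yq PtP0 gamE stX _ _ b0_lt1 b_sum e0 _ q_lip.
have gam0 x x' : 0 <= gam x x'.
  by case: gamE => ->; [exact: ler0n|exact: l1_metric_ge0].
have gamxx x : gam x x = 0.
  by case: gamE => ->; rewrite ?/discrete_metric ?eqxx// /l1_metric subrr l1norm0.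
have mgam : measurable_fun setT (fun u : rvec R dX * rvec R dX => gam u.1 u.2).
  by case: gamE => ->; [exact: measurable_discrete_metric|exact: measurable_l1_metric].
split=> [gam_discrete p p1 NX finNX c kV kV_cond n n0|gam_l1 finEX kU kU_cond n n0].
- have /andP[r0 r1] := hoelder_conjugate_inv p1.
  set r := fine _ in r0 r1.
  have a_pow t : (0 <= a t `^ r)%E by exact: poweR_ge0.
  apply: (beta_coef_le finE discE mD PD mq q01 q1 SM SP0 Yq b0_lt1 b_sum PtP0 e0 q_lip
    gam0 gamxx mgam stX _ _ gam_discrete n0 (kV_cond n)) => t t0.
  + apply: le_trans (integral_gap_discrete finE discE mD PD mq q01 q1 SM SP0 Yq b0_lt1
      b_sum PtP0 gam0 gamxx mgam stX gam_discrete p1 t0) _.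
    by apply: lee_wpmul2r; [exact: a_pow|rewrite le_max lexx orbT].
  rewrite (integral_gap P S g Pt gam0 mgam t0).
  apply: (le_trans (coef_a_le_power P S g Pt gam0 mgam gam_discrete _ t0)).
    by apply/andP; split; [exact: r0|exact: r1].
  rewrite -[leLHS]mul1e; apply: lee_wpmul2r; first exact: a_pow.
  by rewrite le_max lexx.
apply: (tau_sup_le finE discE mD PD mq q01 q1 SM SP0 Yq b0_lt1 b_sum PtP0 e0 q_lip
  gam0 gamxx mgam stX _ _ gam_l1 finEX n0 kU_cond) => t t0.
- by rewrite /a -(integral_gap P S g Pt gam0 mgam t0) gam_l1.
- by rewrite /a -(integral_gap P S g Pt gam0 mgam t0).
Qed.
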